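(* Let $N\ge 2$, $n\ge 1$, $\tau\ge 1$, $K\ge 1$ be integers, let $f_i(x)=\mathbb{E}_{\xi_i\sim D_i}[f_i(x,\xi_i)]$, $i=1,\dots,N$, be differentiable functions on $\mathbb{R}^n$ and $f=\frac1N\sum_{i=1}^N f_i$. Assume: (i) there is $L>0$ with $\|\nabla f_i(x)-\nabla f_i(y)\|\le L\|x-y\|$ for all $x,y\in\mathbb{R}^n$ and all $i$; (ii) $f$ attains its minimum over $\mathbb{R}^n$, and $x^*$ is a minimizer; (iii) the mixing matrix $W\in\mathbb{R}^{N\times N}$ of a connected undirected graph satisfies the mixing conditions stated in the context; (iv) there is $\sigma\ge 0$ such that for all $x\in\mathbb{R}^n$ and all $i$, $\mathbb{E}_{\xi_i\sim D_i}[\nabla f_i(x,\xi_i)]=\nabla f_i(x)$ and $\mathbb{E}_{\xi_i\sim D_i}[\|\nabla f_i(x,\xi_i)-\nabla f_i(x)\|^2]\le\sigma^2$. Let $\xi\in(0,\frac{2}{\tau+3})$, let $x_i(t)$ be generated by the stochastic-gradient version of the algorithm MILE (defined in the context) with stepsize $\alpha$, and let $\rho$ and $B_2$ be the constants defined in the context. If $0<\alpha\le\frac{1}{\sqrt{13B_2}\,L}$, then, with $T=\tau+\tau K$, $$\frac{1}{T}\sum_{t=1}^{T}\mathbb{E}[\|\nabla f(\overline{X}(t))\|^2]\le \frac{2\mathbb{E}[f(\overline{X}(1))]-2f(x^* )}{\alpha\tau K}+\frac{2\mathbb{E}[\|X(1)\|_F^2]+2\mathbb{E}[\|X(0)\|_F^2]}{\alpha^2\rho^2\tau^4K}+\frac{12\mathbb{E}[\|X(1)\|_F^2]+12\mathbb{E}[\|X(0)\|_F^2]}{\tau^3\alpha^2K}+\frac{6\,\mathbb{E}[\|\overline{\nabla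 f}(X(0))\|^2]}{\tau^3K}+L\alpha\sigma^2+156B_2\alpha^2L^2\sigma^2.$$
   Context: Network and mixing matrix. $\mathcal{G}=(\mathcal{V},\mathcal{E})$ is a connected undirected graph on $\mathcal{V}=\{1,\dots,N\}$. The matrix $W=(w_{ij})\in\mathbb{R}^{N\times N}$ satisfies: (1) $w_{ij}=0$ if $i\ne j$ and $(i,j)\notin\mathcal{E}$; (2) $W=W^{\top}$; (3) $\mathrm{Null}(\mathbf{I}_N-W)=\mathrm{span}(\mathbf{1}_N)$; (4) $2\mathbf{I}_N\succeq W+\mathbf{I}_N\succ 0$. Its eigenvalues then satisfy $1=\lambda_1>\lambda_2\ge\dots\ge\lambda_N>-1$. Algorithm MILE with stochastic gradients. Parameters: number of local updates $\tau\in\{1,2,\dots\}$, stepsize $\alpha>0$, weight $\xi\in(0,\frac{2}{\tau+3})$ (a real number, not to be confused with the random samples $\xi_i$, $\xi_i(t)$). For each $i$ and $t\ge -1$, $\xi_i(t)\sim D_i$ is a sample drawn at iteration $t$ from the local data distribution $D_i$ of agent $i$, independently of all samples $\xi_j(s)$, $s<t$, $j=1,\dots,N$; write $g_i(t)=\nabla f_i(x_i(t),\xi_i(t))$. Put $\widetilde w_{ii}=(1-\xi)+\xi w_{ii}$ and $\widetilde w_{ij}=\xi w_{ij}$ for $j\ne i$. The values $x_i(-1)\in\mathbb{R}^n$ are arbitrary (deterministic) and $x_i(0)=x_i(-1)-\alpha g_i(-1)$. For $t=0,1,2,\dots$ and each $i$: if $t \bmod \tau=0$, $$x_i(t+1)=\sum_{j=1}^N\widetilde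 w_{ij}\bigl\{2x_j(t)-x_j(t-1)-\alpha g_j(t)+\alpha g_j(t-1)\bigr\};$$ otherwise $$x_i(t+1)=2x_i(t)-x_i(t-1)-\alpha g_i(t)+\alpha g_i(t-1).$$ Notation. $X(t)=[x_1(t),\dots,x_N(t)]\in\mathbb{R}^{n\times N}$, $\overline X(t)=\frac1N\sum_{i=1}^N x_i(t)$, $\overline{\nabla f}(X(t))=\frac1N\sum_{i=1}^N\nabla f_i(x_i(t))$ (exact gradients); $\|\cdot\|$ is the Euclidean norm and $\|\cdot\|_F$ the Frobenius norm. Constants. $\rho_i=1-\xi+\xi\lambda_i$, $\rho=\rho_2=1-\xi+\xi\lambda_2$, $$A_1=\max_{2\le i\le N}\frac{2\tau}{\sqrt{4\rho_i-[\rho_i(\tau+1)+1-\tau]^2}},$$ $$A_3=\max\left\{\frac{2\sqrt\rho+2}{\sqrt{4\rho-[\rho(\tau+1)+(1-\tau)]^2}},\ \frac{2\sqrt\rho\,\bigl(1+|\tau\sqrt\rho-\frac{\tau-1}{\sqrt\rho}|\bigr)}{\sqrt{4\rho-[\rho(\tau+1)+(1-\tau)]^2}}\right\},$$ $A_4=\max\{A_1,A_3\}$, and $$B_2=3\tau^4+\frac{\tau^2(\tau+1)(2\tau+1)(\rho\tau+\tau-1)^2}{2(1-\sqrt\rho)^2}A_4^2.$$ *)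

(* Defs.v *)
From HB Require Import structures.
From mathcomp Require Import all_boot all_order all_algebra.
From mathcomp Require Import all_classical all_reals all_analysis.

Set Implicit Arguments.
Unset Strict Implicit.
Unset Printing Implicit Defensive.

Import Order.TTheory GRing.Theory Num.Theory.
Import numFieldNormedType.Exports.

Local Open Scope classical_set_scope.
Local Open Scope ring_scope.

(* The library norm on matrices is the sup norm, hence this definition.  On a
   column vector it is the Euclidean norm. *)
Definition frob {R : realType} {m n : nat} (A : 'M[R]_(m, n)) : R :=
  Num.sqrt (\sum_i \sum_j A i j ^+ 2).

Definition gradient {R : realType} {n : nat} (h : 'cV[R]_n -> R)
    (y : 'cV[R]_n) : 'cV[R]_n :=
  \col_k 'D_(delta_mx k 0) h y.

Definition average {R : realType} {N : nat} {V : lmodType R}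
    (v : 'I_N -> V) : V :=
  N%:R^-1 *: \sum_i v i.

Section Mixing.
Context {R : realType} {N : nat}.

Definition psd (A : 'M[R]_N) : Prop :=
  forall v : 'cV[R]_N, 0 <= (v^T *m A *m v) 0 0.

Definition posdef (A : 'M[R]_N) : Prop :=
  forall v : 'cV[R]_N, v != 0 -> 0 < (v^T *m A *m v) 0 0.

Definition connected_graph (e : rel 'I_N) : Prop :=
  symmetric e /\ forall i j, connect e i j.

Definition mixing_matrix (e : rel 'I_N) (W : 'M[R]_N) : Prop :=
  [/\ forall i j, i != j -> ~~ e i j -> W i j = 0,
      W^T = W,
      forall v : 'cV[R]_N,
        (1%:M - W) *m v = 0 <-> exists c : R, v = const_mx c
    & psd (2%:M - (W + 1%:M)) /\ posdef (W + 1%:M)].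

(* lam lists the eigenvalues of W with multiplicity, in nonincreasing order;
   lambda_i is lam`_i.-1. *)
Definition spectrum (W : 'M[R]_N) (lam : seq R) : Prop :=
  char_poly W = \prod_(l <- lam) ('X - l%:P) /\ sorted >=%R lam.

Definition Wtilde (xi : R) (W : 'M[R]_N) : 'M[R]_N :=
  \matrix_(i, j) if i == j then 1 - xi + xi * W i i else xi * W i j.

End Mixing.

Section Constants.
Context {R : realType}.
Implicit Types (N tau : nat) (xi : R) (lam : seq R).

Definition rho_ xi lam (i : nat) : R := 1 - xi + xi * lam`_i.-1.

Definition rho xi lam : R := rho_ xi lam 2.

Definition disc tau (r : R) : R :=
  Num.sqrt (4 * r - (r * (tau%:R + 1) + (1 - tau%:R)) ^+ 2).

(* The terms are nonnegative, so 0 is a neutral starting value for the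
   maximum. *)
Definition A1 N tau xi lam : R :=
  \big[Num.max/0]_(2 <= i < N.+1) (2 * tau%:R / disc tau (rho_ xi lam i)).

Definition A3 tau xi lam : R :=
  let r := rho xi lam in
  let s := Num.sqrt r in
  Num.max ((2 * s + 2) / disc tau r)
          (2 * s * (1 + `|tau%:R * s - (tau%:R - 1) / s|) / disc tau r).

Definition A4 N tau xi lam : R := Num.max (A1 N tau xi lam) (A3 tau xi lam).

Definition B2 N tau xi lam : R :=
  let t : R := tau%:R in
  let r := rho xi lam in
  3 * t ^+ 4 +
  t ^+ 2 * (t + 1) * (2 * t + 1) * (r * t + t - 1) ^+ 2
    / (2 * (1 - Num.sqrt r) ^+ 2) * A4 N tau xi lam ^+ 2.

End Constants.

(* Time is an int; every process is only constrained, and only used, at times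
   t >= -1. *)
Section Sampling.
Context {R : realType} {N n : nat}.
Context {dS : 'I_N -> measure_display} {S : forall i, measurableType (dS i)}.
Context {d : measure_display} {Omega : measurableType d}.
Variable P : probability Omega R.
Implicit Types (zeta : forall i, int -> {RV P >-> S i}).

(* Generated by the samples of all the agents at times s < t. *)
Definition past_sigma zeta (t : int) : set (set Omega) :=
  <<s [set E | exists (j : 'I_N) (s : int), (-1 <= s) && (s < t) /\
         preimage_set_system setT (zeta j s) measurable E] >>.

(* No independence is required between the samples of different agents at the
   same time. *)
Definition fresh_samples (D : forall i, probability (S i) R) zeta : Prop :=
  forall (i : 'I_N) (t : int), -1 <= t ->
    (forall B, measurable B -> distribution P (zeta i t) B = D i B) /\
    (forall A B : set Omega,
       preimage_set_system setT (zeta i t) measurable A ->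
       past_sigma zeta t B ->
       P (A `&` B) = (P A * P B)%E).

Variable F : forall i, 'cV[R]_n -> S i -> R.
Variable zeta : forall i, int -> {RV P >-> S i}.

Definition stoch_grad (x : 'I_N -> int -> Omega -> 'cV[R]_n)
    (i : 'I_N) (t : int) (w : Omega) : 'cV[R]_n :=
  gradient (fun y => F y (zeta i t w)) (x i t w).

Definition MILE (W : 'M[R]_N) (tau : nat) (xi alpha : R)
    (xinit : 'I_N -> 'cV[R]_n) (x : 'I_N -> int -> Omega -> 'cV[R]_n) : Prop :=
  let g := stoch_grad x in
  let step (j : 'I_N) (t : int) w :=
    2 *: x j t w - x j (t - 1) w - alpha *: g j t w + alpha *: g j (t - 1) w in
  [/\ forall i w, x i (-1) w = xinit i,
      forall i w, x i 0 w = x i (-1) w - alpha *: g i (-1) w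
    & forall (t : nat) i w,
        x i (t%:Z + 1) w =
        if (t %% tau == 0)%N then \sum_j Wtilde xi W i j *: step j t w
        else step i t w].

End Sampling.

(* Differentiability is required for every sample s, not only almost every one,
   so that the stochastic gradient is meaningful at the iterates. *)
Definition stoch_objective {R : realType} {N n : nat}
    {dS : 'I_N -> measure_display} {S : forall i, measurableType (dS i)}
    (D : forall i, probability (S i) R)
    (F : forall i, 'cV[R]_n -> S i -> R) (f : 'I_N -> 'cV[R]_n -> R) : Prop :=
  forall i, (forall s y, differentiable (fun z => F i z s) y) /\
    (forall y, (D i).-integrable setT (fun s => (F i y s)%:E) /\
       ('E_(D i)[F i y] = (f i y)%:E)%E).

(* The expectation of a vector is taken componentwise; a component is measurable
   as a limit of difference quotients, and then its integral being a real number
   entails its integrability. *)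
Definition unbiased_bounded_variance {R : realType} {N n : nat}
    {dS : 'I_N -> measure_display} {S : forall i, measurableType (dS i)}
    (D : forall i, probability (S i) R)
    (F : forall i, 'cV[R]_n -> S i -> R) (f : 'I_N -> 'cV[R]_n -> R)
    (sigma : R) : Prop :=
  forall i y,
    (forall k, 'E_(D i)[fun s => (gradient (fun z => F i z s) y k 0)%R]
               = (gradient (f i) y k 0%R)%:E)%E /\
    ('E_(D i)[fun s => (frob (gradient (fun z => F i z s) y
                                - gradient (f i) y) ^+ 2)%R]
       <= (sigma ^+ 2)%:E)%E.

Section Network.
Context {R : realType} {N n : nat} {Omega : Type}.
Variable x : 'I_N -> int -> Omega -> 'cV[R]_n.

Definition Xmat (t : int) (w : Omega) : 'M[R]_(n, N) :=
  \matrix_(k, i) x i t w k 0.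

Definition Xbar (t : int) (w : Omega) : 'cV[R]_n :=
  average (fun i => x i t w).

Definition avg_gradient (f : 'I_N -> 'cV[R]_n -> R) (t : int) (w : Omega)
    : 'cV[R]_n :=
  average (fun i => gradient (f i) (x i t w)).

End Network.

(* Main.v *)
Require Import Defs.
From HB Require Import structures.
From mathcomp Require Import all_boot all_order all_algebra.
From mathcomp Require Import all_classical all_reals all_analysis.
From mathcomp Require Import measurable_realfun zify ring lra.

Set Implicit Arguments.
Unset Strict Implicit.
Unset Printing Implicit Defensive.

Import Order.TTheory GRing.Theory Num.Theory.
Import numFieldNormedType.Exports.

Local Open Scope classical_set_scope.
Local Open Scope ring_scope.

(** The average iterate and the deviations from it are analysed separately.

    The modified mixing matrix is symmetric with row sums 1, so mixing does not
    change the average of the agents, and the correction term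
    [x(t) - x(t-1) + alpha g(t-1)] averages to zero at every time.  Hence the
    average performs plain stochastic gradient descent with the averaged
    stochastic gradient ([Xbar_step]).  The descent lemma then bounds the
    expected decrease of [f] in terms of the squared gradient at the average,
    the squared average gradient, the deviations (through the difference of
    these two gradients) and the noise ([expected_descent]).

    For the deviations, [W] is diagonalised ([mixing_spectrum]).  In the mode
    of an eigenvalue [l < 1] the iterates move along a straight line during a
    round, up to a drift caused by the variation of the gradients, and the
    update that leads to the next round carries a factor [r = 1 - xi + xi l].
    The values at the starts of the rounds therefore satisfy a second-order recursion
    [a(k+2) = tr a(k+1) - r a(k) + forcing], [tr = r (tau+1) + 1 - tau]
    ([round_rec]).  The condition [xi (tau+3) < 2] makes its characteristic
    roots nonreal ([mode_disc_pos]); they then have modulus [sqrt r], the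
    form [x1^2 - tr x1 x0 + r x0^2] is positive definite, the free recursion
    multiplies it by exactly [r], and the forced one multiplies it by
    at most [sqrt r], up to a multiple of the squared forcing ([energy_step]).  Summing over
    rounds and modes bounds the total squared deviation by the initial data
    plus [B2 alpha^2] times the total squared increment of the stochastic
    gradients ([consensus_bound]).  This holds for each trajectory, no
    expectation is taken.

    By smoothness an increment of the gradients is bounded by the displacement
    of the iterates and by the noise; the displacement is in turn bounded by
    the deviations and the step of the average ([Xmat_increment]).  The total
    deviation thus appears on both sides, with factor [12 B2 alpha^2 L^2 <=
    12/13] on the right, and can be solved for ([consensus_solved]).  Inserting
    the result in the telescoped descent inequality, the squared average
    gradients are absorbed and the remaining constants compared
    ([final_combination]).

    On the probabilistic side, a sample independent of the past has with it a
    product joint law ([fresh_law]); so the noise at a point determined by the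
    past has second moment at most [sigma^2] and is orthogonal to every
    square integrable variable determined by the past
    ([noise_orthogonal]).  Measurability of the gradients comes from
    a Caratheodory argument ([measurable_caratheodory]), square
    integrability of the iterates from an induction on time
    ([sq_adapted_iterates]). *)

(** * Scalar recursions: one eigenmode over the rounds of local updates *)

Lemma sum_cauchy_schwarz (R : realFieldType) (I : finType) (a b : I -> R) :
  (\sum_i a i * b i) ^+ 2 <= (\sum_i a i ^+ 2) * (\sum_i b i ^+ 2).
Proof.
have : 0 <= \sum_i \sum_j (a i * b j - a j * b i) ^+ 2.
  by apply: sumr_ge0 => i _; apply: sumr_ge0 => j _; exact: sqr_ge0.
have -> : \sum_i \sum_j (a i * b j - a j * b i) ^+ 2
   = 2 * ((\sum_i a i ^+ 2) * (\sum_i b i ^+ 2) - (\sum_i a i * b i) ^+ 2).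
  rewrite expr2 !big_distrlr /= -sumrB.
  under [X in _ = 2 * X]eq_bigr do rewrite -sumrB.
  rewrite mulrDl mul1r.
  rewrite [X in _ = X + _]exchange_big /= -big_split /=.
  apply: eq_bigr => i _; rewrite -big_split /=; apply: eq_bigr => j _; ring.
by rewrite pmulr_rge0 ?subr_ge0.
Qed.

(** The recursion [x'' = tr x' - s^2 x + b] with [tr^2 <= 4 s^2], whose
    characteristic roots have modulus [s < 1]. *)
Section Oscillator.
Variables (R : realFieldType) (s tr : R).
Hypotheses (s0 : 0 < s) (s1 : s < 1).
Hypothesis tr_le : tr ^+ 2 <= 4 * s ^+ 2.

(** The quadratic form preserved by the companion matrix up to its determinant
    [s^2]. *)
Definition energy (x1 x0 : R) : R := x1 ^+ 2 - tr * x1 * x0 + s ^+ 2 * x0 ^+ 2.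

Lemma energy_coercive x1 x0 :
  (4 * s ^+ 2 - tr ^+ 2) * x1 ^+ 2 <= 4 * s ^+ 2 * energy x1 x0.
Proof.
rewrite -subr_ge0.
have -> : 4 * s ^+ 2 * energy x1 x0 - (4 * s ^+ 2 - tr ^+ 2) * x1 ^+ 2
   = (tr * x1 - 2 * s ^+ 2 * x0) ^+ 2 by rewrite /energy; ring.
exact: sqr_ge0.
Qed.

Lemma energy_ge0 x1 x0 : 0 <= energy x1 x0.
Proof.
have p : 0 < 4 * s ^+ 2 by rewrite mulr_gt0 ?exprn_gt0.
rewrite -(pmulr_rge0 _ p); apply: le_trans (energy_coercive _ _).
by rewrite mulr_ge0 ?sqr_ge0// subr_ge0.
Qed.

(** The free recursion multiplies the energy by [s^2]; Young's inequality gives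
    up the factor [s^2] for [s] in order to separate the forcing [b] from the
    cross term [2 b u], where [u^2 <= s^2 energy]. *)
Lemma energy_step x1 x0 b :
  energy (tr * x1 - s ^+ 2 * x0 + b) x1 <= s * energy x1 x0 + b ^+ 2 / (1 - s).
Proof.
set u := tr * x1 / 2 - s ^+ 2 * x0.
have u_le : u ^+ 2 <= s ^+ 2 * energy x1 x0.
  rewrite -subr_ge0.
  have -> : s ^+ 2 * energy x1 x0 - u ^+ 2 = (4 * s ^+ 2 - tr ^+ 2) * x1 ^+ 2 / 4.
    by rewrite /u /energy; field.
  apply: divr_ge0; last exact: ler0n.
  by apply: mulr_ge0; rewrite ?sqr_ge0 ?subr_ge0.
have -> : energy (tr * x1 - s ^+ 2 * x0 + b) x1
    = s ^+ 2 * energy x1 x0 + b ^+ 2 + 2 * b * u.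
  by rewrite /u /energy; field.
have t0 : 0 < 1 - s by rewrite subr_gt0.
have step : s * (1 - s) * (2 * b * u)
    <= (1 - s) ^+ 2 * (s ^+ 2 * energy x1 x0) + s ^+ 2 * b ^+ 2.
  apply: (@le_trans _ _ ((1 - s) ^+ 2 * u ^+ 2 + s ^+ 2 * b ^+ 2)).
    rewrite -subr_ge0 (_ : _ - _ = ((1 - s) * u - s * b) ^+ 2) ?sqr_ge0//; ring.
  by rewrite lerD2r ler_wpM2l ?sqr_ge0.
rewrite -subr_ge0 -(pmulr_rge0 _ (mulr_gt0 s0 t0)).
rewrite (_ : _ * _ = (1 - s) ^+ 2 * (s ^+ 2 * energy x1 x0) + s ^+ 2 * b ^+ 2
   - s * (1 - s) * (2 * b * u)) ?subr_ge0//.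
by field; rewrite gt_eqF.
Qed.

Lemma energy_sum (x b : nat -> R) :
  (forall k, x k.+2 = tr * x k.+1 - s ^+ 2 * x k + b k) ->
  forall m, (1 - s) ^+ 2 * \sum_(k < m.+1) energy (x k.+1) (x k)
    <= (1 - s) * energy (x 1%N) (x 0%N) + \sum_(k < m) b k ^+ 2.
Proof.
move=> xE m.
have t0 : 0 < 1 - s by rewrite subr_gt0.
have H : (1 - s) * \sum_(k < m) energy (x k.+1) (x k) + energy (x m.+1) (x m)
   <= energy (x 1%N) (x 0%N) + (\sum_(k < m) b k ^+ 2) / (1 - s).
  elim: m => [|m IH]; first by rewrite !big_ord0; lra.
  rewrite !big_ord_recr /= xE mulrDl mulrDr.
  have := energy_step (x m.+1) (x m) (b m); lra.
rewrite big_ord_recr /=.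
have := ler_wpM2l (ltW t0) H.
rewrite [X in _ <= X]mulrDr [X in _ <= _ + X]mulrC divfK ?gt_eqF//.
have := mulr_ge0 (mulr_ge0 (ltW t0) (ltW s0)) (energy_ge0 (x m.+1) (x m)).
lra.
Qed.

End Oscillator.

Section LocalUpdates.
Variables (R : realFieldType) (alpha : R) (h : nat -> R).

(** The deviation from the straight line through [y t0] and [y t0.+1] that the
    variation of [h] produces in [j] local updates. *)
Definition drift (t0 j : nat) : R := - (alpha * \sum_(s < j) (h (t0 + s) - h t0)).

Lemma driftS t0 j : drift t0 j.+1 = drift t0 j - alpha * (h (t0 + j) - h t0).
Proof. by rewrite /drift big_ord_recr /=; ring. Qed.

Lemma drift0 t0 : drift t0 0 = 0.
Proof. by rewrite /drift big_ord0 mulr0 oppr0. Qed.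

Lemma increments_telescope t0 j :
  \sum_(s < j) (h (t0 + s).+1 - h (t0 + s)) = h (t0 + j) - h t0.
Proof.
elim: j => [|j IH]; first by rewrite big_ord0 addn0 subrr.
rewrite big_ord_recr /= IH addnS; ring.
Qed.

(** The sum of [i^2] for [i < j]; that it vanishes at [j = 1] is what makes the
    case [tau = 1] fit the same constants as the others. *)
Definition square_pyramidal (j : nat) : R := j%:R * (j%:R - 1) * (2 * j%:R - 1) / 6.

Lemma square_pyramidal_le j : square_pyramidal j <= j%:R ^+ 3 / 3.
Proof.
case: j => [|j]; rewrite /square_pyramidal; first lra.
have : 1 <= j.+1%:R :> R by rewrite ler1n.
nra.
Qed.

Lemma sum_squares j : \sum_(s < j) ((j - s.+1)%:R : R) ^+ 2 = square_pyramidal j.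
Proof.
rewrite (reindex_inj rev_ord_inj) /=.
have -> : \sum_(s < j) ((j - (j - s.+1).+1)%:R : R) ^+ 2 = \sum_(s < j) s%:R ^+ 2.
  by apply: eq_bigr => s _; rewrite subnSK // subKn // ltnW.
elim: j => [|j IH]; first by rewrite big_ord0 /square_pyramidal; ring.
by rewrite big_ord_recr /= IH /square_pyramidal -[j.+1]addn1 natrD; field.
Qed.

(** By summation by parts, [drift t0 j] is a combination of the increments of
    [h] with weights [j-1, ..., 1, 0]. *)
Lemma drift_sqr t0 j : drift t0 j ^+ 2
  <= alpha ^+ 2 * (square_pyramidal j * \sum_(s < j) (h (t0 + s).+1 - h (t0 + s)) ^+ 2).
Proof.
have -> : drift t0 j ^+ 2 = alpha ^+ 2 *
    (\sum_(s < j) (j - s.+1)%:R * (h (t0 + s).+1 - h (t0 + s))) ^+ 2.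
  rewrite /drift sqrrN exprMn; congr (_ * _ ^+ 2).
  elim: j => [|j IH]; first by rewrite !big_ord0.
  rewrite big_ord_recr /= IH -(increments_telescope t0 j) -big_split /=.
  rewrite [RHS]big_ord_recr /= subnn mul0r addr0.
  apply: eq_bigr => s _; rewrite subSS -(subnSK (ltn_ord s)).
  by rewrite -[(_ - _).+1]addn1 natrD; ring.
rewrite ler_wpM2l ?sqr_ge0//.
apply: le_trans (sum_cauchy_schwarz _ _) _.
by rewrite sum_squares.
Qed.

Variables (y : nat -> R) (t0 m : nat).
Hypothesis local_step : forall j, (j.+1 < m)%N ->
  y (t0 + j.+2) = 2 * y (t0 + j.+1) - y (t0 + j)
    - alpha * (h (t0 + j.+1) - h (t0 + j)).

(** Local updates add to the last displacement only an increment of [h], so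
    without such increments the iterates would move at constant speed. *)
Lemma local_updates_affine j : (j <= m)%N ->
  y (t0 + j) = y t0 + j%:R * (y t0.+1 - y t0) + drift t0 j.
Proof.
suff H i : (i.+1 <= m)%N ->
   y (t0 + i) = y t0 + i%:R * (y t0.+1 - y t0) + drift t0 i /\
   y (t0 + i.+1) = y t0 + i.+1%:R * (y t0.+1 - y t0) + drift t0 i.+1.
  case: j => [|j] jm; first by rewrite addn0 drift0; ring.
  by have [] := H j jm.
elim: i => [|i IH] im.
  by rewrite driftS !drift0 addn0 addn1; split; ring.
have [E0 E1] := IH (ltnW im); split => //.
rewrite local_step // E1 E0 !driftS -[i.+2]addn2 -[i.+1]addn1 !natrD; ring.
Qed.

End LocalUpdates.

Lemma sum_by_rounds (R : nmodType) (tau K : nat) (u : nat -> R) :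
  \sum_(t < K * tau) u t = \sum_(k < K) \sum_(j < tau) u (k * tau + j)%N.
Proof.
elim: K => [|K IH]; first by rewrite mul0n !big_ord0.
by rewrite big_ord_recr /= -IH mulSnr big_split_ord.
Qed.

(** One mode: [y] and [h] are the coordinates of the iterates and of the
    stochastic gradients along an eigenvector whose mixing factor is [s^2]. *)
Section Mode.
Variables (R : realFieldType) (s alpha : R) (tau : nat) (y h : nat -> R).
Hypotheses (s0 : 0 < s) (s1 : s < 1) (tau_gt0 : (0 < tau)%N).
Hypothesis y_step : forall t,
  y t.+2 = (if (t.+1 %% tau == 0)%N then s ^+ 2 else 1)
           * (2 * y t.+1 - y t - alpha * (h t.+1 - h t)).

Let a k := y (k * tau).
Let D k := \sum_(j < tau) (h (k * tau + j).+1 - h (k * tau + j)) ^+ 2.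
Let psi k := drift alpha h (k * tau).
Let tr : R := s ^+ 2 * (tau%:R + 1) + (1 - tau%:R).
Let G : R := square_pyramidal R tau.

(** What the increments of [h] during two consecutive rounds add to the
    recursion between the values at the starts of rounds. *)
Definition round_forcing k : R := drift alpha h (k.+1 * tau) tau
  - s ^+ 2 * (tau%:R * (alpha * (h (k.+1 * tau) - h (k * tau)))
              + drift alpha h (k * tau) tau).

Lemma round_affine k j : (j <= tau)%N ->
  y (k * tau + j) = a k + j%:R * (y (k * tau).+1 - a k) + psi k j.
Proof.
move=> jt; apply: (@local_updates_affine _ alpha h y (k * tau) tau) => // i it.
rewrite !addnS y_step.
by rewrite -addnS modnMDl modn_small //= mul1r addnS.
Qed.

Lemma round_end k : a k.+1 = a k + tau%:R * (y (k * tau).+1 - a k) + psi k tau.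
Proof. by rewrite /a mulSnr round_affine. Qed.

(** The first update of a round is the mixing step, applied to the last two
    points of the previous round; [round_affine] at [tau] and [tau - 1] puts
    these in terms of the start of that round. *)
Lemma round_start k : y (k.+1 * tau).+1
  = s ^+ 2 * (2 * a k.+1 - (a k + (tau%:R - 1) * (y (k * tau).+1 - a k) + psi k tau)
      - alpha * (h (k.+1 * tau) - h (k * tau))).
Proof.
have E : (k.+1 * tau = (k * tau + tau.-1).+1)%N.
  by rewrite -addnS prednK // mulSnr.
rewrite E y_step -E modnMl eqxx round_affine ?leq_pred // /psi.
have -> : drift alpha h (k * tau) tau = drift alpha h (k * tau) tau.-1
    - alpha * (h (k * tau + tau.-1)%N - h (k * tau)%N).
  by rewrite -driftS prednK.
rewrite -[in tau%:R - 1](prednK tau_gt0) -addn1 natrD /a; ring.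
Qed.

(** Eliminating the initial displacements of the rounds from [round_end] and
    [round_start] leaves a closed recursion for the starts of the rounds. *)
Lemma round_rec k : a k.+2 = tr * a k.+1 - s ^+ 2 * a k + round_forcing k.
Proof.
rewrite round_end round_start round_end /tr /round_forcing /psi; ring.
Qed.

(** Inside a round [y] is, up to drift, on the segment between the values at
    the two ends of the round, hence controlled by their squares. *)
Lemma local_convex k j : (j < tau)%N ->
  y (k * tau + j).+1 ^+ 2 <=
    2 * ((1 - j.+1%:R / tau%:R) * a k ^+ 2 + j.+1%:R / tau%:R * a k.+1 ^+ 2)
    + 8 / 3 * tau%:R ^+ 3 * alpha ^+ 2 * D k.
Proof.
move=> jt.
have t0 : 0 < tau%:R :> R by rewrite ltr0n.
set th := _ / _.
have th0 : 0 <= th by rewrite divr_ge0.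
have th1 : th <= 1 by rewrite ler_pdivrMr // mul1r ler_nat.
have D0 : 0 <= D k by apply: sumr_ge0 => i _; exact: sqr_ge0.
have bnd i : (i <= tau)%N -> psi k i ^+ 2 <= tau%:R ^+ 3 / 3 * alpha ^+ 2 * D k.
  move=> it; apply: le_trans (drift_sqr _ _ _ _) _.
  have it' : i%:R <= tau%:R :> R by rewrite ler_nat.
  have i0 : 0 <= i%:R :> R := ler0n _ _.
  rewrite [leRHS](_ : _ = alpha ^+ 2 * (tau%:R ^+ 3 / 3 * D k)); last by ring.
  rewrite ler_wpM2l ?sqr_ge0 //.
  have sq : \sum_(s0 < i) (h (k * tau + s0).+1 - h (k * tau + s0)%N) ^+ 2 <= D k.
    rewrite /D -(subnKC it) big_split_ord /= lerDl.
    by apply: sumr_ge0 => l _; exact: sqr_ge0.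
  apply: (@le_trans _ _ (i%:R ^+ 3 / 3 * \sum_(s0 < i) (h (k * tau + s0).+1 - h (k * tau + s0)%N) ^+ 2)).
    apply: ler_wpM2r; first by apply: sumr_ge0 => l _; exact: sqr_ge0.
    exact: square_pyramidal_le.
  apply: ler_pM sq.
  - by rewrite divr_ge0 ?exprn_ge0.
  - by apply: sumr_ge0 => l _; exact: sqr_ge0.
  - apply: ler_wpM2r; first by rewrite invr_ge0 ler0n.
    by apply: lerXn2r; rewrite ?nnegrE.
have -> : y (k * tau + j).+1 = (1 - th) * a k + th * a k.+1 + (psi k j.+1 - th * psi k tau).
  rewrite -addnS round_affine // round_end /th; field.
  by rewrite gt_eqF.
have b1 := bnd _ jt; have b2 := bnd _ (leqnn _).
set c := (1 - th) * a k + th * a k.+1.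
have cc : c ^+ 2 <= (1 - th) * a k ^+ 2 + th * a k.+1 ^+ 2.
  rewrite -subr_ge0 (_ : _ - _ = (th * (1 - th)) * (a k - a k.+1) ^+ 2).
    by rewrite mulr_ge0 ?sqr_ge0 // mulr_ge0 // subr_ge0.
  by rewrite /c; ring.
set u := psi k j.+1 in b1 *; set v := psi k tau in b2 *.
have chi : (u - th * v) ^+ 2 <= 2 * u ^+ 2 + 2 * v ^+ 2.
  have : 0 <= (u + th * v) ^+ 2 by exact: sqr_ge0.
  have : (th * v) ^+ 2 <= v ^+ 2.
    by rewrite exprMn ler_piMl ?sqr_ge0 // expr_le1.
  move: (th * v) => w; rewrite !expr2; lra.
have : (c + (u - th * v)) ^+ 2 <= 2 * c ^+ 2 + 2 * (u - th * v) ^+ 2.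
  have : 0 <= (c - (u - th * v)) ^+ 2 by exact: sqr_ge0.
  move: (u - th * v) => w; rewrite !expr2; lra.
lra.
Qed.

Hypothesis tr_lt : tr ^+ 2 < 4 * s ^+ 2.

Let D_ge0 k : 0 <= D k.
Proof. by apply: sumr_ge0 => i _; exact: sqr_ge0. Qed.

Let t0 : 1 <= tau%:R :> R. Proof. by rewrite ler1n. Qed.

Let G_ge0 : 0 <= G.
Proof.
have t1 := t0; rewrite /G /square_pyramidal; apply: divr_ge0; last exact: ler0n.
by apply: mulr_ge0; [apply: mulr_ge0|]; lra.
Qed.

Lemma round_drift_sqr k : psi k tau ^+ 2 <= G * alpha ^+ 2 * D k.
Proof.
apply: le_trans (drift_sqr _ _ _ _) _.
by rewrite mulrCA mulrA.
Qed.

(** The weights [6, 3/2, 6] satisfy [1/6 + 2/3 + 1/6 = 1]; the middle one is the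
    largest [q] for which [2 q] stays within the coefficient [3] that the final
    constant allows when [tau = 1]. *)
Lemma round_forcing_sqr k : round_forcing k ^+ 2 <=
  alpha ^+ 2 * ((3 / 2 * tau%:R ^+ 3 * s ^+ 4 + 6 * G) * D k + 6 * G * D k.+1).
Proof.
have p1 := round_drift_sqr k.+1; have p0 := round_drift_sqr k.
rewrite /round_forcing.
rewrite /psi in p0 p1.
have dh : (h (k.+1 * tau)%N - h (k * tau)%N) ^+ 2 <= tau%:R * D k.
  rewrite mulSnr -increments_telescope.
  have := sum_cauchy_schwarz (fun=> 1) (fun j : 'I_tau => h (k * tau + j).+1 - h (k * tau + j)%N).
  rewrite (eq_bigr (fun j : 'I_tau => h (k * tau + j).+1 - h (k * tau + j)%N)); last first.
    by move=> i _; rewrite mul1r.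
  have -> // : \sum_(j < tau) (1 : R) ^+ 2 = tau%:R.
  by rewrite sumr_const card_ord expr1n.
move: (h (k.+1 * tau)%N - h (k * tau)%N) dh => e dh.
move: (drift _ _ _ _) p1 => u p1; move: (drift _ _ (k * tau) _) p0 => v p0.
have split3 (p q w : R) : (p - q - w) ^+ 2 <= 6 * p ^+ 2 + 3 / 2 * q ^+ 2 + 6 * w ^+ 2.
  have q1 : 0 <= (p + w) ^+ 2 by exact: sqr_ge0.
  have q2 : 0 <= (q / 2 + p - w) ^+ 2 by exact: sqr_ge0.
  rewrite !expr2 in q1 q2 *; lra.
rewrite mulrDr opprD addrA.
apply: le_trans (split3 _ _ _) _.
have s2 : s ^+ 2 <= 1 by rewrite expr_le1 // ltW.
have sv : (s ^+ 2 * v) ^+ 2 <= v ^+ 2.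
  by rewrite exprMn ler_piMl ?sqr_ge0 // expr_le1 ?sqr_ge0.
have E : (s ^+ 2 * (tau%:R * (alpha * e))) ^+ 2 <= tau%:R ^+ 3 * s ^+ 4 * alpha ^+ 2 * D k.
  rewrite (_ : _ ^+ 2 = (tau%:R ^+ 2 * s ^+ 4 * alpha ^+ 2) * e ^+ 2); last by ring.
  rewrite (_ : tau%:R ^+ 3 * _ * _ * _ = (tau%:R ^+ 2 * s ^+ 4 * alpha ^+ 2) * (tau%:R * D k)); last by ring.
  apply: ler_wpM2l dh; apply: mulr_ge0; last exact: sqr_ge0.
  by apply: mulr_ge0; rewrite exprn_ge0 // ltW.
lra.
Qed.

(** The end of the first round is an extrapolation of [y 0] and [y 1], whence
    the factor [tau^2]. *)
Lemma initial_energy :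
  energy s tr (a 1) (a 0) <= 4 * tau%:R ^+ 2 * (y 0%N ^+ 2 + y 1%N ^+ 2)
    + 2 * (G * alpha ^+ 2 * D 0%N).
Proof.
have a0E : a 0%N = y 0%N by rewrite /a mul0n.
rewrite round_end a0E mul0n.
have p0 := round_drift_sqr 0; move: (psi 0 tau) p0 => v p0.
set a1 := y 0%N + tau%:R * (y 1%N - y 0%N).
have E : energy s tr (a1 + v) (y 0%N) <= 2 * energy s tr a1 (y 0%N) + 2 * v ^+ 2.
  rewrite -subr_ge0.
  (* The parallelogram identity in the first argument of the energy. *)
  rewrite (_ : _ - _ = energy s tr (a1 - v) (y 0%N)); last by rewrite /energy; ring.
  exact: energy_ge0 s0 (ltW tr_lt) _ _.
suff : energy s tr a1 (y 0%N) <= 2 * tau%:R ^+ 2 * (y 0%N ^+ 2 + y 1%N ^+ 2) by lra.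
set n0 := `|y 0%N|; set n1 := `|y 1%N|.
have n0_ge0 : 0 <= n0 by exact: normr_ge0.
have n1_ge0 : 0 <= n1 by exact: normr_ge0.
have t1 := t0.
have trn : `|tr| <= 2.
  have s2 : s ^+ 2 <= 1 by rewrite expr_le1 // ltW.
  by rewrite -(@ler_pXn2r _ 2) ?nnegrE // real_normK ?num_real //; apply: le_trans (ltW tr_lt) _; lra.
have a1n : `|a1| <= (tau%:R - 1) * n0 + tau%:R * n1.
  rewrite (_ : a1 = (1 - tau%:R) * y 0%N + tau%:R * y 1%N); last by rewrite /a1; ring.
  apply: le_trans (ler_normD _ _) _.
  have e1 : `|1 - tau%:R| = tau%:R - 1 :> R by rewrite distrC ger0_norm // subr_ge0.
  by rewrite !normrM e1 normr_nat.
apply: (@le_trans _ _ ((`|a1| + n0) ^+ 2)).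
  rewrite /energy [(_ + n0) ^+ 2]sqrrD real_normK ?num_real //.
  have m1 : - (tr * a1 * y 0%N) <= 2 * (`|a1| * n0).
    apply: le_trans (ler_norm _) _.
    by rewrite normrN !normrM -mulrA ler_wpM2r // mulr_ge0.
  have m2 : s ^+ 2 * y 0%N ^+ 2 <= n0 ^+ 2.
    by rewrite real_normK ?num_real // ler_piMl ?sqr_ge0 // expr_le1 // ltW.
  rewrite -mulr_natl; lra.
apply: (@le_trans _ _ ((tau%:R * (n0 + n1)) ^+ 2)).
  by rewrite lerXn2r ?nnegrE ?addr_ge0 ?mulr_ge0 ?addr_ge0 //; lra.
rewrite exprMn [2 * _]mulrC -[leRHS]mulrA ler_wpM2l ?sqr_ge0 //.
rewrite -[y 0%N ^+ 2]real_normK ?num_real // -[y 1%N ^+ 2]real_normK ?num_real //.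
rewrite -/n0 -/n1; have : 0 <= (n0 - n1) ^+ 2 by exact: sqr_ge0.
rewrite !expr2; lra.
Qed.

(** The energies of the rounds are summed with [energy_sum], the squares at the
    starts of rounds recovered with [energy_coercive], and the squares inside
    the rounds with [local_convex]. *)
Lemma mode_bound K :
  \sum_(t < K.+1 * tau) y t.+1 ^+ 2 <=
    (tau%:R - 1) * y 0%N ^+ 2
    + 2 * tau%:R * (4 * s ^+ 2 / (4 * s ^+ 2 - tr ^+ 2))
      * (4 * tau%:R ^+ 2 * (y 0%N ^+ 2 + y 1%N ^+ 2) / (1 - s)
         + alpha ^+ 2 * (3 / 2 * tau%:R ^+ 3 * s ^+ 4 + 12 * G) / (1 - s) ^+ 2
           * \sum_(t < K.+1 * tau) (h t.+1 - h t) ^+ 2)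
    + 8 / 3 * tau%:R ^+ 4 * alpha ^+ 2 * \sum_(t < K.+1 * tau) (h t.+1 - h t) ^+ 2.
Proof.
set Y := y 0%N ^+ 2 + y 1%N ^+ 2.
rewrite !(sum_by_rounds _ _ (fun t => (h t.+1 - h t) ^+ 2)).
rewrite (sum_by_rounds _ _ (fun t => y t.+1 ^+ 2)).
rewrite /=.
have DDE : \sum_(k < K.+1) \sum_(j < tau) (h (k * tau + j).+1 - h (k * tau + j)%N) ^+ 2
   = \sum_(k < K.+1) D k by [].
rewrite !DDE; set DD := \sum_(k < K.+1) D k.
have tn0 : tau%:R != 0 :> R by rewrite pnatr_eq0 -lt0n.
have u0 : 0 < 1 - s by rewrite subr_gt0.
have den : 0 < 4 * s ^+ 2 - tr ^+ 2 by rewrite subr_gt0.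
pose S := \sum_(k < K.+1) a k.+1 ^+ 2.
have S1 : \sum_(k < K.+1) \sum_(j < tau) y (k * tau + j).+1 ^+ 2 <=
    (tau%:R - 1) * y 0%N ^+ 2 + 2 * tau%:R * S + 8 / 3 * tau%:R ^+ 4 * alpha ^+ 2 * DD.
  have S0 : \sum_(k < K.+1) a k ^+ 2 <= y 0%N ^+ 2 + S.
    rewrite /S big_ord_recl [in X in _ <= _ + X]big_ord_recr /=.
    rewrite {1}/a mul0n lerD2l lerDl; exact: sqr_ge0.
  apply: (@le_trans _ _ (\sum_(k < K.+1) ((tau%:R - 1) * a k ^+ 2
     + (tau%:R + 1) * a k.+1 ^+ 2 + 8 / 3 * tau%:R ^+ 4 * alpha ^+ 2 * D k))).
    apply: ler_sum => k _.
    apply: (@le_trans _ _ (\sum_(j < tau) (2 * ((1 - j.+1%:R / tau%:R) * a k ^+ 2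
        + j.+1%:R / tau%:R * a k.+1 ^+ 2) + 8 / 3 * tau%:R ^+ 3 * alpha ^+ 2 * D k))).
      by apply: ler_sum => j _; exact: local_convex.
    have gauss m : \sum_(j < m) (j.+1%:R : R) = m%:R * (m%:R + 1) / 2.
      elim: m => [|m IH]; first by rewrite big_ord0 !mul0r.
      by rewrite big_ord_recr /= IH -[m.+1]addn1 natrD; field.
    rewrite big_split /= sumr_const card_ord -mulr_sumr big_split /=.
    rewrite -!mulr_suml sumrB sumr_const card_ord -!mulr_suml !gauss.
    rewrite -[X in _ <= X]addr0 -lerBlDl le_eqVlt; apply/orP; left; apply/eqP.
    by rewrite -[_ * D k *+ tau]mulr_natl; field.
  rewrite !big_split /= -!mulr_sumr -/S -/DD.
  have : (tau%:R - 1) * \sum_(k < K.+1) a k ^+ 2 <= (tau%:R - 1) * (y 0%N ^+ 2 + S).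
    by rewrite ler_wpM2l // subr_ge0.
  lra.
have t1 := t0.
apply: le_trans S1 _; rewrite lerD2r lerD2l -[leRHS]mulrA ler_wpM2l ?mulr_ge0 ?ler0n //.
have S2 : (4 * s ^+ 2 - tr ^+ 2) * S <= 4 * s ^+ 2 * \sum_(k < K.+1) energy s tr (a k.+1) (a k).
  rewrite !mulr_sumr; apply: ler_sum => k _; exact: energy_coercive.
rewrite mulrAC ler_pdivlMr // [leLHS]mulrC; apply: le_trans S2 _.
apply: ler_wpM2l; first by rewrite mulr_ge0 ?sqr_ge0.
have S3 := energy_sum s0 s1 (ltW tr_lt) round_rec K.
rewrite [leRHS](_ : _ = ((1 - s) * (4 * tau%:R ^+ 2 * Y)
   + alpha ^+ 2 * (3 / 2 * tau%:R ^+ 3 * s ^+ 4 + 12 * G) * DD) / (1 - s) ^+ 2); last first.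
  by field; rewrite gt_eqF.
rewrite ler_pdivlMr ?exprn_gt0 // [leLHS]mulrC; apply: le_trans S3 _.
have en := ler_wpM2l (ltW u0) initial_energy; rewrite -/Y in en.
have D1le : \sum_(k < K) D k <= DD by rewrite /DD big_ord_recr lerDl.
have D2le : D 0%N + \sum_(k < K) D k.+1 = DD by rewrite /DD big_ord_recl.
have b2 : \sum_(k < K) round_forcing k ^+ 2 <=
  alpha ^+ 2 * ((3 / 2 * tau%:R ^+ 3 * s ^+ 4 + 6 * G) * DD + 6 * G * (DD - D 0%N)).
  apply: (@le_trans _ _ (\sum_(k < K) alpha ^+ 2 * ((3 / 2 * tau%:R ^+ 3 * s ^+ 4 + 6 * G) * D k + 6 * G * D k.+1))).
    by apply: ler_sum => k _; exact: round_forcing_sqr.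
  rewrite -mulr_sumr big_split /= -!mulr_sumr -D2le [D 0%N + _ - _]addrC addKr D2le.
  rewrite ler_wpM2l ?sqr_ge0 // lerD2r; apply: ler_wpM2l => //.
  apply: addr_ge0; last by rewrite mulr_ge0.
  apply: mulr_ge0; last by rewrite exprn_ge0 // ltW.
  by apply: mulr_ge0; rewrite ?exprn_ge0 // divr_ge0.
have P0 : 0 <= G * alpha ^+ 2 * D 0%N by rewrite mulr_ge0 // mulr_ge0 ?sqr_ge0.
have P1 : 0 <= s * (G * alpha ^+ 2 * D 0%N) by rewrite mulr_ge0 // ltW.
clear D1le D2le; move: (energy _ _ _ _) (\sum_(k < K) round_forcing k ^+ 2) (D 0%N) Y DD G en b2 P0 P1 => *.
lra.
Qed.

End Mode.

Section ModeConstants.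
Variables (R : realFieldType) (s rs alpha : R) (tau : nat) (y h : nat -> R) (A : R).
Hypotheses (s0 : 0 < s) (s_le : s <= rs) (rs1 : rs < 1) (tau_gt0 : (0 < tau)%N).
Hypothesis y_step : forall t,
  y t.+2 = (if (t.+1 %% tau == 0)%N then s ^+ 2 else 1)
           * (2 * y t.+1 - y t - alpha * (h t.+1 - h t)).
Let disc2 : R := 4 * s ^+ 2 - (s ^+ 2 * (tau%:R + 1) + (1 - tau%:R)) ^+ 2.
Hypothesis disc2_gt0 : 0 < disc2.
Hypothesis A_ge : 4 * tau%:R ^+ 2 / disc2 <= A ^+ 2.

(** The bound of [mode_bound] increases with the modulus [s], so it can be
    evaluated at a common bound [rs] for all modes; the result is then brought
    to the form of [B2] and [A4]. *)
Lemma mode_bound_const K (r := rs ^+ 2) (t : R := tau%:R) :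
  \sum_(t < K.+1 * tau) y t.+1 ^+ 2 <=
    (t - 1 + 8 * t * A ^+ 2 / (1 - rs)) * (y 0%N ^+ 2 + y 1%N ^+ 2)
    + (3 * t ^+ 4 +
      t ^+ 2 * (t + 1) * (2 * t + 1) * (r * t + t - 1) ^+ 2
      / (2 * (1 - rs) ^+ 2) * A ^+ 2) * alpha ^+ 2
      * \sum_(t < K.+1 * tau) (h t.+1 - h t) ^+ 2.
Proof.
have s1 : s < 1 by exact: le_lt_trans rs1.
have tr_lt : (s ^+ 2 * (tau%:R + 1) + (1 - tau%:R)) ^+ 2 < 4 * s ^+ 2.
  by rewrite -subr_gt0.
apply: le_trans (mode_bound s0 s1 tau_gt0 y_step tr_lt K) _.
rewrite -/disc2 -/t; set DD := \sum_(_ < _) _.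
have DD0 : 0 <= alpha ^+ 2 * DD.
  by rewrite mulr_ge0 ?sqr_ge0 //; apply: sumr_ge0 => i _; exact: sqr_ge0.
have t1 : 1 <= t by rewrite /t ler1n.
have A0 : 0 <= A ^+ 2 by exact: sqr_ge0.
have u0 : 0 < 1 - rs by rewrite subr_gt0.
have su0 : 0 < 1 - s by rewrite subr_gt0.
have rs0 : 0 < rs by exact: lt_le_trans s_le.
have r0 : 0 <= r by exact: sqr_ge0.
have sr : s ^+ 2 <= r by rewrite /r lerXn2r ?nnegrE // ltW.
have r1 : r <= 1 by rewrite /r expr_le1 // ltW.
have s20 : 0 <= s ^+ 2 by exact: sqr_ge0.
have i0 : 0 <= (1 - s)^-1 by rewrite invr_ge0 ltW.
have i1 : (1 - s)^-1 <= (1 - rs)^-1.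
  by rewrite lef_pV2 ?posrE // lerD2l lerN2.
set i := (1 - rs)^-1 in i1 *.
have E1 : 2 * t * (4 * s ^+ 2 / disc2) <= 2 * s ^+ 2 * A ^+ 2 / t.
  rewrite [leLHS](_ : _ = (2 * s ^+ 2 / t) * (4 * t ^+ 2 / disc2)); last first.
    by field; rewrite gt_eqF //= gt_eqF //; lra.
  rewrite [leRHS](_ : _ = (2 * s ^+ 2 / t) * A ^+ 2); last by field; rewrite gt_eqF //; lra.
  apply: ler_wpM2l A_ge; apply: divr_ge0; last lra.
  by rewrite mulr_ge0.
set Y := y 0%N ^+ 2 + y 1%N ^+ 2.
have y00 : 0 <= y 0%N ^+ 2 by exact: sqr_ge0.
have y10 : 0 <= y 1%N ^+ 2 by exact: sqr_ge0.
have Y0 : 0 <= Y by exact: addr_ge0.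
have inner0 : 0 <= 3 / 2 * t ^+ 3 * s ^+ 4 + 12 * square_pyramidal R tau.
  have t_ge0 : 0 <= t by lra.
  apply: addr_ge0.
    apply: mulr_ge0; last by rewrite exprn_ge0 // ltW.
    by apply: mulr_ge0; rewrite ?exprn_ge0 // divr_ge0.
  apply: mulr_ge0 => //; rewrite /square_pyramidal -/t; apply: divr_ge0 => //.
  by apply: mulr_ge0; [apply: mulr_ge0|]; lra.
apply: (@le_trans _ _ ((t - 1) * Y + 2 * s ^+ 2 * A ^+ 2 / t *
   (4 * t ^+ 2 * Y * i + (3 / 2 * t ^+ 3 * s ^+ 4 + 12 * square_pyramidal R tau) * i ^+ 2 * (alpha ^+ 2 * DD))
   + 8 / 3 * t ^+ 4 * (alpha ^+ 2 * DD))).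
  rewrite [leLHS](_ : _ = (t - 1) * y 0%N ^+ 2 + (2 * t * (4 * s ^+ 2 / disc2)) *
   (4 * t ^+ 2 * Y * (1 - s)^-1 + (3 / 2 * t ^+ 3 * s ^+ 4 + 12 * square_pyramidal R tau) * (1 - s)^-1 ^+ 2 * (alpha ^+ 2 * DD))
   + 8 / 3 * t ^+ 4 * (alpha ^+ 2 * DD)); last first.
    by field; rewrite !gt_eqF.
  rewrite lerD2r; apply: lerD.
    by apply: ler_wpM2l; rewrite ?lerDl // subr_ge0.
  have t_ge0 : 0 <= t by lra.
  have tY : 0 <= 4 * t ^+ 2 * Y by rewrite mulr_ge0 // mulr_ge0 // sqr_ge0.
  apply: ler_pM E1 _.
  - apply: mulr_ge0; first by rewrite mulr_ge0.
    by apply: divr_ge0; [rewrite mulr_ge0 | exact: ltW].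
  - apply: addr_ge0; first by rewrite mulr_ge0.
    by rewrite mulr_ge0 // mulr_ge0 // sqr_ge0.
  - apply: lerD; first by rewrite ler_wpM2l.
    rewrite ler_wpM2r // ler_wpM2l // lerXn2r ?nnegrE //.
    exact: le_trans i1.
rewrite /square_pyramidal -/t.
set AA := A ^+ 2 in A0 *; set x := alpha ^+ 2 * DD in DD0 *.
have i20 : 0 <= i by exact: le_trans i1.
rewrite [leLHS](_ : _ = (t - 1 + 8 * t * (s ^+ 2) * AA * i) * Y
   + ((s ^+ 2 * (3 * t ^+ 2 * s ^+ 4 + 4 * (t - 1) * (2 * t - 1))) * i ^+ 2 * AA
      + 8 / 3 * t ^+ 4) * x); last by field; rewrite gt_eqF //; lra.
rewrite [leRHS](_ : _ = (t - 1 + 8 * t * 1 * AA * i) * Y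
   + ((t ^+ 2 * (t + 1) * (2 * t + 1) * (r * t + t - 1) ^+ 2 / 2) * i ^+ 2 * AA
      + 3 * t ^+ 4) * x); last by rewrite /x /i /AA; field; rewrite gt_eqF.
have t_ge0 : 0 <= t by lra.
apply: lerD; apply: ler_wpM2r => //; apply: lerD => //.
- do 2 apply: ler_wpM2r => //.
  by apply: ler_wpM2l; rewrite ?mulr_ge0 // (le_trans sr).
- do 2 (apply: ler_wpM2r; first by rewrite ?sqr_ge0).
  apply: (@le_trans _ _ (r * (3 * t ^+ 2 * r ^+ 2 + 4 * (t - 1) * (2 * t - 1)))).
    have k0 : 0 <= 4 * (t - 1) * (2 * t - 1) by apply: mulr_ge0; lra.
    apply: ler_pM => //.
      by apply: addr_ge0 => //; rewrite mulr_ge0 ?mulr_ge0 ?exprn_ge0 // ltW.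
    rewrite lerD2r; apply: ler_wpM2l; first by rewrite mulr_ge0 // sqr_ge0.
    by have -> : s ^+ 4 = (s ^+ 2) ^+ 2; [rewrite -exprM | rewrite lerXn2r ?nnegrE].
  (* The square of [r t + (t - 1)] is expanded and each of its three terms is
     compared separately. *)
  set m := t ^+ 2 * (t + 1) * (2 * t + 1).
  have m_ge : 6 * t ^+ 2 <= m.
    rewrite -subr_ge0 (_ : m - _ = t ^+ 2 * ((t - 1) * (2 * t + 5))); last by rewrite /m; ring.
    by rewrite mulr_ge0 ?sqr_ge0 //; apply: mulr_ge0; lra.
  have t2 : 1 <= t ^+ 2 by rewrite exprn_ege1.
  have c1 : r * (3 * t ^+ 2 * r ^+ 2) <= m / 2 * (r ^+ 2 * t ^+ 2).
    apply: (@le_trans _ _ (3 * (r ^+ 2 * t ^+ 2))).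
      by rewrite (_ : r * _ = r * (3 * (r ^+ 2 * t ^+ 2))); [rewrite ler_piMl // mulr_ge0 // mulr_ge0 ?sqr_ge0 | ring].
    by apply: ler_wpM2r; [rewrite mulr_ge0 ?sqr_ge0 | lra].
  have c2 : r * (4 * (t - 1) * (2 * t - 1)) <= m / 2 * (2 * (r * t * (t - 1))).
    have rt0 : 0 <= 2 * r * (t - 1) by apply: mulr_ge0; [rewrite mulr_ge0 | lra].
    rewrite [leLHS](_ : _ = 2 * r * (t - 1) * (2 * (2 * t - 1))); last by ring.
    rewrite [leRHS](_ : _ = 2 * r * (t - 1) * (m / 2 * t)); last by ring.
    apply: ler_wpM2l => //; nra.
  have c3 : 0 <= m / 2 * (t - 1) ^+ 2.
    by rewrite mulr_ge0 ?sqr_ge0 // divr_ge0 // (le_trans _ m_ge) // mulr_ge0 ?sqr_ge0.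
  move: c1 c2 c3; lra.
- by apply: ler_wpM2r; rewrite ?exprn_ge0 //; lra.
Qed.

End ModeConstants.

(** * Orthogonal diagonalisation of real symmetric matrices *)

Lemma char_poly_conj (F : fieldType) n (H A : 'M[F]_n) :
  H *m H^T = 1%:M -> char_poly (H *m A *m H^T) = char_poly A.
Proof.
move=> HH; have HHp : map_mx polyC H *m map_mx polyC H^T = 1%:M.
  by rewrite -map_mxM HH map_mx1.
rewrite /char_poly; have -> : char_poly_mx (H *m A *m H^T)
    = map_mx polyC H *m char_poly_mx A *m map_mx polyC H^T.
  rewrite /char_poly_mx !map_mxM mulmxBr mulmxBl -scalemx1.
  by rewrite -scalemxAr mulmx1 -scalemxAl HHp.
rewrite !det_mulmx mulrAC -det_mulmx HHp det1 mul1r //.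
Qed.

Section RealSpectral.
Variable R : rcfType.

Lemma dot_row n (u v : 'rV[R]_n) : (u *m v^T) 0 0 = \sum_i u 0 i * v 0 i.
Proof. by rewrite mxE; apply: eq_bigr => i _; rewrite mxE. Qed.

Lemma dot_row_ge0 n (u : 'rV[R]_n) : 0 <= (u *m u^T) 0 0.
Proof. by rewrite dot_row; apply: sumr_ge0 => i _; rewrite -expr2 sqr_ge0. Qed.

Lemma dot_row_eq0 n (u : 'rV[R]_n) : ((u *m u^T) 0 0 == 0) = (u == 0).
Proof.
apply/idP/eqP => [|->]; last by rewrite mul0mx mxE.
rewrite dot_row psumr_eq0; last by move=> i _; rewrite -expr2 sqr_ge0.
move=> /allP u0; apply/rowP => i; rewrite mxE; apply/eqP.
by have /implyP/(_ isT) := u0 i (mem_index_enum i); rewrite mulf_eq0 orbb.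
Qed.

(** The reflection that exchanges [v] with the first basis vector. *)
Lemma householder n (v : 'rV[R]_n.+1) : v *m v^T = 1%:M ->
  exists H : 'M[R]_n.+1, H *m H^T = 1%:M /\ row 0 H = v.
Proof.
move=> vv; have [->|ve] := eqVneq v (delta_mx 0 0).
  exists 1%:M; split; first by rewrite trmx1 mulmx1.
  by rewrite rowE mulmx1.
set e : 'rV[R]_n.+1 := delta_mx 0 0 in ve *.
set w := v - e; pose c := (w *m w^T) 0 0.
have c0 : c != 0 by rewrite /c dot_row_eq0 subr_eq0.
have wwE : w *m w^T = c%:M by rewrite [LHS]mx11_scalar.
pose H := 1%:M - (2 / c) *: (w^T *m w).
have HT : H^T = H by rewrite /H linearB linearZ /= trmx1 trmx_mul trmxK.
have ee : e *m e^T = 1%:M.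
  by rewrite /e trmx_delta mul_delta_mx [LHS]mx11_scalar mxE !eqxx.
have ve_ev : v *m e^T = e *m v^T.
  by rewrite [RHS]mx11_scalar [LHS]mx11_scalar !dot_row; under eq_bigr do rewrite mulrC.
pose p := (e *m v^T) 0 0.
have evE : e *m v^T = p%:M by rewrite [LHS]mx11_scalar.
have cE : c = 2 - 2 * p.
  rewrite /c /w linearB /= mulmxBl !mulmxBr vv ee ve_ev evE !mxE !eqxx !mulr1n; ring.
exists H; split.
  have MM : w^T *m w *m (w^T *m w) = c *: (w^T *m w).
    by rewrite mulmxA -[_ *m w *m w^T]mulmxA wwE mul_mx_scalar -scalemxAl.
  rewrite HT /H; move: (w^T *m w) MM => M MM.
  rewrite mulmxBl mul1mx -scalemxAl mulmxBr mulmx1 -scalemxAr MM.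
  have -> : 2 / c *: (M - 2 / c *: (c *: M)) = - (2 / c *: M).
    by rewrite scalerA divfK // scaler_nat mulr2n opprD addrA subrr sub0r scalerN.
  by rewrite opprK subrK.
have ew : e *m w^T = (p - 1)%:M.
  by rewrite /w linearB /= mulmxBr ee evE [RHS]raddfB.
rewrite rowE -/e /H mulmxBr mulmx1 -scalemxAr mulmxA ew mul_scalar_mx scalerA.
rewrite (_ : 2 / c * (p - 1) = -1) ?scaleN1r ?opprK /w 1?addrC ?subrK //.
by move: c0; rewrite cE => c0'; field; exact: c0'.
Qed.

(** The characteristic polynomial being split, an eigenvector exists.  An
    orthogonal matrix with this first row makes [A] block diagonal by symmetry,
    and the induction continues on the remaining block. *)
Lemma real_spectral n (A : 'M[R]_n) (l : seq R) :
  A^T = A -> char_poly A = \prod_(x <- l) ('X - x%:P) ->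
  exists (U : 'M[R]_n) (d : 'rV[R]_n),
    [/\ U *m U^T = 1%:M, U *m A = diag_mx d *m U & perm_eq l [seq d 0 i | i : 'I_n]].
Proof.
elim: n A l => [|n IH] A l AT chA.
  exists 1%:M, 0; split; rewrite ?[LHS]flatmx0 ?[RHS]flatmx0 //.
  have := size_char_poly A; rewrite chA size_prod_XsubC => -[/size0nil ->].
  by rewrite [X in perm_eq _ X]size0nil // size_map -cardE card_ord.
case: l chA => [|x l] chA.
  by have := size_char_poly A; rewrite chA size_prod_XsubC.
have /eigenvalueP [v vA v0] : eigenvalue A x.
  by rewrite eigenvalue_root_char chA big_cons rootM root_XsubC eqxx.
pose c := Num.sqrt ((v *m v^T) 0 0).
have c0 : c != 0 by rewrite /c sqrtr_eq0 -ltNge lt_def dot_row_eq0 v0 dot_row_ge0.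
pose u := c^-1 *: v.
have uu : u *m u^T = 1%:M.
  rewrite /u linearZ /= -scalemxAl -scalemxAr scalerA [v *m v^T]mx11_scalar.
  rewrite -[(v *m v^T) 0 0]sqr_sqrtr ?dot_row_ge0 // -/c.
  by rewrite scale_scalar_mx expr2 mulrACA mulVf // mulr1.
have uA : u *m A = x *: u by rewrite /u -scalemxAl vA scalerA mulrC -scalerA.
have [H [HH rH]] := householder uu.
have HTH : H^T *m H = 1%:M by exact: mulmx1C.
have [B BD] : exists B : 'M[R]_(1 + n), B = H *m A *m H^T by exists (H *m A *m H^T).
have BT : B^T = B by rewrite BD !trmx_mul trmxK AT mulmxA.
have rB : row 0 B = x *: delta_mx 0 0.
  by rewrite BD !row_mul rH uA -scalemxAl -rH -row_mul HH row1.
have B0 j : B 0 j = x *+ (j == 0).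
  by have /rowP/(_ j) := rB; rewrite !mxE eqxx /= eq_sym => ->; rewrite mulr_natr.
have l0 : lshift n (0 : 'I_1) = 0 :> 'I_(1 + n) by exact: val_inj.
pose B' := drsubmx B.
have BE : B = block_mx x%:M 0 0 B'.
  rewrite -[LHS]submxK; congr block_mx.
  - apply/matrixP => i j; rewrite !ord1 !mxE.
    by rewrite l0 B0.
  - apply/matrixP => i j; rewrite !ord1 !mxE.
    by rewrite l0 B0.
  - apply/matrixP => i j; rewrite !ord1 !mxE -BT mxE.
    by rewrite l0 B0.
have B'T : B'^T = B' by rewrite /B' trmx_drsub BT.
have chB : char_poly B' = \prod_(x <- l) ('X - x%:P).
  have := @char_poly_conj R (1 + n) H A HH; rewrite -BD chA BE big_cons.
  rewrite /char_poly (@char_block_diag_mx _ 1 n) det_ublock.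
  have -> : \det (char_poly_mx (x%:M : 'M[R]_1)) = 'X - x%:P :> {poly R}.
    by rewrite det_mx11 !mxE eqxx !mulr1n.
  by apply: mulfI; rewrite polyXsubC_eq0.
have [U [d [UU UB dE]]] := IH _ _ B'T chB.
pose V : 'M[R]_(1 + n) := block_mx 1%:M 0 0 U.
have VV : V *m V^T = 1%:M.
  rewrite /V tr_block_mx !trmx0 trmx1 mulmx_block !(mulmx0, mul0mx, addr0, add0r, mulmx1).
  by rewrite UU -scalar_mx_block.
exists (V *m H), (row_mx x%:M d); split.
- rewrite trmx_mul mulmxA -[V *m H *m _]mulmxA HH mulmx1; exact: VV.
- have -> : V *m H *m A = V *m B *m H.
    by rewrite BD -!mulmxA HTH mulmx1.
  rewrite mulmxA; congr (_ *m _); rewrite BE /V (@mulmx_block _ 1 n 1 n 1 n).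
  have -> : diag_mx (row_mx x%:M d) = block_mx (diag_mx x%:M) 0 0 (diag_mx d) by rewrite diag_mx_row.
  rewrite (@mulmx_block _ 1 n 1 n 1 n) !(mulmx0, mul0mx, addr0, add0r, mulmx1, mul1mx) UB.
  suff -> : diag_mx (x%:M : 'M[R]_1) = x%:M by [].
  by apply/matrixP => i j; rewrite !ord1 !mxE.
- have -> : [seq (row_mx x%:M d) 0 i | i : 'I_n.+1] = x :: [seq d 0 i | i : 'I_n].
    rewrite !/image_mem enum_ordSl /=; congr cons.
      have -> : ord0 = lshift n (0 : 'I_1) by exact: val_inj.
      by rewrite (row_mxEl (x%:M : 'rV[R]_1)) mxE.
    rewrite -map_comp; apply: eq_map => i /=.
    have -> : lift ord0 i = rshift 1 i by exact: val_inj.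
    by rewrite (row_mxEr (x%:M : 'rV[R]_1)).
  by rewrite perm_cons.
Qed.

End RealSpectral.

(** * Distance to consensus along a trajectory *)

Section Frobenius.
Variable R : realType.

Lemma frob_sqr m n (A : 'M[R]_(m, n)) : frob A ^+ 2 = \sum_i \sum_j A i j ^+ 2.
Proof.
by rewrite sqr_sqrtr //; apply: sumr_ge0 => i _; apply: sumr_ge0 => j _; exact: sqr_ge0.
Qed.

Lemma frob_sqr_mx_trace m n (A : 'M[R]_(m, n)) : frob A ^+ 2 = \tr (A *m A^T).
Proof.
rewrite frob_sqr; apply: eq_bigr => i _; rewrite mxE; apply: eq_bigr => j _.
by rewrite mxE expr2.
Qed.

Lemma frob_sqr_orthogonal m n (A : 'M[R]_(m, n)) (U : 'M[R]_n) :
  U *m U^T = 1%:M -> frob (A *m U^T) ^+ 2 = frob A ^+ 2.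
Proof.
move=> /mulmx1C UU; rewrite !frob_sqr_mx_trace trmx_mul trmxK mulmxA.
by rewrite -[A *m U^T *m U]mulmxA UU mulmx1.
Qed.

End Frobenius.

(** The matrix all of whose columns are the average of those of [X]. *)
Definition mean_mx (R : realType) n N (X : 'M[R]_(n, N)) : 'M[R]_(n, N) :=
  X *m const_mx N%:R^-1.

Section Spectrum.
Variables (R : realType) (N : nat) (e : rel 'I_N) (W : 'M[R]_N) (lam : seq R).
Hypotheses (N_ge2 : (2 <= N)%N) (Wmix : mixing_matrix e W) (lamP : spectrum W lam).

(** In an orthonormal eigenbasis exactly one vector, of index [i0], is constant:
    it spans the eigenspace of 1, and the averaging matrix is the projection on
    it.  All other eigenvalues are in the interval from -1 (excluded) to
    [lam`_1 < 1], and occur in [lam] after the first place. *)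
Lemma mixing_spectrum : exists (U : 'M[R]_N) (d : 'rV[R]_N) (i0 : 'I_N),
  [/\ U *m U^T = 1%:M, W *m U^T = U^T *m diag_mx d,
      (const_mx N%:R^-1 : 'M[R]_N) *m U^T = U^T *m delta_mx i0 i0,
      lam`_1 < 1
    & forall i, i != i0 -> [/\ -1 < d 0 i, d 0 i <= lam`_1
        & exists2 j, (2 <= j < N.+1)%N & d 0 i = lam`_j.-1]].
Proof.
have [_ WT kerW [Wpsd Wpd]] := Wmix.
have [chW lams] := lamP.
have [U [d [UU UW perm]]] := real_spectral WT chW.
have UTU : U^T *m U = 1%:M by exact: mulmx1C.
have WU : W *m U^T = U^T *m diag_mx d.
  by have := congr1 trmx UW; rewrite !trmx_mul WT tr_diag_mx.
pose v i : 'cV[R]_N := col i U^T.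
have vW i : W *m v i = d 0 i *: v i.
  rewrite /v {1}colE mulmxA WU -colE; apply/colP => k.
  by rewrite !mxE (bigD1 i) //= big1 ?addr0 => [|j ji]; rewrite !mxE ?eqxx ?(negbTE ji) ?mulr0 // mulrC.
have vv i j : ((v i)^T *m v j) 0 0 = (i == j)%:R.
  have /matrixP/(_ i j) := UU; rewrite [1%:M i j]mxE => <-.
  by rewrite !mxE; apply: eq_bigr => k _; rewrite !mxE.
have v_const i : d 0 i = 1 -> exists c : R, v i = const_mx c.
  by move=> di; apply/kerW; rewrite mulmxBl mul1mx vW di scale1r subrr.
have d_le1 i : d 0 i <= 1.
  have := Wpsd (v i); rewrite -mulmxA mulmxBl mulmxDl mul1mx vW mul_scalar_mx.
  have -> : 2 *: v i - (d 0 i *: v i + v i) = (1 - d 0 i) *: v i.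
    by apply/colP => k; rewrite !mxE; ring.
  by rewrite -scalemxAr mxE vv eqxx mulr1 subr_ge0.
have d_gtN1 i : -1 < d 0 i.
  have vi0 : v i != 0.
    apply/eqP => vi0; have := vv i i; rewrite vi0 mulmx0 mxE eqxx => /esym/eqP.
    by rewrite oner_eq0.
  have := Wpd (v i) vi0; rewrite -mulmxA mulmxDl mul1mx vW.
  have -> : d 0 i *: v i + v i = (d 0 i + 1) *: v i.
    by apply/colP => k; rewrite !mxE; ring.
  by rewrite -scalemxAr mxE vv eqxx mulr1; lra.
have dotc (a b : R) : ((const_mx a : 'cV[R]_N)^T *m (const_mx b : 'cV[R]_N)) 0 0 = N%:R * (a * b).
  rewrite mxE (eq_bigr (fun=> a * b)); last by move=> k _; rewrite !mxE.
  by rewrite sumr_const card_ord mulr_natl.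
have [i0 di0] : exists i0, d 0 i0 = 1.
  pose ov : 'cV[R]_N := const_mx 1.
  have Wo : W *m ov = ov.
    have /kerW : exists c : R, ov = const_mx c by exists 1.
    by rewrite mulmxBl mul1mx => /eqP; rewrite subr_eq0 => /eqP.
  have dy : diag_mx d *m (U *m ov) = U *m ov by rewrite mulmxA -UW -mulmxA Wo.
  have /cV0Pn [i yi] : U *m ov != 0.
    apply/eqP => Uo; have : ov = 0 by rewrite -[ov]mul1mx -UTU -mulmxA Uo mulmx0.
    have k : 'I_N := Ordinal (ltnW N_ge2).
    by move=> /colP/(_ k); rewrite !mxE => /eqP; rewrite oner_eq0.
  exists i; have /colP/(_ i) := dy; rewrite mul_diag_mx mxE.
  by move=> /(canRL (mulfK yi)); rewrite divff.
have i0_uniq i : i != i0 -> d 0 i != 1.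
  move=> ii0; apply/eqP => di; have [c vi] := v_const i di; have [c0 vi0] := v_const i0 di0.
  have := vv i i0; rewrite (negbTE ii0) vi vi0 dotc => /eqP.
  have := vv i i; rewrite eqxx vi dotc => H1; have := vv i0 i0; rewrite eqxx vi0 dotc => H2.
  rewrite !mulf_eq0 => /or3P[] /eqP E; move: H1 H2; rewrite E ?mul0r ?mulr0.
  - by move/esym/eqP; rewrite oner_eq0.
  - by move/esym/eqP; rewrite oner_eq0.
  - by move=> _ /esym/eqP; rewrite oner_eq0.
have [c vi0] := v_const _ di0.
have Nc : N%:R * (c * c) = 1 by have := vv i0 i0; rewrite eqxx vi0 dotc.
have N0 : N%:R != 0 :> R by rewrite pnatr_eq0 -lt0n ltnW.
have JE : (const_mx N%:R^-1 : 'M[R]_N) = v i0 *m (v i0)^T.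
  rewrite vi0; apply/matrixP => i j; rewrite !mxE big_ord1 !mxE.
  by apply: (mulfI N0); rewrite divff.
have lam_mem x : x \in lam -> exists i, x = d 0 i.
  by rewrite (perm_mem perm) => /mapP[i _ ->]; exists i.
have mem_lam i : d 0 i \in lam.
  by rewrite (perm_mem perm); apply/mapP; exists i => //; rewrite mem_enum.
have size_lam : size lam = N by rewrite (perm_size perm) size_map -cardE card_ord.
(* The eigenvalue 1 is simple; as it bounds the sorted list [lam], it is its
   head, and the tail lists the eigenvalues of the other vectors. *)
have cnt1 : count_mem 1 lam = 1%N.
  rewrite (permP perm) count_map (eq_count (a2 := pred1 i0)).
    by rewrite count_uniq_mem ?enum_uniq // mem_enum.
  by move=> i /=; case: (eqVneq i i0) => [->|/i0_uniq/negbTE //]; rewrite di0 eqxx.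
move: lams cnt1 mem_lam size_lam lam_mem; case: (lam) => [|x l] //.
move=> srt cnt1 mem_lam size_lam lam_mem.
have x_max y : y \in l -> y <= x.
  by have /allP := order_path_min (rev_trans le_trans) srt => /(_ y).
have x1 : x = 1.
  have x_le1 : x <= 1 by have [i ->] := lam_mem x (mem_head _ _).
  apply: le_anti; rewrite x_le1 /=.
  by have := mem_lam i0; rewrite di0 inE => /predU1P[<-|/x_max].
have l_neq1 y : y \in l -> y != 1.
  move=> yl; apply/eqP => y1; move: cnt1; rewrite /= x1 eqxx => -[] /eqP.
  by apply/negP; rewrite -lt0n -has_count has_pred1 -y1.
have l_lt1 y : y \in l -> y < 1 by move=> yl; rewrite lt_neqAle l_neq1 // -x1 x_max.
have l_max y : y \in l -> y <= l`_0.
  case: (l) srt => [|z m] //= /andP[_ zm]; rewrite inE => /predU1P[->//|ym].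
  by have /allP := order_path_min (rev_trans le_trans) zm => /(_ _ ym).
have l0 : l`_0 \in l by rewrite mem_nth // -ltnS -[X in (1 < X)%N]/(size (x :: l)) size_lam.
exists U, d, i0; split => //.
- rewrite JE -mulmxA; apply/matrixP => k j.
  rewrite [LHS]mxE big_ord1 [RHS]mxE (bigD1 i0) //= big1 ?addr0; last first.
    by move=> q qi0; rewrite [delta_mx _ _ _ _]mxE (negbTE qi0) mulr0.
  rewrite !mxE eqxx /=; congr (_ * _).
  have /matrixP/(_ i0 j) := UU; rewrite !mxE eq_sym => <-.
  by apply: eq_bigr => q _; rewrite !mxE.
- exact: l_lt1.
- move=> i ii0; have dl : d 0 i \in l.
    by have := mem_lam i; rewrite inE x1 (negbTE (i0_uniq i ii0)).
  split => //; first exact: l_max.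
  exists (index (d 0 i) l).+2; last by rewrite /= nth_index.
  by rewrite /= -[X in (_ < X.+1)%N]size_lam /= !ltnS index_mem.
Qed.

End Spectrum.

Section Contraction.
Variables (R : realType) (N tau : nat) (lam : seq R) (xi : R).
Hypotheses (tau_gt0 : (0 < tau)%N) (xi_gt0 : 0 < xi) (xi_lt : xi < 2 / (tau%:R + 3)).
Let t : R := tau%:R.

Let t1 : 1 <= t. Proof. by rewrite /t ler1n. Qed.

Lemma mode_factor_pos l : -1 < l -> 0 < 1 - xi + xi * l.
Proof.
have t1' := t1; have x0 := xi_gt0.
have : xi * (t + 3) < 2 by rewrite -ltr_pdivlMr //; lra.
nra.
Qed.

(** With [del = xi (1 - l)] the discriminant is [del (4 t - del (t+1)^2)].  Here
    [del (t + 3) < 4], and [(t + 1)^2 <= t (t + 3)] as [t >= 1]. *)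
Lemma mode_disc_pos l : -1 < l -> l < 1 ->
  0 < 4 * (1 - xi + xi * l) - ((1 - xi + xi * l) * (t + 1) + (1 - t)) ^+ 2.
Proof.
move=> lN1 l1; have t1' := t1; have x0 := xi_gt0.
have xt : xi * (t + 3) < 2 by rewrite -ltr_pdivlMr //; lra.
pose del := xi * (1 - l).
have d0 : 0 < del by rewrite mulr_gt0 // subr_gt0.
have d1 : del * (t + 3) < 4.
  have : 0 < (1 + l) * (xi * (t + 3)) by rewrite !mulr_gt0 //; lra.
  rewrite /del; nra.
rewrite (_ : _ - _ = del * (4 * t - del * (t + 1) ^+ 2)); last by rewrite /del; ring.
rewrite mulr_gt0 // subr_gt0.
apply: (@le_lt_trans _ _ (del * (t + 3) * t)); last by nra.
by rewrite -mulrA ler_wpM2l ?(ltW d0) //; nra.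
Qed.

Lemma disc_le_A4 j l : (2 <= j < N.+1)%N -> l = lam`_j.-1 -> -1 < l -> l < 1 ->
  4 * t ^+ 2 / (4 * (1 - xi + xi * l) - ((1 - xi + xi * l) * (t + 1) + (1 - t)) ^+ 2)
   <= A4 N tau xi lam ^+ 2.
Proof.
move=> jN lE lN1 l1; have dp := mode_disc_pos lN1 l1.
set D2 := 4 * _ - _ in dp *.
have discE : disc tau (rho_ xi lam j) = Num.sqrt D2 by rewrite /disc /rho_ -lE.
have s0 : 0 < Num.sqrt D2 by rewrite sqrtr_gt0.
have A4_ge : 2 * t / Num.sqrt D2 <= A4 N tau xi lam.
  rewrite /A4 le_max; apply/orP; left; rewrite /A1 -discE.
  have jr : j \in index_iota 2 N.+1 by rewrite mem_index_iota.
  exact: (@le_bigmax_seq _ _ _ _ 0 j xpredT (fun i => 2 * tau%:R / disc tau (rho_ xi lam i)) jr isT).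
have q0 : 0 <= 2 * t / Num.sqrt D2.
  by apply: divr_ge0; [have := t1; lra | exact: ltW].
rewrite (_ : 4 * _ / _ = (2 * t / Num.sqrt D2) ^+ 2).
  by rewrite lerXn2r ?nnegrE // (le_trans q0).
by rewrite expr_div_n sqr_sqrtr ?(ltW dp) // exprMn; congr (_ * _ / _); ring.
Qed.

End Contraction.

Lemma B2_ge (R : realType) N tau xi (lam : seq R) : 3 * tau%:R ^+ 4 <= B2 N tau xi lam.
Proof.
rewrite /B2 lerDl; apply: mulr_ge0; last exact: sqr_ge0.
apply: divr_ge0; last by rewrite mulr_ge0 ?sqr_ge0.
apply: mulr_ge0; last exact: sqr_ge0.
by rewrite mulr_ge0 ?mulr_ge0 ?sqr_ge0 ?addr_ge0 ?mulr_ge0.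
Qed.

Lemma rho_bounds (R : realType) (N tau : nat) (e : rel 'I_N) (W : 'M[R]_N) (lam : seq R) (xi : R) :
  (2 <= N)%N -> (0 < tau)%N -> mixing_matrix e W -> spectrum W lam ->
  0 < xi -> xi < 2 / (tau%:R + 3) -> 0 < rho xi lam /\ rho xi lam < 1.
Proof.
move=> N_ge2 tau_gt0 Wmix lamP xi_gt0 xi_lt.
have [U [d [i0 [_ _ _ lam1 dP]]]] := mixing_spectrum N_ge2 Wmix lamP.
have [i ii0] : exists i, i != i0.
  have [->|ne] := eqVneq i0 (Ordinal (ltnW N_ge2)); first by exists (Ordinal N_ge2).
  by exists (Ordinal (ltnW N_ge2)); rewrite eq_sym.
have [dN1 dle _] := dP i ii0.
split; first exact: mode_factor_pos tau_gt0 xi_gt0 xi_lt _ (lt_le_trans dN1 dle).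
by rewrite /rho /rho_ -subr_gt0 (_ : _ - _ = xi * (1 - lam`_1)) ?mulr_gt0 ?subr_gt0 //; ring.
Qed.

(** The weight of the initial data in the total deviation, against the weights
    of the convergence rate.  Here [B2] contains both [3 t^4], which compensates
    [t - 1], and a multiple of [A4^2], which compensates the rest. *)
Lemma initial_constant_le (R : realType) (N tau : nat) (lam : seq R) (xi : R) :
  (0 < tau)%N -> 0 < rho xi lam -> rho xi lam < 1 ->
  let C0 := tau%:R - 1 + 8 * tau%:R * A4 N tau xi lam ^+ 2 / (1 - Num.sqrt (rho xi lam)) in
  0 <= C0 /\ (13 * C0 + 6) / 2 <= 13 * B2 N tau xi lam *
    (2 / (rho xi lam ^+ 2 * tau%:R ^+ 3) + 12 / tau%:R ^+ 2).
Proof.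
move=> tau_gt0 r0 r1 C0; rewrite /B2; move: r0 r1 @C0; set r := rho xi lam => r0 r1 C0.
set A := A4 _ _ _ _ ^+ 2 in C0 *; set u := (1 - Num.sqrt r) in C0 *; set t := tau%:R in C0 *.
have t1 : 1 <= t by rewrite /t ler1n.
have A0 : 0 <= A by exact: sqr_ge0.
have s0 : 0 <= Num.sqrt r by exact: sqrtr_ge0.
have s1 : Num.sqrt r < 1 by rewrite -sqrtr1 ltr_sqrt.
have u0 : 0 < u by rewrite subr_gt0.
have u1 : u <= 1 by rewrite /u lerBlDr lerDl.
have t0 : 0 < t by lra.
have p0 : 0 <= t * A / u by apply: divr_ge0; [apply: mulr_ge0 => //; exact: ltW | exact: ltW].
have C0E : C0 = t - 1 + 8 * (t * A / u) by rewrite /C0 -mulrA -!mulrA.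
split; first by rewrite C0E; lra.
set Z := t ^+ 2 * (t + 1) * (2 * t + 1) * (r * t + t - 1) ^+ 2 / (2 * u ^+ 2) * A.
set B := 3 * t ^+ 4 + Z.
have B_ge1 : 3 * t ^+ 4 <= B.
  rewrite /B lerDl /Z; apply: mulr_ge0 => //; apply: divr_ge0; last by rewrite mulr_ge0 ?sqr_ge0.
  apply: mulr_ge0; last exact: sqr_ge0.
  by apply: mulr_ge0; [apply: mulr_ge0; [exact: sqr_ge0 | lra] | lra].
have first_part : 36 * t ^+ 2 <= 3 * t ^+ 4 * (12 / t ^+ 2).
  by rewrite le_eqVlt; apply/orP; left; apply/eqP; field; rewrite gt_eqF.
have second_part : 6 * (t * A / u) <= Z * (2 / (r ^+ 2 * t ^+ 3)).
  have rt : (r * t) ^+ 2 <= (r * t + t - 1) ^+ 2.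
    by rewrite lerXn2r ?nnegrE //; [rewrite mulr_ge0 // ltW | have : 0 < r * t by [rewrite mulr_gt0]; lra | lra].
  rewrite [leRHS](_ : _ = (t + 1) * (2 * t + 1) * ((r * t + t - 1) ^+ 2 / (r * t) ^+ 2) * (t / u) * (A * t / u) * t^-1); last first.
    by rewrite /Z; field; rewrite !gt_eqF.
  have q1 : 1 <= (r * t + t - 1) ^+ 2 / (r * t) ^+ 2.
    by rewrite ler_pdivlMr ?mul1r // exprn_gt0 // mulr_gt0.
  have q2 : t <= t / u by rewrite ler_pdivlMr // ler_piMr // ltW.
  have q3 : 6 <= (t + 1) * (2 * t + 1) by nra.
  rewrite [leLHS](_ : _ = 6 * 1 * t * (A * t / u) * t^-1); last first.
    by field; rewrite !gt_eqF.
  apply: ler_wpM2r; first by rewrite invr_ge0 ltW.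
  apply: ler_wpM2r; first by apply: divr_ge0; [apply: mulr_ge0 => //; exact: ltW | exact: ltW].
  by apply: ler_pM => //; apply: ler_pM.
have BE : B = 3 * t ^+ 4 + Z by [].
have i1 : 0 <= 12 / t ^+ 2 by rewrite divr_ge0 ?sqr_ge0.
have Z0 : 0 <= Z by move: B_ge1; rewrite BE lerDl.
have i2 : 0 <= 2 / (r ^+ 2 * t ^+ 3).
  by apply: divr_ge0 => //; apply: mulr_ge0; rewrite ?sqr_ge0 // exprn_ge0 // ltW.
have c1 : 0 <= Z * (12 / t ^+ 2) by exact: mulr_ge0.
have c2 : 0 <= 3 * t ^+ 4 * (2 / (r ^+ 2 * t ^+ 3)).
  by apply: mulr_ge0 => //; rewrite mulr_ge0 // exprn_ge0 // ltW.
have t2 : t <= t ^+ 2 by rewrite expr2 ler_peMl // ltW.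
rewrite C0E BE; lra.
Qed.

Section Consensus.
Variables (R : realType) (N n tau : nat) (e : rel 'I_N) (W : 'M[R]_N) (lam : seq R).
Variables (xi alpha : R) (X G : nat -> 'M[R]_(n, N)).
Hypotheses (N_ge2 : (2 <= N)%N) (tau_gt0 : (0 < tau)%N).
Hypotheses (Wmix : mixing_matrix e W) (lamP : spectrum W lam).
Hypotheses (xi_gt0 : 0 < xi) (xi_lt : xi < 2 / (tau%:R + 3)).
Let Z t := 2 *: X t.+1 - X t - alpha *: (G t.+1 - G t).
Hypothesis X_step : forall t,
  X t.+2 = if (t.+1 %% tau == 0)%N then Z t *m Wtilde xi W else Z t.

(** In the eigenbasis the deviation is the sum of the squares of the coordinates
    other than [i0], each of which obeys [mode_bound_const] with a modulus at
    most [sqrt rho]. *)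
Lemma consensus_bound K :
  \sum_(t < K.+1 * tau) frob (X t.+1 - mean_mx (X t.+1)) ^+ 2 <=
    (tau%:R - 1 + 8 * tau%:R * A4 N tau xi lam ^+ 2 / (1 - Num.sqrt (rho xi lam)))
      * (frob (X 0%N) ^+ 2 + frob (X 1%N) ^+ 2)
    + B2 N tau xi lam * alpha ^+ 2 * \sum_(t < K.+1 * tau) frob (G t.+1 - G t) ^+ 2.
Proof.
have [U [d [i0 [UU WU JU lam1 dP]]]] := mixing_spectrum N_ge2 Wmix lamP.
pose Y t := X t *m U^T; pose H t := G t *m U^T.
have WtU : Wtilde xi W *m U^T = U^T *m diag_mx (\row_i (1 - xi + xi * d 0 i)).
  have -> : Wtilde xi W = (1 - xi) *: 1%:M + xi *: W.
    apply/matrixP => i j; rewrite !mxE; case: eqVneq => [->|_]; last by rewrite mulr0 add0r.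
    by rewrite mulr1.
  rewrite mulmxDl -!scalemxAl mul1mx WU; apply/matrixP => i j.
  by rewrite !mul_mx_diag !mxE; ring.
have Y_step k i t : Y t.+2 k i = (if (t.+1 %% tau == 0)%N then 1 - xi + xi * d 0 i else 1)
    * (2 * Y t.+1 k i - Y t k i - alpha * (H t.+1 k i - H t k i)).
  have ZU : Z t *m U^T = 2 *: Y t.+1 - Y t - alpha *: (H t.+1 - H t).
    by rewrite /Z !mulmxBl -!scalemxAl mulmxBl.
  rewrite /Y X_step; case: ifP => _; last by rewrite ZU !mxE mul1r.
  by rewrite -mulmxA WtU mulmxA ZU mul_mx_diag !mxE mulrC.
have dev t : frob (X t - mean_mx (X t)) ^+ 2 = \sum_(i | i != i0) \sum_k Y t k i ^+ 2.
  rewrite -(frob_sqr_orthogonal _ UU) mulmxBl /mean_mx -mulmxA JU mulmxA -/(Y t).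
  move: (Y t) => V; rewrite frob_sqr exchange_big /= (bigD1 i0) //= big1 ?add0r => [|k _]; last first.
    rewrite !mxE (bigD1 i0) //= big1 ?addr0 => [|j ji]; rewrite !mxE ?eqxx ?(negbTE ji) ?mulr0 //.
    by rewrite mulr1 subrr expr0n.
  apply: eq_bigr => i ii0; apply: eq_bigr => k _; congr (_ ^+ 2); rewrite !mxE.
  rewrite [X in _ - X]big1 ?subr0 // => j _; rewrite [delta_mx _ _ _ _]mxE.
  by rewrite (negbTE ii0) andbF mulr0.
have frobY (V : 'M[R]_(n, N)) : \sum_(i | i != i0) \sum_k (V *m U^T) k i ^+ 2 <= frob V ^+ 2.
  rewrite -(frob_sqr_orthogonal V UU) frob_sqr [leRHS]exchange_big /= [leRHS](bigD1 i0) //= lerDr.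
  by apply: sumr_ge0 => k _; exact: sqr_ge0.
set C := tau%:R - 1 + _; set B := B2 _ _ _ _ * _.
have [rho_pos rho_lt1] := rho_bounds N_ge2 tau_gt0 Wmix lamP xi_gt0 xi_lt.
have rs1 : Num.sqrt (rho xi lam) < 1 by rewrite -sqrtr1 ltr_sqrt.
have mode i k : i != i0 -> \sum_(t < K.+1 * tau) Y t.+1 k i ^+ 2 <=
   C * (Y 0%N k i ^+ 2 + Y 1%N k i ^+ 2)
   + B * \sum_(t < K.+1 * tau) ((G t.+1 - G t) *m U^T) k i ^+ 2.
  move=> ii0; have [dN1 dle [j jN dE]] := dP i ii0.
  have d_lt1 : d 0 i < 1 by exact: le_lt_trans dle lam1.
  set r := 1 - xi + xi * d 0 i.
  have r0 : 0 < r := mode_factor_pos tau_gt0 xi_gt0 xi_lt dN1.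
  have s0 : 0 < Num.sqrt r by rewrite sqrtr_gt0.
  have r_le : r <= rho xi lam.
    by rewrite /r /rho /rho_ lerD2l ler_wpM2l // ltW.
  have rE : Num.sqrt r ^+ 2 = r by rewrite sqr_sqrtr // ltW.
  have s_le : Num.sqrt r <= Num.sqrt (rho xi lam) by rewrite ler_sqrt // ltW.
  have := @mode_bound_const _ (Num.sqrt r) (Num.sqrt (rho xi lam)) alpha tau
    (fun t => Y t k i) (fun t => H t k i) (A4 N tau xi lam) s0 s_le rs1 tau_gt0 _ _ _ K.
  rewrite rE sqr_sqrtr ?(ltW rho_pos) // -/B.
  have -> : \sum_(t < K.+1 * tau) ((G t.+1 - G t) *m U^T) k i ^+ 2
      = \sum_(t < K.+1 * tau) (H t.+1 k i - H t k i) ^+ 2.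
    by apply: eq_bigr => t _; rewrite mulmxBl; congr (_ ^+ 2); rewrite [LHS]mxE [X in _ + X = _]mxE.
  apply => //.
  - exact: (mode_disc_pos tau_gt0 xi_gt0 xi_lt dN1 d_lt1).
  - exact: (disc_le_A4 tau_gt0 xi_gt0 xi_lt jN dE dN1 d_lt1).
under eq_bigr do rewrite dev.
rewrite exchange_big /=; under eq_bigr => i _ do rewrite exchange_big /=.
apply: (@le_trans _ _ (\sum_(i | i != i0) \sum_k (C * (Y 0%N k i ^+ 2 + Y 1%N k i ^+ 2)
   + B * \sum_(t < K.+1 * tau) ((G t.+1 - G t) *m U^T) k i ^+ 2))).
  by apply: ler_sum => i ii0; apply: ler_sum => k _; exact: mode.
have C0 : 0 <= C.
  apply: addr_ge0; first by rewrite subr_ge0 ler1n.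
  apply: divr_ge0; last by rewrite subr_ge0 ltW.
  by apply: mulr_ge0; rewrite ?sqr_ge0 // mulr_ge0.
have B0 : 0 <= B by rewrite mulr_ge0 ?sqr_ge0 // (le_trans _ (B2_ge _ _ _ _)) // mulr_ge0 ?exprn_ge0.
rewrite [leLHS](_ : _ = \sum_(i | i != i0) (C * (\sum_k Y 0%N k i ^+ 2 + \sum_k Y 1%N k i ^+ 2)
   + B * \sum_k \sum_(t < K.+1 * tau) ((G t.+1 - G t) *m U^T) k i ^+ 2)); last first.
  by apply: eq_bigr => i _; rewrite big_split /= -!mulr_sumr big_split.
rewrite big_split /= -!mulr_sumr big_split /=; apply: lerD; apply: ler_wpM2l => //.
  by apply: lerD; exact: frobY.
under eq_bigr => i _ do rewrite exchange_big /=.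
by rewrite exchange_big /=; apply: ler_sum => t _; exact: frobY.
Qed.

End Consensus.

(** * Smooth functions and their averages *)

Section Euclid.
Variable R : realType.

Definition dot n (u v : 'cV[R]_n) : R := \sum_k u k 0 * v k 0.

Lemma frob_sqr_col n (u : 'cV[R]_n) : frob u ^+ 2 = \sum_k u k 0 ^+ 2.
Proof. by rewrite frob_sqr; apply: eq_bigr => k _; rewrite big_ord1. Qed.

Lemma frob_ge0 m n (A : 'M[R]_(m, n)) : 0 <= frob A.
Proof. exact: sqrtr_ge0. Qed.

Lemma dot_le_frob n (u v : 'cV[R]_n) : dot u v <= frob u * frob v.
Proof.
apply: le_trans (ler_norm _) _.
rewrite -(@ler_pXn2r _ 2) ?nnegrE ?mulr_ge0 ?frob_ge0 ?normr_ge0 //.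
rewrite real_normK ?num_real // exprMn !frob_sqr_col.
exact: sum_cauchy_schwarz.
Qed.

Lemma frob_sqr_average n N (v : 'I_N -> 'cV[R]_n) : (0 < N)%N ->
  frob (average v) ^+ 2 <= N%:R^-1 * \sum_i frob (v i) ^+ 2.
Proof.
move=> N0; have N0' : 0 < N%:R :> R by rewrite ltr0n.
under eq_bigr do rewrite frob_sqr_col.
rewrite frob_sqr_col exchange_big mulr_sumr /=; apply: ler_sum => k _.
rewrite /average !mxE summxE exprMn expr2 -mulrA ler_pM2l ?invr_gt0 //.
rewrite mulrC ler_pdivrMr // mulrC.
have := sum_cauchy_schwarz (fun=> 1) (fun i : 'I_N => v i k 0).
have -> : \sum_(i < N) (1 : R) ^+ 2 = N%:R by rewrite sumr_const card_ord expr1n.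
by rewrite /=; under eq_bigr do rewrite mul1r.
Qed.

Lemma derive_gradient n (f : 'cV[R]_n -> R) y v :
  differentiable f y -> 'D_v f y = dot (gradient f y) v.
Proof.
move=> df; rewrite deriveE // {1}(_ : v = \sum_k v k 0 *: delta_mx k 0).
  rewrite linear_sum; apply: eq_bigr => k _ /=.
  by rewrite linearZ /= mxE deriveE // mulrC.
by rewrite {1}[v]matrix_sum_delta; apply: eq_bigr => k _; rewrite big_ord1.
Qed.

Lemma is_derive_line n (f : 'cV[R]_n -> R) y v (s : R) :
  (forall z, differentiable f z) ->
  is_derive s 1 (fun s => f (s *: v + y)) (dot (gradient f (s *: v + y)) v).
Proof.
move=> df; have H : derivable f (s *: v + y) v by exact: diff_derivable.
have E : (fun h : R => h^-1 *: (((fun s : R => f (s *: v + y)) \o shift s) (h *: (1 : R)) - f (s *: v + y)))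
   = (fun h => h^-1 *: ((f \o shift (s *: v + y)) (h *: v) - f (s *: v + y))).
  apply/funext => h /=; congr (_ *: (f _ - _)).
  by rewrite [h *: 1]mulr1 scalerDl addrA.
rewrite -(derive_gradient v (df (s *: v + y))); apply: DeriveDef.
  by rewrite /derivable E.
by rewrite /derive E.
Qed.

(** Along the segment, [f] minus its quadratic upper bound has a nonpositive
    derivative. *)
Lemma descent_lemma n (f : 'cV[R]_n -> R) (L : R) :
  (forall z, differentiable f z) ->
  (forall y z, frob (gradient f y - gradient f z) <= L * frob (y - z)) ->
  forall y v, f (v + y) <= f y + dot (gradient f y) v + L / 2 * frob v ^+ 2.
Proof.
move=> df lip y v.
pose D := dot (gradient f y) v; pose V := frob v ^+ 2.
pose g s := f (s *: v + y) - s * D - L / 2 * V * s ^+ 2.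
pose g' s := dot (gradient f (s *: v + y)) v - D - L * V * s.
have gd (s : R) : is_derive s (1 : R) g (g' s).
  have H1 := is_derive_line y v s df.
  have H2 : is_derive s 1 (fun s : R => s * D) D.
    apply: (is_derive_eq (is_deriveM (is_derive_id s (1 : R)) (is_derive_cst D s (1 : R)))).
    by rewrite /GRing.scale /=; ring.
  have H3 : is_derive s 1 (fun s : R => L / 2 * V * s ^+ 2) (L * V * s).
    apply: (is_derive_eq (is_deriveZ (L / 2 * V) (is_deriveX 2 (is_derive_id s (1 : R))))).
    by rewrite /GRing.scale /=; field.
  exact: (is_deriveB (is_deriveB H1 H2) H3).
have cg : {within `[0, 1], continuous g}.
  (apply: derivable_within_continuous => s _; exact: (@ex_derive _ _ _ _ _ _ _ (gd s))).
have [c c01 gE] := MVT ltr01 (fun s _ => gd s) cg.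
have c0 : 0 <= c by move: c01; rewrite in_itv /= => /andP[/ltW].
have g'c : g' c <= 0.
  have -> : g' c = dot (gradient f (c *: v + y) - gradient f y) v - L * V * c.
    rewrite /g' /D /dot -sumrB; congr (_ - _); apply: eq_bigr => k _.
    by rewrite [X in _ = X * _]mxE [X in _ = (_ + X) * _]mxE mulrBl.
  rewrite subr_le0; apply: le_trans (dot_le_frob _ _) _.
  apply: le_trans (ler_wpM2r (frob_ge0 _) (lip _ _)) _.
  rewrite addrK.
  have -> : frob (c *: v) = c * frob v.
    apply/eqP; rewrite -(@eqrXn2 _ 2) ?mulr_ge0 ?frob_ge0 //; apply/eqP.
    rewrite exprMn !frob_sqr_col mulr_sumr; apply: eq_bigr => k _.
    by rewrite mxE exprMn.
  by rewrite /V le_eqVlt; apply/orP; left; apply/eqP; ring.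
move: gE; rewrite subr0 mulr1 /g scale1r scale0r add0r => gE.
(move: g'c; rewrite -gE /D /V; lra).
Qed.

Section Average.
Variables (N : nat) (V : lmodType R).
Implicit Types u v : 'I_N -> V.

Lemma averageB u v : average (fun i => u i - v i) = average u - average v.
Proof. by rewrite /average -scalerBr -sumrB. Qed.

Lemma averageD u v : average (fun i => u i + v i) = average u + average v.
Proof. by rewrite /average -scalerDr -big_split. Qed.

Lemma averageZ c v : average (fun i => c *: v i) = c *: average v.
Proof. by rewrite /average -scaler_sumr !scalerA mulrC. Qed.

End Average.

Section AverageGradient.
Variables (n N : nat) (fi : 'I_N -> 'cV[R]_n -> R) (f : 'cV[R]_n -> R).
Hypotheses (fi_diff : forall i (y : 'cV[R]_n), differentiable (fi i) y).
Hypothesis fE : forall y, f y = N%:R^-1 * \sum_i fi i y.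

Let f_eq : f = N%:R^-1 \*: (\sum_i fi i).
Proof. by apply/funext => y; rewrite fE fct_sumE. Qed.

Lemma differentiable_average (y : 'cV[R]_n) : differentiable f y.
Proof. by rewrite f_eq; apply: differentiableZ; apply: differentiable_sum => i. Qed.

Lemma gradient_average y : gradient f y = average (fun i => gradient (fi i) y).
Proof.
apply/colP => k; rewrite /average !mxE summxE f_eq.
rewrite deriveZ; last by apply: derivable_sum => i; exact: diff_derivable.
rewrite derive_sum => [|i]; last exact: diff_derivable.
by congr (_ *: _); apply: eq_bigr => i _; rewrite mxE.
Qed.

Variable L : R.
Hypotheses (L_ge0 : 0 <= L) (N_gt0 : (0 < N)%N).
Hypothesis smooth : forall i y z,
  frob (gradient (fi i) y - gradient (fi i) z) <= L * frob (y - z).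

Lemma smooth_sqr i y z :
  frob (gradient (fi i) y - gradient (fi i) z) ^+ 2 <= L ^+ 2 * frob (y - z) ^+ 2.
Proof.
by rewrite -exprMn lerXn2r ?nnegrE ?mulr_ge0 ?frob_ge0.
Qed.

Lemma gradient_average_dist (x : 'I_N -> 'cV[R]_n) y :
  frob (gradient f y - average (fun i => gradient (fi i) (x i))) ^+ 2
  <= L ^+ 2 * (N%:R^-1 * \sum_i frob (y - x i) ^+ 2).
Proof.
rewrite gradient_average -averageB; apply: le_trans (frob_sqr_average _ N_gt0) _.
rewrite mulrCA ler_wpM2l ?invr_ge0 // mulr_sumr; apply: ler_sum => i _.
exact: smooth_sqr.
Qed.

Lemma smooth_average y z : frob (gradient f y - gradient f z) <= L * frob (y - z).
Proof.
rewrite -(@ler_pXn2r _ 2) ?nnegrE ?mulr_ge0 ?frob_ge0 // exprMn.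
rewrite [in X in _ <= _ * X](_ : frob (y - z) ^+ 2 = N%:R^-1 * \sum_(i < N) frob (y - z) ^+ 2).
  by rewrite {1}(gradient_average z); exact: gradient_average_dist (fun=> z) y.
by rewrite sumr_const card_ord -[_ ^+ 2 *+ N]mulr_natl mulKf // pnatr_eq0 -lt0n.
Qed.

End AverageGradient.

End Euclid.

(** * Measurability of random gradients, and square integrable variables *)

Section Caratheodory.
Context {R : realType} {d : measure_display} {T : measurableType d} {n : nat}.

(** If [Y] takes countably many values, [F (Y w) w] is measurable piece by
    piece.  In general the coordinates of [Y] are rounded down to multiples of
    [1 / (m + 1)], and continuity in the first argument gives the limit. *)
Lemma measurable_caratheodory (F : 'cV[R]_n -> T -> R) (Y : T -> 'cV[R]_n) :
  (forall w, continuous (F ^~ w)) -> (forall y, measurable_fun setT (F y)) ->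
  (forall k, measurable_fun setT (fun w => Y w k 0)) ->
  measurable_fun setT (fun w => F (Y w) w).
Proof.
move=> Fc Fm Ym.
pose q (m : nat) w : 'cV[int]_n := \col_k Num.floor (m.+1%:R * Y w k 0).
pose grid (m : nat) (z : 'cV[int]_n) : 'cV[R]_n := \col_k ((z k 0)%:~R / m.+1%:R).
pose h (m : nat) w := F (grid m (q m w)) w.
apply: (measurable_fun_cvg (h := h)) => [m|w _]; last first.
  suff key : (fun m => grid m (q m w)) @ \oo --> Y w.
    exact: (cvg_comp _ _ key (Fc w (Y w))).
  apply/cvg_ballP => e e0; near=> m.
  split=> // k j; rewrite !ord1 !mxE /ball /=.
  set a := Y w k 0; have /andP[a1 a2] := Num.Theory.floor_itv (m.+1%:R * a).
  have m0 : 0 < m.+1%:R :> R by [].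
  have : m.+1%:R^-1 < e by near: m; exact: (near_infty_natSinv_lt (PosNum e0)).
  apply: le_lt_trans.
  have -> : a - (Num.floor (m.+1%:R * a))%:~R / m.+1%:R
      = (m.+1%:R * a - (Num.floor (m.+1%:R * a))%:~R) / m.+1%:R.
    by rewrite mulrBl mulrAC divff ?mul1r // gt_eqF.
  rewrite normrM [`|_^-1|]ger0_norm ?invr_ge0 // ler_piMl ?invr_ge0 //.
  rewrite ger0_norm ?subr_ge0 // lerBlDl.
  by move: a2; rewrite intrD => /ltW.
move=> _ B mB; rewrite setTI.
have -> : h m @^-1` B = \bigcup_(z : 'cV[int]_n) ([set w | q m w = z] `&` F (grid m z) @^-1` B).
  apply/seteqP; split => [w Bw|w [z _ [<-]]] //.
  by exists (q m w).
apply: countable_bigcupT_measurable => [|z]; first exact: countableP.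
apply: measurableI; last by rewrite -[X in measurable X]setTI; exact: Fm.
have -> : [set w | q m w = z]
    = \bigcap_(k in [set: 'I_n]) ((fun w => Y w k 0) @^-1` `[(z k 0)%:~R / m.+1%:R, (z k 0 + 1)%:~R / m.+1%:R[%classic).
  apply/seteqP; split => w /=.
    move=> qz k _ /=; rewrite in_itv /= ler_pdivrMr // ltr_pdivlMr // mulrC.
    have <- : q m w k 0 = z k 0 by rewrite qz.
    by rewrite mxE; exact: Num.Theory.floor_itv.
  move=> H; apply/colP => k; rewrite mxE; apply: Num.Theory.floor_def.
  have := H k I; rewrite /= in_itv /= ler_pdivrMr // ltr_pdivlMr //.
  by rewrite mulrC.
apply: fin_bigcap_measurable => // k _.
rewrite -[X in measurable X]setTI; apply: Ym => //.
Unshelve. all: by end_near.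
Qed.

(** A partial derivative is a limit of difference quotients along [1 / (m + 1)],
    each of which is measurable by [measurable_caratheodory]. *)
Lemma measurable_gradient (F : 'cV[R]_n -> T -> R) (Y : T -> 'cV[R]_n) :
  (forall w y, differentiable (F ^~ w) y) -> (forall y, measurable_fun setT (F y)) ->
  (forall k, measurable_fun setT (fun w => Y w k 0)) ->
  forall k, measurable_fun setT (fun w => gradient (F ^~ w) (Y w) k 0).
Proof.
move=> Fd Fm Ym k.
have Fc w : continuous (F ^~ w) by move=> y; exact: differentiable_continuous.
pose h (m : nat) w := m.+1%:R^-1^-1 *:
  (F (m.+1%:R^-1 *: delta_mx k 0 + Y w) w - F (Y w) w).
apply: (measurable_fun_cvg (h := h)) => [m|w _].
  apply: measurable_funM => //; apply: measurable_funB; apply: measurable_caratheodory => // j.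
  have -> : (fun w => (m.+1%:R^-1 *: delta_mx k 0 + Y w) j 0)
      = (fun w => (m.+1%:R^-1 *: delta_mx k 0 : 'cV[R]_n) j 0 + Y w j 0).
    by apply/funext => w; rewrite mxE.
  exact: measurable_funD.
have dF : derivable (F ^~ w) (Y w) (delta_mx k 0) by exact: diff_derivable.
rewrite mxE; have to0 : (fun m : nat => m.+1%:R^-1 : R) @ \oo --> 0^'.
  move=> A [e /= e0 eA]; suff: \forall m \near \oo, A (m.+1%:R^-1) by [].
  near=> m; apply: eA => /=; last by rewrite invr_eq0 pnatr_eq0.
  rewrite sub0r normrN ger0_norm ?invr_ge0 //.
  by near: m; exact: (near_infty_natSinv_lt (PosNum e0)).
exact: (cvg_comp _ _ to0 dF).
Unshelve. all: by end_near.
Qed.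

End Caratheodory.

Section SquareIntegrable.
Context {R : realType} {d : measure_display} {T : measurableType d}.
Variable P : probability T R.
Implicit Types (g h : T -> R) (c : R).

Definition integ (h : T -> R) := P.-integrable setT (EFin \o h).

Definition sq_integ (h : T -> R) :=
  measurable_fun setT h /\ integ (fun w => h w ^+ 2).

Lemma integ_le g h : measurable_fun setT g -> (forall w, `|g w| <= h w) ->
  integ h -> integ g.
Proof.
move=> mg gh; apply: le_integrable => //; first exact/measurable_EFinP.
by move=> w _ /=; rewrite lee_fin (le_trans (gh w)) // ler_norm.
Qed.

Lemma integD g h : integ g -> integ h -> integ (fun w => g w + h w).
Proof. by move=> ig ih; apply: eq_integrable (integrableD _ ig ih). Qed.

Lemma integZ c h : integ h -> integ (fun w => c * h w).
Proof. by move=> ih; apply: eq_integrable (integrableZl _ c ih). Qed.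

Lemma integB g h : integ g -> integ h -> integ (fun w => g w - h w).
Proof. by move=> ig ih; apply: eq_integrable (integrableB _ ig ih). Qed.

Lemma integ_cst c : integ (fun=> c).
Proof. exact: finite_measure_integrable_cst. Qed.

Lemma integ_sum (I : Type) (r : seq I) (Q : pred I) (h : I -> T -> R) :
  (forall i, Q i -> integ (h i)) -> integ (fun w => \sum_(i <- r | Q i) h i w).
Proof.
move=> ih; elim: r => [|i r IH].
  by apply: eq_integrable (integ_cst 0) => // w _ /=; rewrite big_nil.
case: (boolP (Q i)) => Qi.
  apply: eq_integrable (integD (ih i Qi) IH) => // w _ /=.
  by rewrite big_cons Qi.
by apply: eq_integrable IH => // w _ /=; rewrite big_cons (negbTE Qi).
Qed.

Lemma sq_integM g h : sq_integ g -> sq_integ h -> integ (fun w => g w * h w).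
Proof.
move=> [mg ig] [mh ih].
apply: integ_le (integD ig ih); first exact: measurable_funM.
move=> w; rewrite normrM -(real_normK (num_real (g w))) -(real_normK (num_real (h w))).
have := sqr_ge0 (`|g w| - `|h w|); have := normr_ge0 (g w); have := normr_ge0 (h w).
by move: `|g w| `|h w| => a b a0 b0; rewrite !expr2; nra.
Qed.

Lemma sq_integ_cst c : sq_integ (fun=> c).
Proof. by split => //; exact: integ_cst. Qed.

Lemma sq_integ_integ h : sq_integ h -> integ h.
Proof.
move=> ih; apply: eq_integrable (sq_integM ih (sq_integ_cst 1)) => // w _ /=.
by rewrite mulr1.
Qed.

Lemma sq_integZ c h : sq_integ h -> sq_integ (fun w => c * h w).
Proof.
move=> [mh ih]; split; first exact: measurable_funM.
apply: eq_integrable (integZ (c ^+ 2) ih) => // w _ /=.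
by rewrite exprMn.
Qed.

Lemma sq_integD g h : sq_integ g -> sq_integ h -> sq_integ (fun w => g w + h w).
Proof.
move=> ig ih; split; first exact: measurable_funD ig.1 ih.1.
apply: eq_integrable (integD (integD ig.2 ih.2) (integZ 2 (sq_integM ig ih))) => // w _ /=.
by congr EFin; ring.
Qed.

Lemma sq_integB g h : sq_integ g -> sq_integ h -> sq_integ (fun w => g w - h w).
Proof.
move=> ig ih; have := sq_integD ig (sq_integZ (-1) ih).
by under eq_fun do rewrite mulN1r.
Qed.

Lemma sq_integ_sum (I : Type) (r : seq I) (Q : pred I) (h : I -> T -> R) :
  (forall i, Q i -> sq_integ (h i)) -> sq_integ (fun w => \sum_(i <- r | Q i) h i w).
Proof.
move=> ih; elim: r => [|i r IH].
  by under eq_fun do rewrite big_nil; exact: sq_integ_cst.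
case: (boolP (Q i)) => Qi.
  by under eq_fun do rewrite big_cons Qi; exact: sq_integD (ih i Qi) IH.
by under eq_fun do rewrite big_cons (negbTE Qi).
Qed.

Lemma sq_integ_le g h : measurable_fun setT g -> (forall w, g w ^+ 2 <= h w) ->
  integ h -> sq_integ g.
Proof.
move=> mg gh ih; split => //; apply: integ_le ih; first exact: measurable_funX.
by move=> w; rewrite ger0_norm ?sqr_ge0.
Qed.

Definition mean (h : T -> R) : R := \int[P]_w h w.

Lemma expectation_mean h : integ h -> ('E_P[h] = (mean h)%:E)%E.
Proof.
by move=> ih; rewrite unlock /mean /Rintegral fineK //; exact: integrable_fin_num.
Qed.

Lemma meanD g h : integ g -> integ h -> mean (fun w => g w + h w) = mean g + mean h.
Proof. by move=> ig ih; rewrite /mean RintegralD. Qed.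

Lemma meanB g h : integ g -> integ h -> mean (fun w => g w - h w) = mean g - mean h.
Proof. by move=> ig ih; rewrite /mean RintegralB. Qed.

Lemma meanZ c h : integ h -> mean (fun w => c * h w) = c * mean h.
Proof. by move=> ih; rewrite /mean RintegralZl. Qed.

Lemma mean_cst c : mean (fun=> c) = c.
Proof.
rewrite /mean Rintegral_cst // -[RHS]mulr1; congr (c * _).
exact: (congr1 fine (probability_setT P)).
Qed.

Lemma mean_le g h : integ g -> integ h -> (forall w, g w <= h w) -> mean g <= mean h.
Proof. by move=> ig ih gh; apply: le_Rintegral. Qed.

Lemma mean_ge0 h : (forall w, 0 <= h w) -> 0 <= mean h.
Proof. by move=> h0; apply: Rintegral_ge0. Qed.

Lemma mean_sum (I : Type) (r : seq I) (Q : pred I) (h : I -> T -> R) :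
  (forall i, Q i -> integ (h i)) ->
  mean (fun w => \sum_(i <- r | Q i) h i w) = \sum_(i <- r | Q i) mean (h i).
Proof.
move=> ih; elim: r => [|i r IH].
  by rewrite big_nil -[RHS](mean_cst 0); congr mean; apply/funext => w; rewrite big_nil.
rewrite big_cons; case: ifP => Qi.
  rewrite -IH -meanD; [|exact: ih|exact: integ_sum].
  by congr mean; apply/funext => w; rewrite big_cons Qi.
by rewrite -IH; congr mean; apply/funext => w; rewrite big_cons Qi.
Qed.

End SquareIntegrable.

(** * A sample independent of the past *)

(** The past is the sigma-algebra generated by [G].  It is put on [Omega] as a
    second measurable structure, so that the pair of the present outcome, known
    only up to the past, and of the sample [zeta] is a random variable with
    values in a product space. *)
Section Fresh.
Context {R : realType} {d dS : measure_display} {Omega : measurableType d} {S : measurableType dS}.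
Variables (P : probability Omega R) (D : probability S R) (G : set (set Omega)).
Variable (zeta : {RV P >-> S}).
Hypothesis G_meas : G `<=` measurable.
Hypothesis law : forall B, measurable B -> distribution P zeta B = D B.
Hypothesis indep : forall A B, preimage_set_system setT zeta measurable A ->
  <<s G >> B -> P (A `&` B) = (P A * P B)%E.

Notation past := (g_sigma_algebraType G).

Lemma past_measurable (A : set Omega) : <<s G >> A -> measurable A.
Proof. by move: A; apply: smallest_sub => //; exact: sigma_algebra_measurable. Qed.

Lemma measurable_to_past : measurable_fun [set: Omega] (id : Omega -> past).
Proof. by move=> _ B mB; rewrite setTI; exact: past_measurable. Qed.

Let id_mixin := isMeasurableFun.Build _ _ _ _ _ measurable_to_past.
Let to_past : {mfun Omega >-> past} := HB.pack (id : Omega -> past) id_mixin.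

Lemma measurable_pair_past :
  measurable_fun [set: Omega] (fun w => (w, zeta w) : past * S).
Proof. by apply: measurable_fun_pair => //; exact: measurable_to_past. Qed.

Let pair_mixin := isMeasurableFun.Build _ _ _ _ _ measurable_pair_past.
Let pair_past : {mfun Omega >-> (past * S)%type} :=
  HB.pack (fun w => (w, zeta w) : past * S) pair_mixin.

(** Independence is the equality of the two measures on rectangles, and a
    product measure is determined by its values there. *)
Lemma fresh_law (X : set (past * S)) : measurable X ->
  (distribution P to_past \x D)%E X = distribution P pair_past X.
Proof.
apply: product_measure_unique => A B mA mB.
rewrite /distribution /pushforward /=.
transitivity (P (zeta @^-1` B `&` A)).
  by congr (P _); apply/seteqP; split => w [] /=.
rewrite indep //; first by rewrite muleC -law.
by exists B => //; rewrite setTI.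
Qed.

Lemma fresh_integral_ge0 (H : past * S -> \bar R) :
  measurable_fun setT H -> (forall z, (0 <= H z)%E) ->
  (\int[P]_w H (w, zeta w) = \int[P]_w \int[D]_s H (w, s))%E.
Proof.
move=> mH H0.
transitivity (\int[distribution P pair_past]_z H z)%E.
  by rewrite ge0_integral_distribution.
rewrite (eq_measure_integral (distribution P to_past \x D)%E); last first.
  by move=> A mA _; exact/esym/fresh_law.
rewrite fubini_tonelli1 // ge0_integral_distribution //.
  exact: measurable_fun_fubini_tonelli_F.
by move=> w; exact: integral_ge0.
Qed.

(** Integrating first over the sample, by Fubini for the product law, gives
    zero. *)
Lemma fresh_mean0 (H : past * S -> R) : measurable_fun setT H ->
  integ P (fun w => H (w, zeta w)) -> (forall w, (\int[D]_s (H (w, s))%:E = 0)%E) ->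
  mean P (fun w => H (w, zeta w)) = 0.
Proof.
move=> mH iH H0.
have mHE : measurable_fun setT (EFin \o H) by exact/measurable_EFinP.
have iprod : ((distribution P to_past \x D)%E).-integrable setT (EFin \o H).
  apply/integrableP; split => //.
  rewrite (eq_measure_integral (distribution P pair_past)); last first.
    by move=> A mA _; exact: fresh_law.
  by rewrite ge0_integral_distribution //; [move/integrableP: iH => [] | exact: measurableT_comp].
rewrite /mean /Rintegral.
have -> : (\int[P]_w (H (w, zeta w))%:E = \int[distribution P pair_past]_z (EFin \o H) z)%E.
  by rewrite integral_distribution.
rewrite (eq_measure_integral (distribution P to_past \x D)%E); last first.
  by move=> A mA _; exact/esym/fresh_law.
rewrite -integral12_prod_meas1 // (eq_integral (cst 0%E)); last first.
  by move=> w _; exact: H0.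
by rewrite integral0.
Qed.

End Fresh.

(** * Combining descent and consensus *)

(** [S], [G], [F] and [f] stand for the expectations of the squared deviation,
    of the squared average gradient, of the squared gradient at the average and
    of the objective at the average; [E0] and [E1] for those of the squared
    norms of the first two iterates. *)
Section FinalCombination.
Variables (R : realFieldType) (N tau K : nat) (L alpha sigma r B C0 E0 E1 fs : R).
Variables (S G F f : nat -> R).
Let T := (K.+1 * tau)%N.
Hypotheses (N_ge2 : (2 <= N)%N) (tau_gt0 : (0 < tau)%N) (K_gt0 : (0 < K)%N).
Hypotheses (L_gt0 : 0 < L) (alpha_gt0 : 0 < alpha) (r_gt0 : 0 < r).
Hypotheses (B_ge : 3 * tau%:R ^+ 4 <= B) (C0_ge0 : 0 <= C0).
Hypothesis C0_le :
  (13 * C0 + 6) / 2 <= 13 * B * (2 / (r ^+ 2 * tau%:R ^+ 3) + 12 / tau%:R ^+ 2).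
Hypothesis alpha_le : 13 * B * (alpha ^+ 2 * L ^+ 2) <= 1.
Hypotheses (E0_ge0 : 0 <= E0) (E1_ge0 : 0 <= E1) (S0_le : S 0%N <= E0).
Hypotheses (S_ge0 : forall t, 0 <= S t) (G_ge0 : forall t, 0 <= G t).
Hypothesis fs_le : forall t, fs <= f t.
Hypothesis descent : forall t, f t.+1 <= f t - alpha / 2 * F t
  - alpha / 2 * (1 - L * alpha) * G t + alpha * L ^+ 2 / (2 * N%:R) * S t
  + L * alpha ^+ 2 * sigma ^+ 2 / 2.
Hypothesis consensus : \sum_(t < T) S t.+1 <= C0 * (E0 + E1) + B * alpha ^+ 2 *
  \sum_(t < T) (3 * L ^+ 2 * (2 * S t.+1 + 2 * S t + N%:R * alpha ^+ 2 * (G t + sigma ^+ 2))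
     + 6 * N%:R * sigma ^+ 2).

(** The right-hand side of [consensus] contains the deviations with factor at
    most [12 B alpha^2 L^2 <= 12/13]; moving them to the left multiplies
    everything else by 13. *)
Lemma consensus_solved : \sum_(t < T) S t.+1 <=
  (13 * C0 + 6) * (E0 + E1)
  + 3 * N%:R * alpha ^+ 2 * (G 0%N + \sum_(t < T) G t.+1 + T%:R * sigma ^+ 2)
  + 78 * B * alpha ^+ 2 * N%:R * sigma ^+ 2 * T%:R.
Proof.
have B0 : 0 <= B by apply: le_trans B_ge; rewrite mulr_ge0 ?exprn_ge0.
have Sshift (u : nat -> R) : (forall t, 0 <= u t) ->
    \sum_(t < T) u t <= u 0%N + \sum_(t < T) u t.+1.
  move=> u0; case: T => [|m]; first by rewrite !big_ord0 addr0.
  by rewrite big_ord_recl lerD2l [leRHS]big_ord_recr /= lerDl.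
have HS := Sshift S S_ge0; have HG := Sshift G G_ge0.
move: consensus; rewrite big_split /= -mulr_sumr big_split /= big_split /= -!mulr_sumr.
rewrite big_split /= !sumr_const card_ord.
move: HS HG; set SS := \sum_(t < T) S t.+1; set S' := \sum_(t < T) S t.
set G' := \sum_(t < T) G t; set GG := \sum_(t < T) G t.+1 => HS HG.
rewrite -[sigma ^+ 2 *+ T]mulr_natl -[sigma *+ T]mulr_natl.
have qB := alpha_le.
set q := alpha ^+ 2 * L ^+ 2 in qB *.
have q0 : 0 <= q by rewrite mulr_ge0 ?sqr_ge0.
have SS0 : 0 <= SS by apply: sumr_ge0.
have N0 : 0 <= N%:R * alpha ^+ 2 by rewrite mulr_ge0 ?sqr_ge0.
have T0 : 0 <= T%:R * sigma ^+ 2 by rewrite mulr_ge0 ?sqr_ge0.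
have Bq0 : 0 <= B * q by exact: mulr_ge0.
set X := G 0%N + GG + T%:R * sigma ^+ 2.
have X0 : 0 <= X by rewrite !addr_ge0 //; exact: sumr_ge0.
rewrite (_ : B * alpha ^+ 2 * _ = B * q * (6 * SS + 6 * S')
   + 3 * (B * q) * (N%:R * alpha ^+ 2) * (G' + T%:R * sigma ^+ 2)
   + 6 * B * alpha ^+ 2 * N%:R * sigma ^+ 2 * T%:R); last by rewrite /q; ring.
have k1 : B * q * (6 * SS + 6 * S') <= B * q * (12 * SS + 6 * E0).
  by apply: ler_wpM2l => //; have := S0_le; lra.
have k2 : 3 * (B * q) * (N%:R * alpha ^+ 2) * (G' + T%:R * sigma ^+ 2)
   <= 3 / 13 * (N%:R * alpha ^+ 2) * X.
  apply: (@le_trans _ _ (3 * (B * q) * (N%:R * alpha ^+ 2) * X)).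
    apply: ler_wpM2l; last by rewrite /X; lra.
    by rewrite mulr_ge0 // mulr_ge0.
  apply: ler_wpM2r => //; apply: ler_wpM2r => //; lra.
have k3 : B * q * (12 * SS + 6 * E0) <= 1 / 13 * (12 * SS + 6 * E0).
  apply: ler_wpM2r; first by rewrite addr_ge0 // mulr_ge0.
  by lra.
have := E1_ge0; have := E0_ge0; lra.
Qed.

(** The total deviation from [consensus_solved] is inserted in the telescoped
    descent inequality.  Its share [3 alpha^2 L^2] of the squared average
    gradients is covered by [1 - L alpha], except at time 0, and its share of
    the noise is covered by doubling the constant 78. *)
Lemma final_combination : T%:R^-1 * \sum_(t < T) F t.+1 <=
  (2 * f 1%N - 2 * fs) / (alpha * tau%:R * K%:R)
  + (2 * E1 + 2 * E0) / (alpha ^+ 2 * r ^+ 2 * tau%:R ^+ 4 * K%:R)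
  + (12 * E1 + 12 * E0) / (tau%:R ^+ 3 * alpha ^+ 2 * K%:R)
  + 6 * G 0%N / (tau%:R ^+ 3 * K%:R)
  + L * alpha * sigma ^+ 2
  + 156 * B * alpha ^+ 2 * L ^+ 2 * sigma ^+ 2.
Proof.
have SSle := consensus_solved.
have tele : forall m, \sum_(t < m) (alpha / 2 * F t.+1 + alpha / 2 * (1 - L * alpha) * G t.+1
    - alpha * L ^+ 2 / (2 * N%:R) * S t.+1 - L * alpha ^+ 2 * sigma ^+ 2 / 2) <= f 1%N - f m.+1.
  elim=> [|m IH]; first by rewrite big_ord0 subrr.
  by rewrite big_ord_recr /=; have := descent m.+1; lra.
have := tele T; rewrite sumrB sumrB big_split /= -!mulr_sumr sumr_const card_ord.
have := fs_le T.+1; move: SSle.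
set SS := \sum_(t < T) S t.+1; set GG := \sum_(t < T) G t.+1; set FF := \sum_(t < T) F t.+1.
rewrite -[2^-1 *+ T]mulr_natl.
set t := tau%:R; set k := K%:R.
have t1 : 1 <= t :> R by rewrite /t ler1n.
have k1 : 1 <= k :> R by rewrite /k ler1n.
have TE : T%:R = (k + 1) * t :> R by rewrite /T natrM -addn1 natrD.
rewrite TE; set n := N%:R; have n2 : 2 <= n :> R by rewrite /n ler_nat.
have GG0 : 0 <= GG by exact: sumr_ge0.
have f1 := fs_le 1%N.
have qB := alpha_le; set q := alpha ^+ 2 * L ^+ 2 in qB *.
have al := alpha_gt0; have Lp := L_gt0; have rp := r_gt0.
have Bge : 3 * t ^+ 4 <= B by exact: B_ge.
have t0 : 0 < t by lra.
have k0 : 0 < k by lra.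
have n0 : 0 < n by lra.
have k10 : 0 < k + 1 by lra.
have tk0 : 0 < (k + 1) * t by rewrite mulr_gt0.
have q0 : 0 < q by rewrite mulr_gt0 ?exprn_gt0.
have B0 : 0 < B by apply: lt_le_trans Bge; rewrite mulr_gt0 ?exprn_gt0.
move=> H1 H2 H3.
(* The telescoped descent inequality divided by alpha T / 2. *)
have H4 : ((k + 1) * t)^-1 * FF <= (2 * f 1%N - 2 * fs) / (alpha * ((k + 1) * t))
   - (1 - L * alpha) * GG / ((k + 1) * t) + L ^+ 2 / (n * ((k + 1) * t)) * SS
   + L * alpha * sigma ^+ 2.
  rewrite -subr_ge0 (_ : _ - _ = (f 1%N - fs - (alpha / 2 * FF + alpha / 2 * (1 - L * alpha) * GG
    - alpha * L ^+ 2 / (2 * n) * SS - (k + 1) * t * (L * alpha ^+ 2 * sigma ^+ 2 / 2)))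
     / (alpha * ((k + 1) * t) / 2)).
        by rewrite divr_ge0 //; [lra | rewrite divr_ge0 // mulr_ge0 // ltW].
  by field; rewrite !gt_eqF.
apply: le_trans H4 _.
have iTk : ((k + 1) * t)^-1 <= (k * t)^-1.
  by rewrite lef_pV2 ?posrE ?mulr_gt0 // ler_pM2r //; lra.
have Ha : (2 * f 1%N - 2 * fs) / (alpha * ((k + 1) * t)) <= (2 * f 1%N - 2 * fs) / (alpha * t * k).
  apply: ler_wpM2l; first lra.
  by rewrite -mulrA !invfM ler_pM2l ?invr_gt0 // -!invfM [t * k]mulrC.
set E := E0 + E1 in H1.
have E_ge0 : 0 <= E by exact: addr_ge0.
have t4 : t ^+ 2 <= t ^+ 4 by apply: ler_weXn2l.
have t2 : 1 <= t ^+ 2 by rewrite exprn_ege1.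
have t41 : 1 <= t ^+ 4 by rewrite exprn_ege1.
have qt : 39 * (t ^+ 4 * q) <= 1.
  apply: le_trans qB; rewrite [leLHS](_ : _ = 13 * (3 * t ^+ 4) * q); last by ring.
  by rewrite ler_pM2r // ler_pM2l.
have q39 : 39 * q <= 1.
  by apply: le_trans qt; rewrite ler_pM2l // ler_peMl // ltW.
have La0 : 0 <= L * alpha by apply: mulr_ge0; exact: ltW.
(* From [39 q <= 1], where [q = (L alpha)^2]; hence [3 q <= 1 - L alpha]. *)
have La : L * alpha <= 1 / 6.
  rewrite -(@ler_pXn2r _ 2) ?nnegrE ?divr_ge0 //.
  by rewrite (_ : (L * alpha) ^+ 2 = q); [lra | rewrite /q; ring].
have Hb : L ^+ 2 / (n * ((k + 1) * t)) * SS <= L ^+ 2 * ((13 * C0 + 6) / n) * E / ((k + 1) * t)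
   + 3 * q * (G 0%N + GG) / ((k + 1) * t) + 3 * q * sigma ^+ 2 + 78 * B * q * sigma ^+ 2.
  rewrite [leRHS](_ : _ = L ^+ 2 / (n * ((k + 1) * t)) * ((13 * C0 + 6) * E +
     3 * n * alpha ^+ 2 * (G 0%N + GG + (k + 1) * t * sigma ^+ 2) +
     78 * B * alpha ^+ 2 * n * sigma ^+ 2 * ((k + 1) * t))); last first.
    by rewrite /q; field; rewrite !gt_eqF.
  by apply: ler_wpM2l => //; rewrite divr_ge0 ?sqr_ge0 // mulr_ge0 // ltW.
have Hc : 3 * q * GG / ((k + 1) * t) <= (1 - L * alpha) * GG / ((k + 1) * t).
  by apply: ler_wpM2r; [rewrite invr_ge0 ltW | apply: ler_wpM2r => //; lra].
have Hd : 3 * q * G 0%N / ((k + 1) * t) <= 6 * G 0%N / (t ^+ 3 * k).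
  apply: (@le_trans _ _ (3 * q * G 0%N / (k * t))).
    by apply: ler_wpM2l => //; rewrite mulr_ge0 // mulr_ge0 // ltW.
  rewrite [leLHS](_ : _ = (3 * (q * t ^+ 2)) * (G 0%N / (t ^+ 3 * k))); last first.
    by field; rewrite !gt_eqF.
  rewrite -[leRHS]mulrA; apply: ler_wpM2r.
    by rewrite divr_ge0 // mulr_ge0 ?exprn_ge0 // ltW.
  have : q * t ^+ 2 <= t ^+ 4 * q by rewrite mulrC ler_pM2r.
  lra.
have He : 3 * q * sigma ^+ 2 <= 78 * B * q * sigma ^+ 2.
  do 2 (apply: ler_wpM2r; first by rewrite ?sqr_ge0 // ltW).
  lra.
have Hf : L ^+ 2 * ((13 * C0 + 6) / n) * E / ((k + 1) * t) <=
   (2 * E1 + 2 * E0) / (alpha ^+ 2 * r ^+ 2 * t ^+ 4 * k) + (12 * E1 + 12 * E0) / (t ^+ 3 * alpha ^+ 2 * k).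
  rewrite [leRHS](_ : _ = (2 / (r ^+ 2 * t ^+ 3) + 12 / t ^+ 2) * (alpha ^+ 2)^-1 * E / (k * t)); last first.
    by rewrite /E; field; rewrite !gt_eqF.
  set Q := 2 / _ + _.
  have Q0 : 0 <= Q.
    by apply: addr_ge0; apply: divr_ge0 => //; rewrite ?mulr_ge0 ?exprn_ge0 // ltW.
  have C13 : 0 <= 13 * C0 + 6 by rewrite addr_ge0 // mulr_ge0.
  have c1 : L ^+ 2 * ((13 * C0 + 6) / n) <= Q * (alpha ^+ 2)^-1.
    apply: (@le_trans _ _ (L ^+ 2 * (13 * B * Q))).
      apply: ler_wpM2l; first exact: sqr_ge0.
      apply: le_trans C0_le; apply: ler_wpM2l => //.
      by rewrite lef_pV2 ?posrE.
    rewrite ler_pdivlMr ?exprn_gt0 // [leLHS](_ : _ = Q * (13 * B * q)); last by rewrite /q; ring.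
    by rewrite ler_piMr.
  apply: ler_pM => //.
  - by rewrite mulr_ge0 // mulr_ge0 ?sqr_ge0 // divr_ge0 // ltW.
  - by rewrite invr_ge0 ltW.
  - by apply: ler_wpM2r.
rewrite -[156 * B * alpha ^+ 2 * L ^+ 2]mulrA -/q.
have Hsplit : 3 * q * (G 0%N + GG) / ((k + 1) * t)
  = 3 * q * G 0%N / ((k + 1) * t) + 3 * q * GG / ((k + 1) * t) by rewrite mulrDr mulrDl.
move: Ha Hb Hc Hd He Hf Hsplit.
rewrite (_ : 156 * B * q = 78 * B * q + 78 * B * q); last by ring.
rewrite [X in _ -> _ -> _ -> _ -> _ -> _ -> _ -> _ <= _ + X]mulrDl.
lra.
Qed.

End FinalCombination.

(** * The noise of a stochastic gradient at a point determined by the past *)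

Section Noise.
Context {R : realType} {n : nat} {dS d : measure_display} {S : measurableType dS} {Omega : measurableType d}.
Variables (D : probability S R) (F : 'cV[R]_n -> S -> R) (f : 'cV[R]_n -> R) (sigma : R).
Hypothesis F_diff : forall s y, differentiable (F ^~ s) y.
Hypothesis F_meas : forall y, measurable_fun setT (F y).
Hypothesis f_diff : forall y, differentiable f y.
Hypothesis mean_grad : forall y k,
  ('E_D[fun s => (gradient (F ^~ s) y k 0)%R] = (gradient f y k 0%R)%:E)%E.
Hypothesis var_grad : forall y,
  ('E_D[fun s => (frob (gradient (F ^~ s) y - gradient f y) ^+ 2)%R] <= (sigma ^+ 2)%:E)%E.
Variables (P : probability Omega R) (G : set (set Omega)) (zeta : {RV P >-> S}).
Hypothesis G_meas : G `<=` measurable.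
Hypothesis law : forall B, measurable B -> distribution P zeta B = D B.
Hypothesis indep : forall A B, preimage_set_system setT zeta measurable A ->
  <<s G >> B -> P (A `&` B) = (P A * P B)%E.
Notation past := (g_sigma_algebraType G).
Variable x : Omega -> 'cV[R]_n.
Hypothesis x_past : forall k, measurable_fun [set: past] ((fun w => x w k 0) : past -> R).

(** The error of the stochastic gradient when the sample [zeta] is drawn at a
    point [x] that the past determines. *)
Definition noise (w : Omega) : 'cV[R]_n :=
  gradient (F ^~ (zeta w)) (x w) - gradient f (x w).

Lemma sample_gradient_measurable y k :
  measurable_fun setT (fun s => gradient (F ^~ s) y k 0).
Proof. by have := @measurable_gradient R _ S n F (fun=> y) _ _ _ k; apply. Qed.

(** As a function of the past and of an arbitrary sample; Fubini needs this joint
    measurability, with the point [x] kept measurable for the past alone. *)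
Lemma noise_joint_measurable k : measurable_fun [set: past * S]
  (fun z => (gradient (F ^~ z.2) (x z.1) - gradient f (x z.1)) k 0).
Proof.
have xm j : measurable_fun [set: past * S] (fun z => x z.1 j 0).
  exact: (measurableT_comp (x_past j) measurable_fst).
under eq_fun do rewrite mxE [X in _ + X]mxE; apply: measurable_funB.
  have := @measurable_gradient R _ (past * S)%type n (fun y z => F y z.2) (fun z => x z.1) _ _ xm k.
  apply => // y; exact: (measurableT_comp (F_meas y) measurable_snd).
have := @measurable_gradient R _ (past * S)%type n (fun y z => f y) (fun z => x z.1) _ _ xm k.
by apply.
Qed.

Lemma noise_measurable k : measurable_fun [set: Omega] (fun w => noise w k 0).
Proof.
exact: (measurableT_comp (noise_joint_measurable k) (measurable_pair_past zeta G_meas)).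
Qed.

(** Conditionally on the past the point is fixed, and the variance of the sample
    gradient at a fixed point is bounded by assumption. *)
Lemma integral_noise_sqr :
  (\int[P]_w (frob (noise w) ^+ 2)%:E <= (sigma ^+ 2)%:E)%E.
Proof.
pose H (z : past * S) : \bar R :=
  (frob (gradient (F ^~ z.2) (x z.1) - gradient f (x z.1)) ^+ 2)%:E.
have mH : measurable_fun setT H.
  apply/measurable_EFinP; under eq_fun do rewrite frob_sqr_col.
  apply: measurable_sum => k; apply: measurable_funX; exact: noise_joint_measurable.
rewrite (_ : (\int[P]_w _ = \int[P]_w H (w, zeta w))%E) //.
rewrite (fresh_integral_ge0 G_meas law indep) //; last first.
  by move=> z; rewrite lee_fin sqr_ge0.
apply: (@le_trans _ _ (\int[P]_w (sigma ^+ 2)%:E)%E).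
  apply: ge0_le_integral => //.
  - by move=> w _; apply: integral_ge0 => s _; rewrite lee_fin sqr_ge0.
  - have mF := @measurable_fun_fubini_tonelli_F _ _ _ S R D H mH _.
    apply: (measurableT_comp (mF _) (measurable_to_past G_meas)).
    by move=> z; rewrite lee_fin sqr_ge0.
  - by move=> w _; have := var_grad (x w); rewrite unlock.
by rewrite integral_cst // [X in (_ * X)%E](probability_setT P) mule1.
Qed.

Lemma noise_sqr_integ : integ P (fun w => frob (noise w) ^+ 2).
Proof.
have mn : measurable_fun [set: Omega] (fun w => frob (noise w) ^+ 2).
  under eq_fun do rewrite frob_sqr_col.
  by apply: measurable_sum => k; apply: measurable_funX; exact: noise_measurable.
apply/integrableP; split; first exact/measurable_EFinP.
under eq_integral do rewrite /= ger0_norm ?sqr_ge0 //.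
exact: le_lt_trans integral_noise_sqr (ltry _).
Qed.

Lemma mean_noise_sqr : mean P (fun w => frob (noise w) ^+ 2) <= sigma ^+ 2.
Proof.
rewrite -lee_fin -expectation_mean; last exact: noise_sqr_integ.
by rewrite unlock integral_noise_sqr.
Qed.

Lemma noise_sq_integ k : sq_integ P (fun w => noise w k 0).
Proof.
apply: sq_integ_le (noise_measurable k) _ noise_sqr_integ => w.
by rewrite frob_sqr_col (bigD1 k) //= lerDl; apply: sumr_ge0 => j _; exact: sqr_ge0.
Qed.

(** The deviation from [gradient f y] is square integrable by the variance
    bound, and the law of a sample is a finite measure. *)
Lemma sample_gradient_integ y k : integ D (fun s => gradient (F ^~ s) y k 0).
Proof.
pose e s := (gradient (F ^~ s) y - gradient f y) k 0.
have eE s : e s = gradient (F ^~ s) y k 0 - gradient f y k 0 by rewrite /e !mxE.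
have em : measurable_fun setT e.
  rewrite (funext eE); apply: measurable_funB => //.
  exact: sample_gradient_measurable.
have vi : integ D (fun s => frob (gradient (F ^~ s) y - gradient f y) ^+ 2).
  have vm : measurable_fun setT (fun s => frob (gradient (F ^~ s) y - gradient f y) ^+ 2).
    under eq_fun do rewrite frob_sqr_col; apply: measurable_sum => j; apply: measurable_funX.
    under eq_fun do rewrite mxE [X in _ + X]mxE; apply: measurable_funB => //.
    exact: sample_gradient_measurable.
  apply/integrableP; split; first exact/measurable_EFinP.
  under eq_integral do rewrite /= ger0_norm ?sqr_ge0 //.
  by have := var_grad y; rewrite unlock => /le_lt_trans; apply; exact: ltry.
have ei : sq_integ D e.
  apply: sq_integ_le em _ vi => s.
  by rewrite frob_sqr_col (bigD1 k) //= lerDl; apply: sumr_ge0 => j _; exact: sqr_ge0.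
have := integD (sq_integ_integ ei) (integ_cst D (gradient f y k 0)).
by under eq_fun do rewrite eE subrK.
Qed.

(** Conditionally on the past, [h] is a constant and the sample gradient is
    unbiased. *)
Lemma noise_orthogonal (h : Omega -> R) k :
  measurable_fun [set: past] (h : past -> R) -> sq_integ P h ->
  mean P (fun w => h w * noise w k 0) = 0.
Proof.
move=> hm hi.
pose H (z : past * S) : R := h z.1 * (gradient (F ^~ z.2) (x z.1) - gradient f (x z.1)) k 0.
apply: (@fresh_mean0 _ _ _ _ _ _ D G zeta G_meas law indep H).
- apply: measurable_funM; last exact: noise_joint_measurable.
  exact: (measurableT_comp hm measurable_fst).
- exact: sq_integM hi (noise_sq_integ k).
- move=> w; rewrite /H /=.
  have gi := sample_gradient_integ (x w) k.
  have : mean D (fun s => h w * (gradient (F ^~ s) (x w) k 0 - gradient f (x w) k 0)) = 0.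
    rewrite meanZ ?meanB ?mean_cst //; [|exact: integ_cst|apply: integB => //; exact: integ_cst].
    have := mean_grad (x w) k; rewrite expectation_mean // => -[->].
    by rewrite subrr mulr0.
  have ii : integ D (fun s => h w * (gradient (F ^~ s) (x w) k 0 - gradient f (x w) k 0)).
    by apply: integZ; apply: integB => //; exact: integ_cst.
  move=> m0; have E := expectation_mean ii; rewrite m0 unlock in E.
  rewrite -[RHS]/(0%:E) -E.
  apply: eq_integral => s _; congr ((h w * _)%:E).
  by rewrite [LHS]mxE [X in _ + X]mxE.
Qed.

End Noise.

(** * The iterates are adapted and square integrable *)

Section Process.
Context {R : realType} {N n : nat}.
Context {dS : 'I_N -> measure_display} {S : forall i, measurableType (dS i)}.
Context {d : measure_display} {Omega : measurableType d}.
Variables (D : forall i, probability (S i) R) (F : forall i, 'cV[R]_n -> S i -> R).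
Variables (fi : 'I_N -> 'cV[R]_n -> R) (L sigma : R).
Hypothesis objective : stoch_objective D F fi.
Hypothesis fi_diff : forall i (y : 'cV[R]_n), differentiable (fi i) y.
Hypothesis L_gt0 : 0 < L.
Hypothesis smooth : forall i y z,
  frob (gradient (fi i) y - gradient (fi i) z) <= L * frob (y - z).
Hypothesis noise_bound : unbiased_bounded_variance D F fi sigma.
Variables (P : probability Omega R) (zeta : forall i, int -> {RV P >-> S i}).
Hypothesis zeta_fresh : fresh_samples D zeta.
Variables (W : 'M[R]_N) (tau : nat) (xi alpha : R).
Variables (xinit : 'I_N -> 'cV[R]_n) (x : 'I_N -> int -> Omega -> 'cV[R]_n).
Hypothesis x_MILE : MILE F zeta W tau xi alpha xinit x.

Definition sample_events (t : int) : set (set Omega) :=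
  [set E | exists (j : 'I_N) (s : int), (-1 <= s) && (s < t) /\
         preimage_set_system setT (zeta j s) measurable E].

Notation past t := (g_sigma_algebraType (sample_events t)).

(** Determined by the samples drawn before time [t]. *)
Definition adapted (t : int) (h : Omega -> R) :=
  measurable_fun [set: past t] (h : past t -> R).

Definition sq_adapted (t : int) (h : Omega -> R) := adapted t h /\ sq_integ P h.

Definition sq_adapted_vec t (v : Omega -> 'cV[R]_n) := forall k, sq_adapted t (fun w => v w k 0).

Lemma sample_events_measurable t : sample_events t `<=` measurable.
Proof.
move=> _ [j [s [_ [B mB <-]]]].
exact: (measurable_funP (zeta j s)).
Qed.

Lemma adapted_mono s t h : s <= t -> adapted s h -> adapted t h.
Proof.
move=> st hs _ B mB; rewrite setTI.
have : <<s sample_events s >> (h @^-1` B).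
  by have := hs measurableT _ mB; rewrite setTI.
apply: sub_sigma_algebra2 => E [j [u [/andP[u1 us] HE]]].
by exists j, u; split => //; rewrite u1 (lt_le_trans us st).
Qed.

Lemma sq_adapted_mono s t h : s <= t -> sq_adapted s h -> sq_adapted t h.
Proof. by move=> st [a i]; split => //; exact: adapted_mono st a. Qed.

Lemma sq_adapted_cst t c : sq_adapted t (fun=> c).
Proof. by split; [exact: measurable_cst | exact: sq_integ_cst]. Qed.

Lemma sq_adaptedD t g h : sq_adapted t g -> sq_adapted t h -> sq_adapted t (fun w => g w + h w).
Proof. by move=> [ga gi] [ha hi]; split; [exact: measurable_funD | exact: sq_integD]. Qed.

Lemma sq_adaptedB t g h : sq_adapted t g -> sq_adapted t h -> sq_adapted t (fun w => g w - h w).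
Proof. by move=> [ga gi] [ha hi]; split; [exact: measurable_funB | exact: sq_integB]. Qed.

Lemma sq_adaptedZ t c h : sq_adapted t h -> sq_adapted t (fun w => c * h w).
Proof. by move=> [ha hi]; split; [exact: measurable_funM | exact: sq_integZ]. Qed.

Lemma sq_adapted_sum t (I : Type) (r : seq I) (Q : pred I) (h : I -> Omega -> R) :
  (forall i, Q i -> sq_adapted t (h i)) -> sq_adapted t (fun w => \sum_(i <- r | Q i) h i w).
Proof.
move=> gh; split; last by apply: sq_integ_sum => i Qi; have [] := gh i Qi.
elim: r => [|i r IH].
  by rewrite /adapted; under eq_fun do rewrite big_nil; exact: measurable_cst.
rewrite /adapted; case: (boolP (Q i)) => Qi.
  by under eq_fun do rewrite big_cons Qi; apply: measurable_funD => //; have [] := gh i Qi.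
by under eq_fun do rewrite big_cons (negbTE Qi).
Qed.

Lemma sq_adapted_vecD t u v : sq_adapted_vec t u -> sq_adapted_vec t v -> sq_adapted_vec t (fun w => u w + v w).
Proof. by move=> gu gv k; under eq_fun do rewrite mxE; exact: sq_adaptedD. Qed.

Lemma sq_adapted_vecZ t c u : sq_adapted_vec t u -> sq_adapted_vec t (fun w => c *: u w).
Proof. by move=> gu k; under eq_fun do rewrite mxE; exact: sq_adaptedZ. Qed.

Lemma sq_adapted_vecB t u v : sq_adapted_vec t u -> sq_adapted_vec t v -> sq_adapted_vec t (fun w => u w - v w).
Proof.
move=> gu gv k; under eq_fun do rewrite mxE [X in _ + X]mxE.
exact: sq_adaptedB.
Qed.

Lemma sq_adapted_vec_sum t (I : Type) (r : seq I) (v : I -> Omega -> 'cV[R]_n) :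
  (forall i, sq_adapted_vec t (v i)) -> sq_adapted_vec t (fun w => \sum_(i <- r) v i w).
Proof.
by move=> gv k; under eq_fun do rewrite summxE; apply: sq_adapted_sum => i _; exact: gv.
Qed.

Lemma sq_adapted_vec_mono s t u : s <= t -> sq_adapted_vec s u -> sq_adapted_vec t u.
Proof. by move=> st gu k; exact: sq_adapted_mono st (gu k). Qed.

Lemma integ_frob_sqr t u : sq_adapted_vec t u -> integ P (fun w => frob (u w) ^+ 2).
Proof.
move=> gu; under eq_fun do rewrite frob_sqr_col.
by apply: integ_sum => k _; have [_ []] := gu k.
Qed.

Lemma integ_dot s t u v : sq_adapted_vec s u -> sq_adapted_vec t v -> integ P (fun w => dot (u w) (v w)).
Proof.
move=> gu gv; apply: integ_sum => k _.
by apply: sq_integM; [have [] := gu k | have [] := gv k].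
Qed.

Lemma adapted_measurable t h : adapted t h -> measurable_fun [set: Omega] h.
Proof.
by move=> ha; exact: (measurableT_comp ha (measurable_to_past (@sample_events_measurable t))).
Qed.

(** A Lipschitz gradient grows at most linearly, so square integrability of the
    point passes to the gradient. *)
Lemma sq_adapted_exact_gradient t (h : 'cV[R]_n -> R) u : (forall y, differentiable h y) ->
  (forall y z, frob (gradient h y - gradient h z) <= L * frob (y - z)) ->
  sq_adapted_vec t u -> sq_adapted_vec t (fun w => gradient h (u w)).
Proof.
move=> hd hs gu k.
have ad : adapted t (fun w => gradient h (u w) k 0).
  have := @measurable_gradient R _ (past t) n (fun y z => h y) u _ _ _ k.
  by apply => // j; have [] := gu j.
split => //.
apply: (@sq_integ_le _ _ _ _ _ (fun w => 2 * L ^+ 2 * frob (u w) ^+ 2 + 2 * frob (gradient h 0) ^+ 2)).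
- exact: adapted_measurable ad.
- move=> w; set a := gradient h (u w); set b := gradient h 0.
  have lip : frob (a - b) ^+ 2 <= L ^+ 2 * frob (u w) ^+ 2.
    rewrite -exprMn lerXn2r ?nnegrE ?mulr_ge0 ?frob_ge0 ?(ltW L_gt0) //.
    by have := hs (u w) 0; rewrite subr0.
  have aE : a k 0 = (a - b) k 0 + b k 0 by rewrite !mxE subrK.
  have c1 : (a - b) k 0 ^+ 2 <= frob (a - b) ^+ 2.
    by rewrite frob_sqr_col (bigD1 k) //= lerDl; apply: sumr_ge0 => j _; exact: sqr_ge0.
  have c2 : b k 0 ^+ 2 <= frob b ^+ 2.
    by rewrite frob_sqr_col (bigD1 k) //= lerDl; apply: sumr_ge0 => j _; exact: sqr_ge0.
  have : 0 <= ((a - b) k 0 - b k 0) ^+ 2 by exact: sqr_ge0.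
  rewrite aE; move: ((a - b) k 0) (b k 0) c1 c2 => p q c1 c2; rewrite !expr2 in c1 c2 lip *; lra.
- apply: integD; last exact: integ_cst.
  by apply: integZ; exact: integ_frob_sqr gu.
Qed.

Let F_diff i s y : differentiable (@F i ^~ s) y. Proof. by have [H _] := objective i. Qed.

Let F_meas i y : measurable_fun setT (@F i y).
Proof. by have [_ /(_ y) [/integrableP[/measurable_EFinP]]] := objective i. Qed.

Let law i t : -1 <= t -> forall B, measurable B -> distribution P (zeta i t) B = D i B.
Proof. by move=> t1; have [] := zeta_fresh i t1. Qed.

Let indep i t : -1 <= t -> forall A B, preimage_set_system setT (zeta i t) measurable A ->
  <<s sample_events t >> B -> P (A `&` B) = (P A * P B)%E.
Proof. by move=> t1; have [_] := zeta_fresh i t1. Qed.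

Let mean_grad i y k := (noise_bound i y).1 k.
Let var_grad i y := (noise_bound i y).2.

Definition grad_noise i t w : 'cV[R]_n := stoch_grad F zeta x i t w - gradient (fi i) (x i t w).

Section AtTime.
Variables (i : 'I_N) (t : int).
Hypotheses (t_ge : -1 <= t) (xi_good : sq_adapted_vec t (x i t)).

Let x_past k : adapted t (fun w => x i t w k 0). Proof. by have [] := xi_good k. Qed.

Lemma mean_grad_noise_sqr : mean P (fun w => frob (grad_noise i t w) ^+ 2) <= sigma ^+ 2.
Proof.
have H := (mean_noise_sqr (@F_diff i) (@F_meas i) (fi_diff i) (var_grad i)
  (@sample_events_measurable t) (@law i t t_ge) (@indep i t t_ge) x_past).
exact: H.
Qed.

Lemma grad_noise_orthogonal h k : sq_adapted t h ->
  mean P (fun w => h w * grad_noise i t w k 0) = 0.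
Proof.
move=> [ha hi].
exact: (noise_orthogonal (@F_diff i) (@F_meas i) (fi_diff i) (mean_grad i) (var_grad i)
  (@sample_events_measurable t) (@law i t t_ge) (@indep i t t_ge) x_past k ha hi).
Qed.

Lemma sample_in_past : measurable_fun [set: past (t + 1)] (zeta i t : past (t + 1) -> S i).
Proof.
move=> _ B mB; rewrite setTI; apply: sub_gen_smallest.
exists i, t; split; first by rewrite t_ge ltrDl.
by exists B => //; rewrite setTI.
Qed.

(** The sample of time [t] belongs to the past of [t + 1].  Square integrability
    follows by writing the stochastic gradient as the exact one plus noise. *)
Lemma sq_adapted_stoch_grad : sq_adapted_vec (t + 1) (stoch_grad F zeta x i t).
Proof.
move=> k; split.
  have := @measurable_gradient R _ (past (t + 1)) n (fun y w => @F i y (zeta i t w)) (x i t) _ _ _ k.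
  apply => //.
    by move=> y; exact: (measurableT_comp (@F_meas i y) sample_in_past).
  by move=> j; apply: adapted_mono (x_past j); rewrite lerDl.
have := sq_adapted_exact_gradient (fi_diff i) (smooth i) xi_good k => -[_ gi].
have ni : sq_integ P (fun w => grad_noise i t w k 0).
  exact: (noise_sq_integ (@F_diff i) (@F_meas i) (fi_diff i) (var_grad i)
    (@sample_events_measurable t) (@law i t t_ge) (@indep i t t_ge) x_past k).
have := sq_integD ni gi.
by under eq_fun do rewrite [X in X + _]mxE [X in _ + X + _]mxE subrK.
Qed.

Lemma sq_adapted_grad_noise : sq_adapted_vec (t + 1) (grad_noise i t).
Proof.
apply: sq_adapted_vecB; first exact: sq_adapted_stoch_grad.
apply: sq_adapted_vec_mono (sq_adapted_exact_gradient (fi_diff i) (smooth i) xi_good).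
by rewrite lerDl.
Qed.

End AtTime.

(** An update involves the iterates of two consecutive times, so the induction
    carries both.  The shift by one lets a natural number range over the times
    from [-1] on. *)
Lemma sq_adapted_iterates (m : nat) : forall i, sq_adapted_vec (m%:Z - 1) (x i (m%:Z - 1)).
Proof.
have [x1 x0 xS] := x_MILE.
suff H k : (forall i, sq_adapted_vec (k%:Z - 1) (x i (k%:Z - 1))) /\
    (forall i, sq_adapted_vec (k.+1%:Z - 1) (x i (k.+1%:Z - 1))) by have [] := H m.
elim: k => [|k [IH0 IH1]].
  have g1 i : sq_adapted_vec (-1) (x i (-1)).
    by rewrite (funext (x1 i)) => k; exact: sq_adapted_cst.
  split => [//|i]; rewrite (_ : 1%:Z - 1 = 0) // (funext (x0 i)).
  apply: sq_adapted_vecB; first exact: sq_adapted_vec_mono (g1 i).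
  by apply: sq_adapted_vecZ; exact: (sq_adapted_stoch_grad (lexx _) (g1 i)).
split => // i.
have -> : k.+2%:Z - 1 = k%:Z + 1 by lia.
have E1 : k.+1%:Z - 1 = k%:Z by lia.
rewrite E1 in IH1.
have gx j : sq_adapted_vec (k%:Z + 1) (x j k%:Z) by apply: sq_adapted_vec_mono (IH1 j); lia.
have gx' j : sq_adapted_vec (k%:Z + 1) (x j (k%:Z - 1)) by apply: sq_adapted_vec_mono (IH0 j); lia.
have gg j : sq_adapted_vec (k%:Z + 1) (stoch_grad F zeta x j k%:Z).
  by apply: sq_adapted_stoch_grad (IH1 j); lia.
have gg' j : sq_adapted_vec (k%:Z + 1) (stoch_grad F zeta x j (k%:Z - 1)).
  have t1 : -1 <= k%:Z - 1 by lia.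
  by apply: sq_adapted_vec_mono (sq_adapted_stoch_grad t1 (IH0 j)); lia.
pose st j w := 2 *: x j k%:Z w - x j (k%:Z - 1) w
    - alpha *: stoch_grad F zeta x j k%:Z w + alpha *: stoch_grad F zeta x j (k%:Z - 1) w.
have gstep j : sq_adapted_vec (k%:Z + 1) (st j).
  apply: sq_adapted_vecD; last exact: (sq_adapted_vecZ alpha (gg' j)).
  apply: sq_adapted_vecB; last exact: (sq_adapted_vecZ alpha (gg j)).
  exact: sq_adapted_vecB (sq_adapted_vecZ 2 (gx j)) (gx' j).
have -> : x i (k%:Z + 1) = fun w => if (k %% tau == 0)%N
    then \sum_j Wtilde xi W i j *: st j w else st i w.
  by apply/funext => w; exact: xS.
case: (k %% tau == 0)%N; last exact: gstep.
by apply: sq_adapted_vec_sum => j; exact: (sq_adapted_vecZ _ (gstep j)).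
Qed.

Lemma sq_adapted_iterate (t : nat) i : sq_adapted_vec t%:Z (x i t%:Z).
Proof. by have := sq_adapted_iterates t.+1 i; have -> : t.+1%:Z - 1 = t%:Z by lia. Qed.

End Process.

(** * The trajectory of the average and of the deviations *)

Section Dot.
Context {R : realType} {n : nat}.
Implicit Types u v w : 'cV[R]_n.

Lemma frob_sqr_dot u : frob u ^+ 2 = dot u u.
Proof. by rewrite frob_sqr_col; apply: eq_bigr => k _; rewrite expr2. Qed.

Lemma dotC u v : dot u v = dot v u.
Proof. by apply: eq_bigr => k _; rewrite mulrC. Qed.

Lemma dotDr u v w : dot u (v + w) = dot u v + dot u w.
Proof. by rewrite /dot -big_split; apply: eq_bigr => k _; rewrite mxE mulrDr. Qed.

Lemma dotZr c u v : dot u (c *: v) = c * dot u v.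
Proof. by rewrite /dot mulr_sumr; apply: eq_bigr => k _; rewrite mxE mulrCA. Qed.

Lemma dotNr u v : dot u (- v) = - dot u v.
Proof. by rewrite -scaleN1r dotZr mulN1r. Qed.

Lemma dotDl u v w : dot (v + w) u = dot v u + dot w u.
Proof. by rewrite dotC dotDr !(dotC u). Qed.

Lemma dotZl c u v : dot (c *: v) u = c * dot v u.
Proof. by rewrite dotC dotZr dotC. Qed.

Lemma dotNl u v : dot (- v) u = - dot v u.
Proof. by rewrite dotC dotNr dotC. Qed.

End Dot.

Section MeanSplit.
Context {R : realType} {N n : nat}.
Hypothesis N_gt0 : (0 < N)%N.
Implicit Types M X : 'M[R]_(n, N).

(** Pythagoras: averaging the columns is an orthogonal projection. *)
Lemma frob_mean_split M : frob M ^+ 2 = frob (M - mean_mx M) ^+ 2 + frob (mean_mx M) ^+ 2.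
Proof.
have N0 : N%:R != 0 :> R by rewrite pnatr_eq0 -lt0n.
pose J : 'M[R]_N := const_mx N%:R^-1.
have JT : J^T = J by apply/matrixP => i j; rewrite !mxE.
have JJ : J *m J = J.
  apply/matrixP => i j; rewrite !mxE; under eq_bigr do rewrite !mxE.
  by rewrite sumr_const card_ord -[_ * _ *+ N]mulr_natl mulrA divff // mul1r.
have AB : (M - M *m J) *m (M *m J)^T = 0.
  by rewrite trmx_mul JT mulmxA mulmxBl -mulmxA JJ subrr mul0mx.
rewrite /mean_mx -/J !frob_sqr_mx_trace -raddfD /=.
rewrite -{1 2}[M](subrK (M *m J)) linearD /= mulmxDl !mulmxDr AB addr0.
have -> : M *m J *m (M - M *m J)^T = 0.
  by rewrite -[LHS]trmxK trmx_mul trmxK AB trmx0.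
by rewrite add0r.
Qed.

Lemma frobB_sqr_le M X : frob (M - X) ^+ 2 <= 2 * frob M ^+ 2 + 2 * frob X ^+ 2.
Proof.
rewrite !frob_sqr !mulr_sumr -big_split; apply: ler_sum => i _ /=.
rewrite !mulr_sumr -big_split; apply: ler_sum => j _ /=; rewrite !mxE.
by have : 0 <= (M i j + X i j) ^+ 2 by [exact: sqr_ge0]; rewrite !expr2; lra.
Qed.

Lemma frob_sqr_columns M (v : 'I_N -> 'cV[R]_n) :
  (forall k i, M k i = v i k 0) -> frob M ^+ 2 = \sum_i frob (v i) ^+ 2.
Proof.
move=> Mv; under [RHS]eq_bigr do rewrite frob_sqr_col.
rewrite frob_sqr exchange_big; apply: eq_bigr => i _; apply: eq_bigr => k _.
by rewrite Mv.
Qed.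

Lemma mean_mx_columns M (v : 'I_N -> 'cV[R]_n) :
  (forall k i, M k i = v i k 0) -> forall k i, mean_mx M k i = average v k 0.
Proof.
move=> Mv k i; rewrite /average !mxE summxE mulr_sumr; apply: eq_bigr => j _.
by rewrite mxE Mv mulrC.
Qed.

End MeanSplit.

Section Pathwise.
Context {R : realType} {N n : nat}.
Context {dS : 'I_N -> measure_display} {S : forall i, measurableType (dS i)}.
Context {d : measure_display} {Omega : measurableType d}.
Variables (F : forall i, 'cV[R]_n -> S i -> R) (P : probability Omega R).
Variable zeta : forall i, int -> {RV P >-> S i}.
Variables (W : 'M[R]_N) (tau : nat) (xi alpha : R).
Variables (xinit : 'I_N -> 'cV[R]_n) (x : 'I_N -> int -> Omega -> 'cV[R]_n).
Hypothesis x_MILE : MILE F zeta W tau xi alpha xinit x.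
Hypothesis WT : W^T = W.
Hypothesis W1 : forall i, \sum_j W i j = 1.

Notation g i t := (stoch_grad F zeta x i t).

Definition grad_mx (t : nat) w : 'M[R]_(n, N) := \matrix_(k, i) g i t%:Z w k 0.

Lemma Wtilde_sym i j : Wtilde xi W i j = Wtilde xi W j i.
Proof.
have Wij : W i j = W j i by rewrite -[in LHS]WT mxE.
by rewrite !mxE eq_sym Wij; case: eqVneq => [->|].
Qed.

Lemma Wtilde_col_sum j : \sum_i Wtilde xi W i j = 1.
Proof.
transitivity (\sum_i ((1 - xi) * (i == j)%:R + xi * W j i)).
  apply: eq_bigr => i _; rewrite Wtilde_sym mxE eq_sym.
  by case: eqVneq => [->|]; rewrite ?mulr1 ?mulr0 ?add0r.
rewrite big_split /= -!mulr_sumr W1 (bigD1 j) //= big1 => [|i /negbTE -> //].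
by rewrite eqxx /=; ring.
Qed.

(** The algorithm in matrix form; mixing acts on the right of the columns, which
    agrees with the rows of [Wtilde] by symmetry. *)
Lemma Xmat_step w t : let X s := Xmat x s%:Z w in
  let Z := 2 *: X t.+1 - X t - alpha *: (grad_mx t.+1 w - grad_mx t w) in
  X t.+2 = if (t.+1 %% tau == 0)%N then Z *m Wtilde xi W else Z.
Proof.
move=> X Z; have [_ _ xS] := x_MILE.
have E1 : t.+1%:Z - 1 = t%:Z by lia.
have Zc k i : Z k i = (2 *: x i t.+1%:Z w - x i t%:Z w - alpha *: g i t.+1%:Z w
    + alpha *: g i t%:Z w) k 0.
  have rc (a b p q : 'cV[R]_n) : (2 *: a - b - alpha *: p + alpha *: q) k 0
      = 2 * a k 0 - b k 0 - alpha * (p k 0 - q k 0) by rewrite !mxE; ring.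
  have lc (A B M Q : 'M[R]_(n, N)) : (2 *: A - B - alpha *: (M - Q)) k i
      = 2 * A k i - B k i - alpha * (M k i - Q k i) by rewrite !mxE.
  have Xe s : X s k i = x i s%:Z w k 0 by rewrite [LHS]mxE.
  have Ge s : grad_mx s w k i = g i s%:Z w k 0 by rewrite [LHS]mxE.
  by rewrite rc lc !Xe !Ge.
apply/matrixP => k i; rewrite [LHS]mxE.
have -> : t.+2%:Z = t.+1%:Z + 1 by lia.
rewrite xS E1; case: (t.+1 %% tau == 0)%N; last by rewrite Zc.
rewrite [RHS]mxE summxE; apply: eq_bigr => j _.
by rewrite [LHS]mxE Zc Wtilde_sym mulrC.
Qed.

Lemma average_mixed (v : 'I_N -> 'cV[R]_n) :
  average (fun i => \sum_j Wtilde xi W i j *: v j) = average v.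
Proof.
rewrite /average exchange_big /=; congr (_ *: _); apply: eq_bigr => j _.
by rewrite -scaler_suml Wtilde_col_sum scale1r.
Qed.

(** The correction [Xbar t - Xbar (t-1) + alpha * (average gradient at t-1)]
    vanishes at time 0 by the choice of the first step, and its vanishing at
    [t] is the claim at [t - 1]; so both are proved together. *)
Lemma Xbar_step w (t : nat) :
  Xbar x t.+1%:Z w = Xbar x t%:Z w - alpha *: average (fun i => g i t%:Z w).
Proof.
have [x1 x0 xS] := x_MILE.
pose gb s := average (fun i => g i s w).
have H0 : Xbar x 0 w = Xbar x (-1) w - alpha *: gb (-1).
  by rewrite /Xbar -averageZ -averageB; congr average; apply/funext => i.
suff H k : Xbar x k%:Z w - Xbar x (k%:Z - 1) w + alpha *: gb (k%:Z - 1) = 0 /\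
    Xbar x k.+1%:Z w = Xbar x k%:Z w - alpha *: gb k%:Z by have [] := H t.
have key m : Xbar x m%:Z w - Xbar x (m%:Z - 1) w + alpha *: gb (m%:Z - 1) = 0 ->
    Xbar x m.+1%:Z w = Xbar x m%:Z w - alpha *: gb m%:Z.
  move=> c0; have -> : m.+1%:Z = m%:Z + 1 by lia.
  pose v j := 2 *: x j m%:Z w - x j (m%:Z - 1) w - alpha *: g j m%:Z w + alpha *: g j (m%:Z - 1) w.
  have -> : Xbar x (m%:Z + 1) w = average v.
    rewrite /Xbar; case: (boolP (m %% tau == 0)%N) => mt.
      by rewrite -[RHS]average_mixed; congr average; apply/funext => i; rewrite xS mt.
    by congr average; apply/funext => i; rewrite xS (negbTE mt).
  rewrite /v averageD !averageB !averageZ -/(gb _) -/(gb _) -/(Xbar x m%:Z w) -/(Xbar x (m%:Z - 1) w).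
  rewrite -[RHS]addr0 -c0; move: (Xbar x m%:Z w) (Xbar x _ w) (gb _) (gb _) => a b p q.
  by apply/colP => l; rewrite !mxE; ring.
elim: k => [|k [c0 IH]].
  have c0 : Xbar x 0%:Z w - Xbar x (0%:Z - 1) w + alpha *: gb (0%:Z - 1) = 0.
    by rewrite sub0r H0 addrAC subrK subrr.
  by split; [exact: c0 | exact: key c0].
have c1 : Xbar x k.+1%:Z w - Xbar x (k.+1%:Z - 1) w + alpha *: gb (k.+1%:Z - 1) = 0.
  have -> : k.+1%:Z - 1 = k%:Z by lia.
  by rewrite IH addrAC subrK subrr.
by split; [exact: c1 | exact: key c1].
Qed.

Definition deviation (t : nat) w := frob (Xmat x t%:Z w - mean_mx (Xmat x t%:Z w)) ^+ 2.

Lemma deviationE t w : deviation t w = \sum_i frob (x i t%:Z w - Xbar x t%:Z w) ^+ 2.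
Proof.
apply: frob_sqr_columns => k i.
have Xc l j : Xmat x t%:Z w l j = x j t%:Z w l 0 by rewrite mxE.
by rewrite mxE [X in _ + X]mxE (mean_mx_columns Xc) Xc [RHS]mxE [X in _ = _ + X]mxE.
Qed.

Hypothesis N_gt0 : (0 < N)%N.

Lemma deviation_le t w : deviation t w <= frob (Xmat x t%:Z w) ^+ 2.
Proof. by rewrite (frob_mean_split N_gt0 (Xmat x t%:Z w)) lerDl sqr_ge0. Qed.

(** The displacement splits orthogonally into that of the deviations and that of
    the average, and the latter is known exactly from [Xbar_step]. *)
Lemma Xmat_increment t w : frob (Xmat x t.+1%:Z w - Xmat x t%:Z w) ^+ 2 <=
  2 * deviation t.+1 w + 2 * deviation t w
  + N%:R * alpha ^+ 2 * frob (average (fun i => g i t%:Z w)) ^+ 2.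
Proof.
rewrite (frob_mean_split N_gt0); apply: lerD.
  have -> : forall X Y : 'M[R]_(n, N), X - Y - mean_mx (X - Y) = (X - mean_mx X) - (Y - mean_mx Y).
    move=> X Y; rewrite /mean_mx mulmxBl; apply/matrixP => k i.
    by move: (X *m _) (Y *m _) => A B; rewrite !mxE; ring.
  exact: frobB_sqr_le.
pose u i := x i t.+1%:Z w - x i t%:Z w.
have Mc k i : (Xmat x t.+1%:Z w - Xmat x t%:Z w) k i = u i k 0 by rewrite !mxE.
rewrite (frob_sqr_columns (v := fun=> average u)); last exact: mean_mx_columns Mc.
rewrite sumr_const card_ord -[_ ^+ 2 *+ N]mulr_natl -mulrA; apply: ler_wpM2l => //.
rewrite averageB -/(Xbar x t.+1%:Z w) -/(Xbar x t%:Z w) Xbar_step addrAC subrr add0r.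
by rewrite !frob_sqr_dot dotNl dotNr opprK dotZl dotZr mulrA expr2.
Qed.

End Pathwise.

(** * Expected descent and expected consensus *)

Section Assembly.
Context {R : realType} {N n : nat}.
Context {dS : 'I_N -> measure_display} {S : forall i, measurableType (dS i)}.
Context {d : measure_display} {Omega : measurableType d}.
Variables (D : forall i, probability (S i) R) (F : forall i, 'cV[R]_n -> S i -> R).
Variables (fi : 'I_N -> 'cV[R]_n -> R) (f : 'cV[R]_n -> R) (L sigma : R).
Hypothesis N_gt0 : (0 < N)%N.
Hypothesis objective : stoch_objective D F fi.
Hypothesis fi_diff : forall i (y : 'cV[R]_n), differentiable (fi i) y.
Hypothesis fE : forall y, f y = N%:R^-1 * \sum_i fi i y.
Hypothesis L_gt0 : 0 < L.
Hypothesis smooth : forall i y z,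
  frob (gradient (fi i) y - gradient (fi i) z) <= L * frob (y - z).
Variable xstar : 'cV[R]_n.
Hypothesis xstar_min : forall y, f xstar <= f y.
Hypothesis noise_bound : unbiased_bounded_variance D F fi sigma.
Variables (P : probability Omega R) (zeta : forall i, int -> {RV P >-> S i}).
Hypothesis zeta_fresh : fresh_samples D zeta.
Variables (W : 'M[R]_N) (tau : nat) (xi alpha : R).
Variables (xinit : 'I_N -> 'cV[R]_n) (x : 'I_N -> int -> Omega -> 'cV[R]_n).
Hypothesis x_MILE : MILE F zeta W tau xi alpha xinit x.
Hypothesis alpha_gt0 : 0 < alpha.
Hypothesis WT : W^T = W.
Hypothesis W1 : forall i, \sum_j W i j = 1.

Notation g i t := (stoch_grad F zeta x i t).
Notation nz i t := (grad_noise F fi zeta x i t).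
Notation sq_adapted t := (sq_adapted zeta t).
Notation sq_adapted_vec t := (sq_adapted_vec zeta t).

Let x_good (t : nat) i : sq_adapted_vec t%:Z (x i t%:Z).
Proof. exact: (sq_adapted_iterate objective fi_diff L_gt0 smooth noise_bound zeta_fresh x_MILE). Qed.

Let t_ge (t : nat) : -1 <= t%:Z. Proof. by lia. Qed.

Let nz_good (t : nat) i : sq_adapted_vec (t%:Z + 1) (nz i t%:Z).
Proof.
exact: (sq_adapted_grad_noise objective fi_diff L_gt0 smooth noise_bound zeta_fresh (t_ge t) (x_good t i)).
Qed.

Let g_good (t : nat) i : sq_adapted_vec (t%:Z + 1) (g i t%:Z).
Proof.
exact: (sq_adapted_stoch_grad objective fi_diff L_gt0 smooth noise_bound zeta_fresh (t_ge t) (x_good t i)).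
Qed.

Let average_good t (v : 'I_N -> Omega -> 'cV[R]_n) : (forall i, sq_adapted_vec t (v i)) ->
  sq_adapted_vec t (fun w => average (fun i => v i w)).
Proof. by move=> gv; apply: sq_adapted_vecZ; exact: sq_adapted_vec_sum. Qed.

Notation a t w := (gradient f (Xbar x t%:Z w)).
Notation b t w := (avg_gradient x fi t%:Z w).

Definition noise_average (t : nat) w := average (fun i => nz i t%:Z w).
Notation nbar := noise_average.

Let Xbar_good (t : nat) : sq_adapted_vec t%:Z (Xbar x t%:Z).
Proof. exact: average_good (x_good t). Qed.

Let f_diff := differentiable_average fi_diff fE.
Let f_smooth := smooth_average fi_diff fE (ltW L_gt0) N_gt0 smooth.

Let a_good t : sq_adapted_vec t%:Z (fun w => a t w).
Proof. exact: (sq_adapted_exact_gradient L_gt0 f_diff f_smooth (Xbar_good t)). Qed.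

Let b_good t : sq_adapted_vec t%:Z (fun w => b t w).
Proof.
apply: average_good => i.
exact: (sq_adapted_exact_gradient L_gt0 (@fi_diff i) (@smooth i) (x_good t i)).
Qed.

Let nbar_good t : sq_adapted_vec (t%:Z + 1) (nbar t).
Proof. exact: average_good (nz_good t). Qed.

Lemma average_stoch_gradE t w : average (fun i => g i t%:Z w) = b t w + nbar t w.
Proof.
rewrite /noise_average /avg_gradient -averageD; congr average; apply/funext => i.
by rewrite /grad_noise addrC subrK.
Qed.

Lemma noise_average_orthogonal t u : sq_adapted_vec t%:Z u ->
  mean P (fun w => dot (u w) (nbar t w)) = 0.
Proof.
move=> gu.
have int_uv k i : integ P (fun w => u w k 0 * nz i t%:Z w k 0).
  by apply: sq_integM; [have [] := gu k | have [] := nz_good t i k].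
have E w : dot (u w) (nbar t w) = N%:R^-1 * \sum_k \sum_i u w k 0 * nz i t%:Z w k 0.
  rewrite /dot mulr_sumr; apply: eq_bigr => k _.
  by rewrite /noise_average /average mxE summxE mulrCA mulr_sumr.
rewrite (funext E) meanZ; last by apply: integ_sum => k _; apply: integ_sum => i _.
rewrite mean_sum => [|k _]; last by apply: integ_sum => i _.
rewrite big1 ?mulr0 // => k _; rewrite mean_sum // big1 // => i _.
exact: (grad_noise_orthogonal objective fi_diff noise_bound zeta_fresh (t_ge t) (x_good t i) _ (gu k)).
Qed.

Lemma mean_agent_noise_sqr t i : mean P (fun w => frob (nz i t%:Z w) ^+ 2) <= sigma ^+ 2.
Proof.
exact: (mean_grad_noise_sqr objective fi_diff noise_bound zeta_fresh (t_ge t) (x_good t i)).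
Qed.

Let nz_int t i : integ P (fun w => frob (nz i t%:Z w) ^+ 2).
Proof. exact: integ_frob_sqr (nz_good t i). Qed.

Lemma mean_sum_noise t : mean P (fun w => \sum_i frob (nz i t%:Z w) ^+ 2) <= N%:R * sigma ^+ 2.
Proof.
rewrite (mean_sum _ (fun i _ => nz_int t i)).
apply: (@le_trans _ _ (\sum_(i < N) sigma ^+ 2)); last by rewrite sumr_const card_ord mulr_natl.
by apply: ler_sum => i _; exact: mean_agent_noise_sqr.
Qed.

(** By convexity.  The samples of distinct agents at one time may be dependent,
    so there is no gain of a factor [N]. *)
Lemma mean_noise_average_sqr t : mean P (fun w => frob (nbar t w) ^+ 2) <= sigma ^+ 2.
Proof.
have N0 : 0 < N%:R :> R by rewrite ltr0n.
apply: (@le_trans _ _ (mean P (fun w => N%:R^-1 * \sum_i frob (nz i t%:Z w) ^+ 2))).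
  apply: mean_le; first exact: integ_frob_sqr (nbar_good t).
    by apply: integZ; apply: integ_sum.
  by move=> w; exact: frob_sqr_average.
rewrite meanZ; last exact: integ_sum.
by rewrite ler_pdivrMl // mean_sum_noise.
Qed.

Lemma mean_average_stoch_grad_sqr t :
  mean P (fun w => frob (average (fun i => g i t%:Z w)) ^+ 2)
  <= mean P (fun w => frob (b t w) ^+ 2) + sigma ^+ 2.
Proof.
have E w : frob (average (fun i => g i t%:Z w)) ^+ 2
    = frob (b t w) ^+ 2 + frob (nbar t w) ^+ 2 + 2 * dot (b t w) (nbar t w).
  rewrite average_stoch_gradE !frob_sqr_dot dotDl !dotDr (dotC (nbar t w) (b t w)); ring.
have i1 := integ_frob_sqr (b_good t); have i2 := integ_frob_sqr (nbar_good t).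
have i3 := integ_dot (b_good t) (nbar_good t).
rewrite (funext E) meanD; [|exact: integD|exact: integZ].
rewrite meanD // meanZ // (noise_average_orthogonal (b_good t)) mulr0 addr0 lerD2l.
exact: mean_noise_average_sqr.
Qed.

(** Between its minimum and the quadratic upper bound of [descent_lemma] at 0,
    the objective is dominated by an integrable function. *)
Lemma objective_integ t : integ P (fun w => f (Xbar x t%:Z w)).
Proof.
have fm : measurable_fun [set: Omega] (fun w => f (Xbar x t%:Z w)).
  have := @measurable_caratheodory R _ Omega n (fun y w => f y) (Xbar x t%:Z) _ _ _.
  apply => //; first by move=> w y; exact: differentiable_continuous (f_diff y).
  by move=> k; have [_ []] := Xbar_good t k.
pose u w := `|f 0| + `|f xstar| + (frob (gradient f 0) ^+ 2 + (1 + L / 2) * frob (Xbar x t%:Z w) ^+ 2).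
apply: (@integ_le _ _ _ P _ u) => //; last first.
  apply: integD; first exact: integ_cst.
  apply: integD; first exact: integ_cst.
  by apply: integZ; exact: integ_frob_sqr (Xbar_good t).
move=> w; rewrite /u; set y := Xbar x t%:Z w.
have up := descent_lemma f_diff f_smooth 0 y; rewrite addr0 in up.
have lo := xstar_min y.
have cs := dot_le_frob (gradient f 0) y.
have am : 0 <= (frob (gradient f 0) - frob y) ^+ 2 by exact: sqr_ge0.
have p1 := frob_ge0 (gradient f 0); have p2 := frob_ge0 y.
have n1 := ler_norm (f 0); have n2 := ler_norm (- f xstar); rewrite normrN in n2.
have q1 := normr_ge0 (f 0); have q2 := normr_ge0 (f xstar).
have L0 : 0 <= L / 2 * frob y ^+ 2 by rewrite mulr_ge0 ?sqr_ge0 // divr_ge0 // ltW.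
have r1 : 0 <= frob y ^+ 2 by exact: sqr_ge0.
have r2 : 0 <= frob (gradient f 0) ^+ 2 by exact: sqr_ge0.
have pq : frob (gradient f 0) * frob y <= frob (gradient f 0) ^+ 2 + frob y ^+ 2.
  by rewrite !expr2 in am r1 r2 *; nra.
rewrite ler_norml; apply/andP; split; lra.
Qed.

Definition mean_deviation t := mean P (deviation x t).
Definition mean_avg_gradient t := mean P (fun w => frob (b t w) ^+ 2).
Definition mean_gradient t := mean P (fun w => frob (gradient f (Xbar x t%:Z w)) ^+ 2).
Definition mean_objective t := mean P (fun w => f (Xbar x t%:Z w)).
Notation Sm := mean_deviation.
Notation Gm := mean_avg_gradient.
Notation Fm := mean_gradient.
Notation fm := mean_objective.

Let dev_integ t : integ P (deviation x t).
Proof.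
rewrite (funext (deviationE x t)); apply: integ_sum => i _.
exact: integ_frob_sqr (sq_adapted_vecB (x_good t i) (Xbar_good t)).
Qed.

(** In the descent lemma for the step of the average, the inner product of [a]
    and [b], the gradient at the average and the average of the gradients, is
    half of [|a|^2 + |b|^2 - |a - b|^2], where [|a - b|^2] is controlled by the
    deviations.  The noise enters through its square and through the inner
    product with a vector determined by the past, whose mean is zero. *)
Lemma expected_descent t : fm t.+1 <= fm t - alpha / 2 * Fm t
  - alpha / 2 * (1 - L * alpha) * Gm t + alpha * L ^+ 2 / (2 * N%:R) * Sm t
  + L * alpha ^+ 2 * sigma ^+ 2 / 2.
Proof.
have c0 : 0 <= L * alpha ^+ 2 / 2.
  by apply: divr_ge0 => //; apply: mulr_ge0; rewrite ?sqr_ge0 // ltW.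
have arith (p q r v y s2 : R) : y <= s2 -> p + - (alpha / 2) * q
    + - (alpha / 2 * (1 - L * alpha)) * r + v + L * alpha ^+ 2 / 2 * y
    <= p - alpha / 2 * q - alpha / 2 * (1 - L * alpha) * r + v + L * alpha ^+ 2 * s2 / 2.
  move=> ys; have := ler_wpM2l c0 ys; lra.
(* The vector paired with the noise: the part in [a] comes from the linear
   term of the descent lemma, the part in [b] from the quadratic one. *)
pose u w := (L * alpha ^+ 2) *: b t w - alpha *: a t w.
have u_good : sq_adapted_vec t%:Z u by apply: sq_adapted_vecB; [exact: sq_adapted_vecZ (b_good t)|exact: sq_adapted_vecZ (a_good t)].
have pathwise w : f (Xbar x t.+1%:Z w) <= f (Xbar x t%:Z w)
   + (- (alpha / 2)) * frob (a t w) ^+ 2 + (- (alpha / 2 * (1 - L * alpha))) * frob (b t w) ^+ 2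
   + alpha * L ^+ 2 / (2 * N%:R) * deviation x t w
   + L * alpha ^+ 2 / 2 * frob (nbar t w) ^+ 2 + dot (u w) (nbar t w).
  rewrite (Xbar_step x_MILE WT W1) average_stoch_gradE.
  have := descent_lemma f_diff f_smooth (Xbar x t%:Z w) (- (alpha *: (b t w + nbar t w))).
  rewrite addrC => H; apply: le_trans H _.
  have := gradient_average_dist fi_diff fE (ltW L_gt0) N_gt0 smooth (x ^~ t%:Z ^~ w) (Xbar x t%:Z w).
  rewrite -/(avg_gradient x fi t%:Z w).
  have -> : \sum_i frob (Xbar x t%:Z w - x i t%:Z w) ^+ 2 = deviation x t w.
    rewrite deviationE; apply: eq_bigr => i _; rewrite !frob_sqr_dot -opprB.
    by rewrite dotNl dotNr opprK.
  rewrite /u; move: (a t w) (b t w) (nbar t w) => p q v.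
  rewrite !frob_sqr_dot !(dotDl, dotDr, dotNl, dotNr, dotZl, dotZr).
  rewrite (dotC v q) (dotC q p) => H.
  have N0 : N%:R != 0 :> R by rewrite pnatr_eq0 -lt0n.
  rewrite (_ : alpha * L ^+ 2 / (2 * N%:R) * deviation x t w
     = alpha / 2 * (L ^+ 2 * (N%:R^-1 * deviation x t w))); last by field.
  have := ler_wpM2l (_ : 0 <= alpha / 2) H; rewrite divr_ge0 ?(ltW alpha_gt0) // => /(_ isT).
  lra.
have ia := integ_frob_sqr (a_good t); have ib := integ_frob_sqr (b_good t).
have inb := integ_frob_sqr (nbar_good t); have iu := integ_dot u_good (nbar_good t).
have if0 := objective_integ t; have id := dev_integ t.
have combine (p q r v y z : Omega -> R) c1 c2 c3 c4 : integ P p -> integ P q -> integ P r ->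
    integ P v -> integ P y -> integ P z ->
    integ P (fun w => p w + c1 * q w + c2 * r w + c3 * v w + c4 * y w + z w) /\
    mean P (fun w => p w + c1 * q w + c2 * r w + c3 * v w + c4 * y w + z w)
    = mean P p + c1 * mean P q + c2 * mean P r + c3 * mean P v + c4 * mean P y + mean P z.
  move=> *; split; first by repeat (apply: integD || apply: integZ || assumption).
  rewrite !(meanD, meanZ) //; by repeat (apply: integD || apply: integZ || assumption).
have [iu' H] := combine _ _ _ _ _ _ (- (alpha / 2)) (- (alpha / 2 * (1 - L * alpha)))
  (alpha * L ^+ 2 / (2 * N%:R)) (L * alpha ^+ 2 / 2) if0 ia ib id inb iu.
apply: le_trans (mean_le (objective_integ t.+1) iu' pathwise) _.
rewrite H (noise_average_orthogonal u_good) addr0.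
exact: arith (mean_noise_average_sqr t).
Qed.

(** An increment of a stochastic gradient is that of the exact gradient plus the
    two noises; the square of a sum of three terms costs a factor 3. *)
Lemma gradient_increment t w : frob (grad_mx F zeta x t.+1 w - grad_mx F zeta x t w) ^+ 2 <=
  3 * L ^+ 2 * frob (Xmat x t.+1%:Z w - Xmat x t%:Z w) ^+ 2
  + (3 * \sum_i frob (nz i t.+1%:Z w) ^+ 2 + 3 * \sum_i frob (nz i t%:Z w) ^+ 2).
Proof.
have Ge s k i : grad_mx F zeta x s w k i = g i s%:Z w k 0 by rewrite [LHS]mxE.
have Xe s k i : Xmat x s%:Z w k i = x i s%:Z w k 0 by rewrite [LHS]mxE.
rewrite (frob_sqr_columns (v := fun i => g i t.+1%:Z w - g i t%:Z w)); last first.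
  by move=> k i; rewrite [LHS]mxE [X in _ + X]mxE !Ge [RHS]mxE [X in _ = _ + X]mxE.
rewrite (frob_sqr_columns (v := fun i => x i t.+1%:Z w - x i t%:Z w)); last first.
  by move=> k i; rewrite [LHS]mxE [X in _ + X]mxE !Xe [RHS]mxE [X in _ = _ + X]mxE.
have combine (p q r v : 'I_N -> R) c : (forall i, p i <= c * q i + (3 * r i + 3 * v i)) ->
    \sum_i p i <= c * \sum_i q i + (3 * \sum_i r i + 3 * \sum_i v i).
  by move=> pq; rewrite !mulr_sumr -!big_split; apply: ler_sum.
apply: combine => i.
have := smooth_sqr (ltW L_gt0) smooth i (x i t.+1%:Z w) (x i t%:Z w).
set u := gradient (fi i) _ - _ => H.
have -> : g i t.+1%:Z w - g i t%:Z w = u + nz i t.+1%:Z w - nz i t%:Z w.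
  rewrite /u /grad_noise; move: (g i t.+1%:Z w) (g i t%:Z w) (gradient _ _) (gradient _ _).
  by move=> p q r s; apply/colP => k; rewrite !mxE; ring.
move: (nz i t.+1%:Z w) (nz i t%:Z w) u H => p q u H.
have three : frob (u + p - q) ^+ 2 <= 3 * frob u ^+ 2 + (3 * frob p ^+ 2 + 3 * frob q ^+ 2).
  rewrite !frob_sqr_col !mulr_sumr -!big_split; apply: ler_sum => k _ /=; rewrite !mxE.
  have := sqr_ge0 (u k 0 - p k 0); have := sqr_ge0 (u k 0 + q k 0).
  have := sqr_ge0 (p k 0 + q k 0); rewrite !expr2; lra.
lra.
Qed.

Variable lam : seq R.
Variable e : rel 'I_N.
Hypotheses (N_ge2 : (2 <= N)%N) (tau_gt0 : (0 < tau)%N).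
Hypotheses (W_mix : mixing_matrix e W) (lamP : spectrum W lam).
Hypotheses (xi_gt0 : 0 < xi) (xi_lt : xi < 2 / (tau%:R + 3)).

Definition mean_iterate t := mean P (fun w => frob (Xmat x t%:Z w) ^+ 2).
Notation Em := mean_iterate.

Let X_integ t : integ P (fun w => frob (Xmat x t%:Z w) ^+ 2).
Proof.
have E w : frob (Xmat x t%:Z w) ^+ 2 = \sum_i frob (x i t%:Z w) ^+ 2.
  by apply: frob_sqr_columns => k i; rewrite mxE.
by rewrite (funext E); apply: integ_sum => i _; exact: integ_frob_sqr (x_good t i).
Qed.

Lemma expected_gradient_increment t :
  integ P (fun w => frob (grad_mx F zeta x t.+1 w - grad_mx F zeta x t w) ^+ 2) /\
  mean P (fun w => frob (grad_mx F zeta x t.+1 w - grad_mx F zeta x t w) ^+ 2)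
  <= 3 * L ^+ 2 * (2 * Sm t.+1 + 2 * Sm t + N%:R * alpha ^+ 2 * (Gm t + sigma ^+ 2))
     + 6 * N%:R * sigma ^+ 2.
Proof.
have arith (p q r s v G' ns c c' : R) : 0 <= c * c' -> r <= G' -> s <= ns -> v <= ns ->
    c * (2 * p + 2 * q + c' * r) + (3 * s + 3 * v) <= c * (2 * p + 2 * q + c' * G') + 6 * ns.
  move=> cc rG sn vn; have := ler_wpM2l cc rG; lra.
have gi : integ P (fun w => frob (grad_mx F zeta x t.+1 w - grad_mx F zeta x t w) ^+ 2).
  have E w : frob (grad_mx F zeta x t.+1 w - grad_mx F zeta x t w) ^+ 2
      = \sum_i frob (g i t.+1%:Z w - g i t%:Z w) ^+ 2.
    apply: frob_sqr_columns => k i; rewrite [LHS]mxE [X in _ + X]mxE.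
    by rewrite [RHS]mxE [X in _ = _ + X]mxE !(mxE _ (fun k i => g i _ w k 0)).
  rewrite (funext E); apply: integ_sum => i _.
  apply: integ_frob_sqr (sq_adapted_vecB (g_good t.+1 i) (sq_adapted_vec_mono _ (g_good t i))); lia.
split => //.
have gbar_good : sq_adapted_vec (t%:Z + 1) (fun w => average (fun i => g i t%:Z w)).
  exact: average_good (g_good t).
have igb := integ_frob_sqr gbar_good.
have id0 := dev_integ t; have id1 := dev_integ t.+1.
have in0 : integ P (fun w => \sum_i frob (nz i t%:Z w) ^+ 2) by exact: integ_sum.
have in1 : integ P (fun w => \sum_i frob (nz i t.+1%:Z w) ^+ 2) by exact: integ_sum.
pose u w := 3 * L ^+ 2 * (2 * deviation x t.+1 w + 2 * deviation x t w
  + N%:R * alpha ^+ 2 * frob (average (fun i => g i t%:Z w)) ^+ 2)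
  + (3 * \sum_i frob (nz i t.+1%:Z w) ^+ 2 + 3 * \sum_i frob (nz i t%:Z w) ^+ 2).
have iu : integ P u by repeat (apply: integD || apply: integZ || assumption).
have gu w : frob (grad_mx F zeta x t.+1 w - grad_mx F zeta x t w) ^+ 2 <= u w.
  apply: le_trans (gradient_increment t w) _; rewrite lerD2r.
  apply: ler_wpM2l; first by rewrite mulr_ge0 ?sqr_ge0.
  exact: (Xmat_increment x_MILE WT W1 N_gt0).
apply: le_trans (mean_le gi iu gu) _.
have combine (p q r s v : Omega -> R) c c' : integ P p -> integ P q -> integ P r ->
    integ P s -> integ P v ->
    mean P (fun w => c * (2 * p w + 2 * q w + c' * r w) + (3 * s w + 3 * v w))
    = c * (2 * mean P p + 2 * mean P q + c' * mean P r) + (3 * mean P s + 3 * mean P v).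
  move=> *; rewrite !(meanD, meanZ) //;
    by repeat (apply: integD || apply: integZ || assumption).
rewrite (combine _ _ _ _ _ _ _ id1 id0 igb in1 in0).
rewrite -[6 * _ * _]mulrA; apply: arith (mean_average_stoch_grad_sqr t) (mean_sum_noise t.+1) (mean_sum_noise t).
by apply: mulr_ge0; apply: mulr_ge0; rewrite ?sqr_ge0.
Qed.

Lemma expected_consensus K : \sum_(t < K.+1 * tau) Sm t.+1 <=
  (tau%:R - 1 + 8 * tau%:R * A4 N tau xi lam ^+ 2 / (1 - Num.sqrt (rho xi lam)))
    * (Em 0 + Em 1)
  + B2 N tau xi lam * alpha ^+ 2 * \sum_(t < K.+1 * tau)
     (3 * L ^+ 2 * (2 * Sm t.+1 + 2 * Sm t + N%:R * alpha ^+ 2 * (Gm t + sigma ^+ 2))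
     + 6 * N%:R * sigma ^+ 2).
Proof.
set C0 := _ - 1 + _.
have gi t := (expected_gradient_increment t).1.
have pw w := consensus_bound N_ge2 tau_gt0 W_mix lamP xi_gt0 xi_lt (Xmat_step x_MILE WT w) K.
rewrite -/C0 in pw.
have B0 : 0 <= B2 N tau xi lam * alpha ^+ 2.
  rewrite mulr_ge0 ?sqr_ge0 // (le_trans _ (B2_ge _ _ _ _)) // mulr_ge0 ?exprn_ge0 //.
have -> : \sum_(t < K.+1 * tau) Sm t.+1
    = mean P (fun w => \sum_(t < K.+1 * tau) deviation x t.+1 w) by rewrite mean_sum.
apply: (@le_trans _ _ (mean P (fun w => C0 * (frob (Xmat x 0%:Z w) ^+ 2 + frob (Xmat x 1%:Z w) ^+ 2)
   + B2 N tau xi lam * alpha ^+ 2 * \sum_(t < K.+1 * tau)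
       frob (grad_mx F zeta x t.+1 w - grad_mx F zeta x t w) ^+ 2))).
  apply: mean_le => [||w]; [| |exact: pw].
    by apply: integ_sum => t _; exact: dev_integ.
  by apply: integD; apply: integZ; [exact: integD | exact: integ_sum].
rewrite meanD; [|apply: integZ; exact: integD|apply: integZ; exact: integ_sum].
rewrite (meanZ _ (integD (X_integ 0) (X_integ 1))) meanZ; last exact: integ_sum.
rewrite (meanD (X_integ 0) (X_integ 1)) mean_sum // lerD2l; apply: ler_wpM2l => //.
by apply: ler_sum => t _; have [] := expected_gradient_increment t.
Qed.

Lemma mean_square_gradient_bound K : (0 < K)%N ->
  alpha <= 1 / (Num.sqrt (13 * B2 N tau xi lam) * L) ->
  (K.+1 * tau)%:R^-1 * \sum_(t < K.+1 * tau) Fm t.+1 <=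
  (2 * fm 1 - 2 * f xstar) / (alpha * tau%:R * K%:R)
  + (2 * Em 1 + 2 * Em 0) / (alpha ^+ 2 * rho xi lam ^+ 2 * tau%:R ^+ 4 * K%:R)
  + (12 * Em 1 + 12 * Em 0) / (tau%:R ^+ 3 * alpha ^+ 2 * K%:R)
  + 6 * Gm 0 / (tau%:R ^+ 3 * K%:R)
  + L * alpha * sigma ^+ 2
  + 156 * B2 N tau xi lam * alpha ^+ 2 * L ^+ 2 * sigma ^+ 2.
Proof.
move=> K0 al.
have [r0 r1] := rho_bounds N_ge2 tau_gt0 W_mix lamP xi_gt0 xi_lt.
have [C0 C0le] := @initial_constant_le _ N tau lam xi tau_gt0 r0 r1.
have B_ge := B2_ge N tau xi lam.
have Bp : 0 < B2 N tau xi lam.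
  by apply: lt_le_trans B_ge; rewrite mulr_gt0 // exprn_gt0 // ltr0n.
have al2 : 13 * B2 N tau xi lam * (alpha ^+ 2 * L ^+ 2) <= 1.
  have q0 : 0 <= 13 * B2 N tau xi lam by rewrite mulr_ge0 // ltW.
  have s0 : 0 < Num.sqrt (13 * B2 N tau xi lam) * L by rewrite mulr_gt0 // sqrtr_gt0 mulr_gt0.
  move: al; rewrite ler_pdivlMr // => al.
  rewrite -[X in X * _](sqr_sqrtr q0) -!exprMn.
  rewrite -[leRHS](expr1n _ 2) lerXn2r ?nnegrE //.
    by rewrite mulr_ge0 ?sqrtr_ge0 // mulr_ge0 // ltW.
  by rewrite mulrCA.
apply: (final_combination N_ge2 tau_gt0 K0 L_gt0 alpha_gt0 r0 B_ge C0 C0le al2 _ _ _ _ _ _ expected_descent (expected_consensus K)).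
- by apply: mean_ge0 => w; exact: sqr_ge0.
- by apply: mean_ge0 => w; exact: sqr_ge0.
- by apply: mean_le => // w; exact: deviation_le.
- by move=> t; apply: mean_ge0 => w; exact: sqr_ge0.
- by move=> t; apply: mean_ge0 => w; exact: sqr_ge0.
- move=> t; rewrite -(mean_cst P (f xstar)).
  by apply: mean_le => [||w]; [exact: integ_cst | exact: objective_integ | exact: xstar_min].
Qed.

Lemma expectation_gradient t :
  ('E_P[fun w => (frob (gradient f (Xbar x t%:Z w)) ^+ 2)%R] = (Fm t)%:E)%E.
Proof. by apply: expectation_mean; exact: integ_frob_sqr (a_good t). Qed.

Lemma expectation_objective t : ('E_P[fun w => f (Xbar x t%:Z w)] = (fm t)%:E)%E.
Proof. exact/expectation_mean/objective_integ. Qed.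

Lemma expectation_iterate t :
  ('E_P[fun w => (frob (Xmat x t%:Z w) ^+ 2)%R] = (Em t)%:E)%E.
Proof. exact/expectation_mean/X_integ. Qed.

Lemma expectation_avg_gradient t :
  ('E_P[fun w => (frob (avg_gradient x fi t%:Z w) ^+ 2)%R] = (Gm t)%:E)%E.
Proof. by apply: expectation_mean; exact: integ_frob_sqr (b_good t). Qed.

End Assembly.

(** * The convergence rate *)

Theorem theorem3 (R : realType) (N n tau K : nat)
  (N_ge2 : (2 <= N)%N) (n_ge1 : (1 <= n)%N)
  (tau_ge1 : (1 <= tau)%N) (K_ge1 : (1 <= K)%N)
  (dS : 'I_N -> measure_display) (S : forall i, measurableType (dS i))
  (D : forall i, probability (S i) R)
  (F : forall i, 'cV[R]_n -> S i -> R)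
  (fi : 'I_N -> 'cV[R]_n -> R)
  (objective : stoch_objective D F fi)
  (fi_diff : forall i (y : 'cV[R]_n), differentiable (fi i) y)
  (f : 'cV[R]_n -> R) (fE : forall y, f y = N%:R^-1 * \sum_i fi i y)
  (L : R) (L_gt0 : 0 < L)
  (smooth : forall i y z,
     frob (gradient (fi i) y - gradient (fi i) z) <= L * frob (y - z))
  (xstar : 'cV[R]_n) (xstar_min : forall y, f xstar <= f y)
  (e : rel 'I_N) (e_connected : connected_graph e)
  (W : 'M[R]_N) (W_mixing : mixing_matrix e W)
  (lam : seq R) (lamP : spectrum W lam)
  (sigma : R) (sigma_ge0 : 0 <= sigma)
  (noise : unbiased_bounded_variance D F fi sigma)
  (xi : R) (xi_gt0 : 0 < xi) (xi_lt : xi < 2 / (tau%:R + 3))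
  (d : measure_display) (Omega : measurableType d) (P : probability Omega R)
  (zeta : forall i, int -> {RV P >-> S i})
  (zeta_fresh : fresh_samples D zeta)
  (alpha : R) (alpha_gt0 : 0 < alpha)
  (alpha_le : alpha <= 1 / (Num.sqrt (13 * B2 N tau xi lam) * L))
  (xinit : 'I_N -> 'cV[R]_n) (x : 'I_N -> int -> Omega -> 'cV[R]_n)
  (x_MILE : MILE F zeta W tau xi alpha xinit x) :
  let T := (tau + tau * K)%N in
  let r := rho xi lam in
  let EX2 (t : int) := ('E_P[fun w => (frob (Xmat x t w) ^+ 2)%R])%E in
  ((T%:R^-1)%:E *
     \sum_(1 <= t < T.+1)
        'E_P[fun w => (frob (gradient f (Xbar x t w)) ^+ 2)%R]
   <= (2%:E * 'E_P[fun w => f (Xbar x 1%R w)] - (2 * f xstar)%:E)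
        / (alpha * tau%:R * K%:R)%:E
      + (2%:E * EX2 1%R + 2%:E * EX2 0%R)
        / (alpha ^+ 2 * r ^+ 2 * tau%:R ^+ 4 * K%:R)%:E
      + (12%:E * EX2 1%R + 12%:E * EX2 0%R)
        / (tau%:R ^+ 3 * alpha ^+ 2 * K%:R)%:E
      + 6%:E * 'E_P[fun w => (frob (avg_gradient x fi 0%R w) ^+ 2)%R]
        / (tau%:R ^+ 3 * K%:R)%:E
      + (L * alpha * sigma ^+ 2)%:E
      + (156 * B2 N tau xi lam * alpha ^+ 2 * L ^+ 2 * sigma ^+ 2)%:E)%E.
Proof.
cbv zeta.
have N_gt0 : (0 < N)%N by exact: ltnW.
have [_ WT kerW _] := W_mixing.
have W1 i : \sum_j W i j = 1.
  have /kerW : exists c : R, (const_mx 1 : 'cV[R]_N) = const_mx c by exists 1.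
  rewrite mulmxBl mul1mx => /eqP; rewrite subr_eq0 => /eqP/colP/(_ i).
  by rewrite !mxE => ->; apply: eq_bigr => j _; rewrite mxE mulr1.
have eG := expectation_gradient N_gt0 objective fi_diff fE L_gt0 smooth noise zeta_fresh x_MILE.
have eF := expectation_objective N_gt0 objective fi_diff fE L_gt0 smooth xstar_min noise zeta_fresh x_MILE.
have eX := expectation_iterate objective fi_diff L_gt0 smooth noise zeta_fresh x_MILE.
have eA := expectation_avg_gradient objective fi_diff L_gt0 smooth noise zeta_fresh x_MILE.
have main := mean_square_gradient_bound N_gt0 objective fi_diff fE L_gt0 smooth xstar_min
  noise zeta_fresh x_MILE alpha_gt0 WT W1 N_ge2 tau_ge1 W_mixing lamP xi_gt0 xi_lt K_ge1 alpha_le.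
have [rho_pos _] := rho_bounds N_ge2 tau_ge1 W_mixing lamP xi_gt0 xi_lt.
have div (p q : R) : q != 0 -> (p%:E / q%:E = (p / q)%:E)%E.
  by move=> q0; rewrite inver (negbTE q0).
have t0 : (tau%:R : R) != 0 by rewrite pnatr_eq0 -lt0n.
have k0 : (K%:R : R) != 0 by rewrite pnatr_eq0 -lt0n.
have a0 : alpha != 0 by rewrite gt_eqF.
have r0 : rho xi lam != 0 by rewrite gt_eqF.
rewrite (eF 1%N) (eX 1%N) (eX 0%N) (eA 0%N) big_add1 /= big_mkord.
rewrite (eq_bigr (fun t : 'I__ => (mean_gradient f P x t.+1)%:E)) => [|t _]; last exact: eG.
rewrite sumEFin -!EFinM -EFinB -!EFinD !div ?mulf_neq0 ?expf_neq0 // -!EFinD lee_fin.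
have -> : (tau + tau * K = K.+1 * tau)%N by rewrite mulSn mulnC.
exact: main.
Qed.
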